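(* Let $A$ be an ultramatricial R$^*$-algebra with property (N2). If $\mu\colon\mathcal{P}(A)\to\mathbb{R}$ is a finitely additive measure such that $\mu(\mathcal{P}(A))$ is a bounded subset of $\mathbb{R}$, then $\mu$ extends uniquely to a bounded linear functional on $A$.
   Context: A $^*$-algebra $A$ is an ultramatricial R$^*$-algebra if (up to $^*$-isomorphism) it is a $^*$-subalgebra of $B(H)$, $H$ a complex Hilbert space, equal to the union of an upward-directed family $(A_i)_{i\in I}$ of finite-dimensional $^*$-subalgebras; it has property (N2) if the family can be chosen so that no $A_i$ has a direct summand $^*$-isomorphic to the $2\times 2$ matrix algebra $M_2(\mathbb{C})$. $\mathcal{P}(A)$ is the set of projections $p=p^2=p^*$ of $A$. A finitely additive measure is a function $\mu\colon\mathcal{P}(A)\to\mathbb{R}$ with $\mu(p+q)=\mu(p)+\mu(q)$ whenever $p,q\in\mathcal{P}(A)$ satisfy $pq=0$. $A$ carries the operator norm. *)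

(* Defs.v *)
From HB Require Import structures.
From mathcomp Require Import all_boot all_algebra.
From mathcomp Require Import complex.
From mathcomp Require Import classical_sets reals.

Set Implicit Arguments.
Unset Strict Implicit.
Unset Printing Implicit Defensive.

Import GRing.Theory Num.Theory.
Local Open Scope ring_scope.
Local Open Scope classical_set_scope.

Section OperatorAlgebra.

Variable R : realType.
Local Notation C := (R[i]).

Variable H : lmodType C.
Variable ip : H -> H -> C.

Definition hnorm (x : H) : R := Num.sqrt (complex.Re (ip x x)).

Definition is_hilbert : Prop :=
  [/\ (forall (a : C) (x y z : H), ip (a *: x + y) z = a * ip x z + ip y z),
      (forall x y : H, ip y x = Num.conj (ip x y)),
      (forall x : H, 0 <= ip x x),
      (forall x : H, ip x x = 0 -> x = 0) &
      (forall u : nat -> H,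
        (forall e : R, 0 < e -> exists N : nat, forall m n : nat,
            (N <= m)%N -> (N <= n)%N -> hnorm (u m - u n) < e) ->
        exists l : H, forall e : R, 0 < e -> exists N : nat, forall n : nat,
            (N <= n)%N -> hnorm (u n - l) < e)].

Definition op_zero : H -> H := fun _ => 0.
Definition op_add (S T : H -> H) : H -> H := fun x => S x + T x.
Definition op_scale (a : C) (T : H -> H) : H -> H := fun x => a *: T x.

Definition bounded_op (T : H -> H) : Prop :=
  (forall (a : C) (x y : H), T (a *: x + y) = a *: T x + T y) /\
  (exists K : R, forall x : H, hnorm (T x) <= K * hnorm x).

Definition is_adjoint (T S : H -> H) : Prop :=
  forall x y : H, ip (T x) y = ip x (S y).

Definition opnorm (T : H -> H) : R :=
  sup [set hnorm (T x) | x in [set x : H | hnorm x <= 1]].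

Definition star_subalgebra (B : set (H -> H)) : Prop :=
  [/\ (forall T, B T -> bounded_op T),
      B op_zero /\
      (forall S T, B S -> B T -> B (op_add S T)),
      (forall a T, B T -> B (op_scale a T)),
      (forall S T, B S -> B T -> B (S \o T)) &
      (forall T, B T -> exists S, B S /\ is_adjoint T S)].

Definition fin_dim (B : set (H -> H)) : Prop :=
  exists (n : nat) (f : 'I_n -> H -> H), (forall i, B (f i)) /\
    forall T, B T -> exists c : 'I_n -> C,
      forall x : H, T x = \sum_(i < n) c i *: f i x.

Definition is_ideal (B J : set (H -> H)) : Prop :=
  [/\ J `<=` B, J op_zero,
      (forall S T, J S -> J T -> J (op_add S T)),
      (forall a T, J T -> J (op_scale a T)) &
      (forall S T, B S -> J T -> J (S \o T) /\ J (T \o S))].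

Definition mx_adj (n : nat) (a : 'M[C]_n) : 'M[C]_n := (map_mx Num.conj a)^T.

Definition star_iso_M2 (J : set (H -> H)) : Prop :=
  exists phi : 'M[C]_2 -> (H -> H),
    [/\ (forall a, J (phi a)),
        (forall T, J T -> exists a, phi a = T),
        injective phi /\
        (forall (c : C) a b, phi (c *: a + b) = op_add (op_scale c (phi a)) (phi b)),
        (forall a b, phi (a *m b) = phi a \o phi b) &
        (forall a, is_adjoint (phi a) (phi (mx_adj a)))].

Definition has_M2_summand (B : set (H -> H)) : Prop :=
  exists J K : set (H -> H),
    [/\ is_ideal B J, is_ideal B K,
        (forall T, J T -> K T -> T = op_zero),
        (forall T, B T -> exists j k, [/\ J j, K k & T = op_add j k]) &
        star_iso_M2 J].

Definition ultramatricial_N2 (A : set (H -> H)) : Prop :=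
  star_subalgebra A /\
  exists (I : Type) (Af : I -> set (H -> H)),
    [/\ (forall i, star_subalgebra (Af i) /\ fin_dim (Af i)),
        (forall i j, exists k, Af i `<=` Af k /\ Af j `<=` Af k),
        A = \bigcup_i Af i &
        (forall i, ~ has_M2_summand (Af i))].

Definition is_projection (A : set (H -> H)) (p : H -> H) : Prop :=
  [/\ A p, p \o p = p & is_adjoint p p].

Definition fin_add_measure (A : set (H -> H)) (mu : (H -> H) -> R) : Prop :=
  forall p q, is_projection A p -> is_projection A q -> p \o q = op_zero ->
    mu (op_add p q) = mu p + mu q.

Definition linear_on (A : set (H -> H)) (phi : (H -> H) -> C) : Prop :=
  forall (a : C) S T, A S -> A T ->
    phi (op_add (op_scale a S) T) = a * phi S + phi T.

Definition bounded_on (A : set (H -> H)) (phi : (H -> H) -> C) : Prop :=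
  exists c : R, forall T, A T -> Normc.normc (phi T) <= c * opnorm T.

Definition bdd_lin_ext (A : set (H -> H)) (mu : (H -> H) -> R)
    (phi : (H -> H) -> C) : Prop :=
  [/\ linear_on A phi, bounded_on A phi &
      forall p, is_projection A p -> phi p = ((mu p)%:C)%C].

End OperatorAlgebra.

(* Main.v *)
Require Import Defs.
From HB Require Import structures.
From mathcomp Require Import all_boot all_order all_algebra.
From mathcomp Require Import complex ring lra.
From mathcomp Require Import boolp classical_sets reals.
Set Implicit Arguments.
Unset Strict Implicit.
Unset Printing Implicit Defensive.
Import Order.TTheory GRing.Theory Num.Theory.
Local Open Scope ring_scope.

(* By directedness it suffices to extend mu on each finite-dimensional A_i: two linear
   functionals agreeing on projections agree on A_i, because a self-adjoint element is a
   real combination of spectral projections lying in A_i. The bound comes from the same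
   decomposition, as sum |mu p| <= 2 M over any orthogonal family of projections.

   In A_i a maximal orthogonal family of nonzero projections consists of minimal ones, and
   partial isometries between linked members give matrix units. A block of size n turns mu
   into a bounded frame function on the unit sphere of C^n; since n <> 2, Gleason's theorem
   applies, and a minimal projection is a ray of exactly one block.

   Gleason's theorem is first proved on R^3, by an approximate version of the argument of
   Cooke, Keane and Moran. If f is nearly maximal at p then f plus its quarter turn about p
   is nearly minimal along the equator of p, so by Piron's geometric lemma it is nearly
   affine in the squared sine of the latitude. Applying this at a near maximum p and at a
   near minimum orthogonal to p, f minus a quadratic form is nearly odd under permutations
   of the axes; the same statement at a near maximum of this difference forces it to be
   small. Hence f is a uniform limit of quadratic forms. In complex dimension at least 3,
   the polarization along orthogonal vectors is then real-linear in the coefficients. *)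

(** * Frame functions on the sphere of R^3 *)

(** A bounded frame function need not attain its supremum and is not known to be continuous, so no
    argument at a true maximum is available. Every step is therefore quantitative, with the
    tolerance chosen before the function: the number of moves in the descent lemma depends only on
    the gap in latitude, so an error [eps] per move is controlled for all functions at once. No
    limit of quadratic forms is extracted either: the approximating frames may vary with the
    tolerance, and the coefficients are read off from the function itself at six vectors. In the
    complex case the real theorem applies to real spans of orthogonal triples, and such a span never
    contains both [x] and [i x] for nonzero [x]. This is why additivity in the complex coefficient
    needs a separate argument. The algebras A_i need not contain the identity operator: polynomials
    in an element are taken without constant term, and units are built from projections. *)

Section Spiral.
Variable R : realType.
Implicit Types (u v : R[i]) (t c s : R).

(** Every factor [1 + i t] will cost one error term, so the number of factors is recorded and the
    values of [t] are not. *)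
Definition spiral (k : nat) u :=
  exists2 l : seq R, size l = k & u = \prod_(t <- l) Complex 1 t.

Lemma spiral_mul k1 k2 u v : spiral k1 u -> spiral k2 v -> spiral (k1 + k2) (u * v).
Proof.
move=> [l1 <- ->] [l2 <- ->]; exists (l1 ++ l2); first by rewrite size_cat.
by rewrite big_cat.
Qed.

Lemma spiral_exp k t : spiral k (Complex 1 t ^+ k).
Proof. by exists (nseq k t); rewrite ?size_nseq // big_nseq -Monoid.iteropE. Qed.

Lemma spiral_real r : 1 <= r -> spiral 2 (r%:C)%C.
Proof.
move=> hr; exists [:: Num.sqrt (r - 1); - Num.sqrt (r - 1)] => //.
rewrite !big_cons big_nil mulr1; have := sqr_sqrtr (a := r - 1); rewrite subr_ge0.
move=> /(_ hr) h; apply/eqP; rewrite eq_complex /=; apply/andP; split; apply/eqP; lra.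
Qed.

Lemma unit_sqrt c s : c ^+ 2 + s ^+ 2 = 1 ->
  exists c' s', [/\ c' ^+ 2 + s' ^+ 2 = 1, 0 <= c', 2 * c' ^+ 2 = 1 + c
    & Complex c' s' ^+ 2 = Complex c s].
Proof.
move=> h; have hc : -1 <= c <= 1 by apply/andP; split; nra.
have [h1 h2] := andP hc.
pose a := Num.sqrt ((1 + c) / 2); pose b := Num.sqrt ((1 - c) / 2).
have ha : a ^+ 2 = (1 + c) / 2 by apply: sqr_sqrtr; lra.
have hb : b ^+ 2 = (1 - c) / 2 by apply: sqr_sqrtr; lra.
have a0 : 0 <= a by apply: sqrtr_ge0. have b0 : 0 <= b by apply: sqrtr_ge0.
have hab : (2 * a * b) ^+ 2 = s ^+ 2.
  have -> : (2 * a * b) ^+ 2 = 4 * a ^+ 2 * b ^+ 2 by ring.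
  by rewrite ha hb; lra.
have [sg hsg hs] : exists2 sg, sg ^+ 2 = 1 & s = 2 * a * (sg * b).
  have /eqP := hab; rewrite eqf_sqr => /orP[/eqP e|/eqP e].
    by exists 1; rewrite ?expr1n // -[s]opprK; lra.
  by exists (-1); rewrite ?sqrrN ?expr1n //; lra.
exists a, (sg * b); split => //.
- by rewrite exprMn hsg ha hb; lra.
- by rewrite ha; lra.
apply/eqP; rewrite eq_complex /=; apply/andP; split; apply/eqP; last by rewrite hs; ring.
have -> : a * a - sg * b * (sg * b) = a ^+ 2 - sg ^+ 2 * b ^+ 2 by ring.
by rewrite hsg ha hb; lra.
Qed.

(** Halving the angle divides [1 - c'] by at least 3 while the exponent only doubles, so exponent
    times defect is of order (2/3)^n and tends to 0. *)
Lemma unit_root2n n c s : c ^+ 2 + s ^+ 2 = 1 ->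
  exists c' s', [/\ c' ^+ 2 + s' ^+ 2 = 1, 0 <= c', 1 - c' <= 3^-1 ^+ n
    & Complex c' s' ^+ (2 ^ n.+1) = Complex c s].
Proof.
elim: n => [|n IH] h.
  have [c' [s' [h1 h2 h3 h4]]] := unit_sqrt h; exists c', s'; split=> //.
  by rewrite expr0; lra.
have [c1 [s1 [h1 h2 h3 h4]]] := IH h.
have [c' [s' [k1 k2 k3 k4]]] := unit_sqrt h1; exists c', s'; split=> //.
  (* Since [c1 >= 0] forces [c' >= 1/2], we have 1 - c1 = 2 (1 - c') (1 + c') >= 3 (1 - c'). *)
  rewrite exprS; apply: (@le_trans _ _ (3^-1 * (1 - c1))); last by rewrite ler_pM2l // invr_gt0.
  have hc2 : 1 / 2 <= c' by rewrite leNgt; apply/negP => hlt; nra.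
  have hc1 : c' <= 1 by nra.
  have : 0 <= (1 - c') * (c' - 1 / 2) by rewrite mulr_ge0 // subr_ge0.
  by nra.
by rewrite expnS exprM k4.
Qed.

Lemma bernoulli (x : R) n : 0 <= x <= 1 -> 1 - n%:R * (1 - x) <= x ^+ n.
Proof.
move=> /andP[x0 x1]; elim: n => [|n IH]; first by rewrite expr0 mul0r subr0.
rewrite exprS -natr1; have : x ^+ n <= 1 by rewrite exprn_ile1.
have : 0 <= x ^+ n by rewrite exprn_ge0.
have : 0 <= n%:R * (1 - x) ^+ 2 by rewrite mulr_ge0 ?sqr_ge0.
have : x * (1 - n%:R * (1 - x)) <= x * x ^+ n by rewrite ler_wpM2l.
by move: (x ^+ n) IH (n%:R) => y IH m; nra.
Qed.

Lemma geo_small (e : R) : 0 < e -> exists n, (2 / 3) ^+ n <= e.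
Proof.
move=> e0; exists (2 * Num.bound e^-1)%N.
have hb : e^-1 < (Num.bound e^-1)%:R by apply: archi_boundP; rewrite invr_ge0 ltW.
set N := Num.bound _ in hb *.
rewrite -(ltr_pM2r e0) mulVf ?gt_eqF // in hb.
have : ((2 / 3) ^+ (2 * N) : R) * (1 + N%:R) <= 1.
  elim: (N) => [|m IH]; first by rewrite muln0 expr0 mul1r addr0.
  rewrite mulnS exprD -(natr1 m); have : 0 <= ((2 / 3) ^+ (2 * m) : R) by apply: exprn_ge0; lra.
  have : (0 : R) <= m%:R by [].
  have -> : ((2 / 3) ^+ 2 : R) = 4 / 9 by field.
  move: ((2 / 3) ^+ (2 * m)) (m%:R : R) IH => y z IH z0 y0.
  have : 0 <= y * z by rewrite mulr_ge0.
  by nra.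
have : 0 <= ((2 / 3) ^+ (2 * N) : R) by apply: exprn_ge0; lra.
have : 0 <= (N%:R : R) by [].
move: ((2 / 3) ^+ (2 * N)) (N%:R : R) hb => y z hb z0 y0 hy.
rewrite leNgt; apply/negP => lt_ey; have : 0 <= (y - e) * z by rewrite mulr_ge0 // subr_ge0 ltW.
by nra.
Qed.

(** The argument of the target is reached by a high power of [1 + i s/c], where [c + i s] is a root
    of the unit part. This overshoots the modulus 1 only by c^(-2^(n+1)), which Bernoulli keeps
    below the modulus of the target; the remaining real factor is at least 1 and is a product of two
    conjugate factors. The root order depends on [d] alone. *)
Lemma spiral_reach (d : R) : 0 < d -> exists k, forall x y, 1 + d <= x ^+ 2 + y ^+ 2 ->
  spiral k (Complex x y).
Proof.
move=> d0; pose e := Num.min (d / 8) (1 / 8).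
have e0 : 0 < e by rewrite lt_min; apply/andP; split; lra.
have [n hn] := geo_small e0.
exists (2 ^ n.+1 + 2)%N => x y hxy.
pose r := Num.sqrt (x ^+ 2 + y ^+ 2).
have hr : r ^+ 2 = x ^+ 2 + y ^+ 2 by apply: sqr_sqrtr; nra.
have r0 : 0 <= r by apply: sqrtr_ge0.
have r1 : 1 < r by nra.
have rn0 : r != 0 by apply: lt0r_neq0; lra.
have hu : (x / r) ^+ 2 + (y / r) ^+ 2 = 1.
  by rewrite !exprMn exprVn -mulrDl -hr divff // expf_neq0.
have [c [s [h1 h2 h3 h4]]] := unit_root2n n hu.
have e1 : e <= d / 8 by rewrite ge_min lexx.
have e2 : e <= 1 / 8 by rewrite ge_min lexx orbT.
have hc1 : c <= 1 by nra.
have hpow : 1 - 2 * e <= c ^+ (2 ^ n.+1).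
  apply: le_trans (bernoulli _ _); last by rewrite h2.
  rewrite lerD2l lerN2 natrX.
  apply: (@le_trans _ _ (2 ^+ n.+1 * 3^-1 ^+ n)).
    by rewrite ler_wpM2l // exprn_ge0.
  by rewrite exprS -mulrA -exprMn ler_pM2l.
have c0 : 0 < c.
  rewrite lt_def h2 andbT; apply/eqP => c00; move: hpow; rewrite c00 expr0n expn_eq0 /=.
  by lra.
have hE : Complex x y = (Complex 1 (s / c)) ^+ (2 ^ n.+1) * ((r * c ^+ (2 ^ n.+1))%:C)%C.
  have -> : Complex 1 (s / c) = Complex c s * ((c^-1)%:C)%C.
    apply/eqP; rewrite eq_complex /=.
    by apply/andP; split; apply/eqP; field; rewrite gt_eqF.
  rewrite exprMn h4 -mulrA -rmorphXn -rmorphM /=.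
  rewrite mulrCA -exprMn mulVf ?gt_eqF // expr1n mulr1.
  apply/eqP; rewrite eq_complex /=.
  by apply/andP; split; apply/eqP; field.
rewrite hE; apply: spiral_mul; first exact: spiral_exp.
apply: spiral_real; nra.
Qed.

End Spiral.

(** * Frame functions on R^3 and axial frame functions *)

Section Vec3.
Variable R : realType.
Definition vec3 : Type := (R * R * R)%type.
Implicit Types (u v w s t n e : vec3).

Definition dot u v : R := u.1.1 * v.1.1 + u.1.2 * v.1.2 + u.2 * v.2.
Definition cross u v : vec3 :=
  (u.1.2 * v.2 - u.2 * v.1.2, u.2 * v.1.1 - u.1.1 * v.2, u.1.1 * v.1.2 - u.1.2 * v.1.1).
Definition comb a u b v : vec3 :=
  (a * u.1.1 + b * v.1.1, a * u.1.2 + b * v.1.2, a * u.2 + b * v.2).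

Lemma dotC u v : dot u v = dot v u.
Proof. rewrite /dot; ring. Qed.

Lemma dot_combr u a v b w : dot u (comb a v b w) = a * dot u v + b * dot u w.
Proof. rewrite /dot /=; ring. Qed.

Lemma dot_combl u a v b w : dot (comb a v b w) u = a * dot v u + b * dot w u.
Proof. rewrite /dot /=; ring. Qed.

Lemma dot_crossl u v : dot u (cross u v) = 0.
Proof. rewrite /dot /=; ring. Qed.

Lemma dot_crossr u v : dot v (cross u v) = 0.
Proof. rewrite /dot /=; ring. Qed.

Lemma dot_cross u v : dot (cross u v) (cross u v) = dot u u * dot v v - dot u v ^+ 2.
Proof. rewrite /dot /=; ring. Qed.

Lemma dot_ge0 u : 0 <= dot u u.
Proof. by rewrite /dot; nra. Qed.

Lemma dot_gt0 u : dot u u != 0 -> 0 < dot u u.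
Proof. by move=> h; rewrite lt_def h dot_ge0. Qed.

Lemma equator_perp n : exists e : vec3, [/\ e.2 = 0, dot e e != 0 & dot n e = 0].
Proof.
have [/eqP h|h] := boolP ((n.1.1 == 0) && (n.1.2 == 0)).
  exists (1, 0, 0); split=> //=; first by rewrite /dot /= !mulr0 !addr0 mulr1 oner_neq0.
  by move/eqP/andP: h => [/eqP h1 /eqP h2]; rewrite /dot /= h1; ring.
exists (- n.1.2, n.1.1, 0); split=> //=; last by rewrite /dot /=; ring.
rewrite /dot /= mulr0 addr0 mulrNN -!expr2 paddr_eq0 ?sqr_ge0 // !sqrf_eq0 andbC.
exact: h.
Qed.

Definition frame (f : vec3 -> R) (W : R) := forall u v w,
  dot u u != 0 -> dot v v != 0 -> dot w w != 0 ->
  dot u v = 0 -> dot u w = 0 -> dot v w = 0 -> f u + f v + f w = W.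

Section Frame.
Variables (f : vec3 -> R) (W : R).
Hypothesis Hf : frame f W.

Lemma frame_cross u v : dot u u != 0 -> dot v v != 0 -> dot u v = 0 ->
  f u + f v + f (cross u v) = W.
Proof.
move=> hu hv huv; apply: Hf => //; first 1 last.
- exact: dot_crossl.
- exact: dot_crossr.
by rewrite dot_cross huv expr0n subr0 mulf_neq0.
Qed.

(** The two vectors on the right are orthogonal and span the same plane as [u] and [v]; both pairs
    are completed to a frame by [cross u v]. *)
Lemma frame_rot u v a b : dot u u != 0 -> dot v v != 0 -> dot u v = 0 ->
  (a != 0) || (b != 0) ->
  f u + f v = f (comb a u b v) + f (comb (- b * dot v v) u (a * dot u u) v).
Proof.
move=> hu hv huv hab.
have u0 := dot_gt0 hu; have v0 := dot_gt0 hv.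
have hvu : dot v u = 0 by rewrite dotC.
have pos : 0 < a ^+ 2 * dot u u + b ^+ 2 * dot v v.
  have a0 : 0 <= a ^+ 2 * dot u u by rewrite mulr_ge0 ?sqr_ge0 ?dot_ge0.
  have b0 : 0 <= b ^+ 2 * dot v v by rewrite mulr_ge0 ?sqr_ge0 ?dot_ge0.
  rewrite lt_def addr_ge0 // paddr_eq0 // !(mulf_eq0, orbb).
  by rewrite (negbTE hu) (negbTE hv) !orbF negb_and hab.
have := frame_cross hu hv huv => e1.
have e2 : f (comb a u b v) + f (comb (- b * dot v v) u (a * dot u u) v) + f (cross u v) = W.
  apply: Hf; rewrite ?dot_combr ?dot_combl ?dot_crossl ?dot_crossr ?huv ?hvu
    ?mulr0 ?addr0 ?add0r //.
  - by move: pos; rewrite !expr2 -!mulrA => /lt0r_neq0.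
  - have -> : - b * dot v v * (- b * dot v v * dot u u) + a * dot u u * (a * dot u u * dot v v)
      = (a ^+ 2 * dot u u + b ^+ 2 * dot v v) * (dot u u * dot v v) by ring.
    by rewrite !mulf_neq0 // gt_eqF.
  - by rewrite dot_cross huv expr0n subr0 mulf_neq0.
  - by ring.
by apply: (addIr (f (cross u v))); rewrite e1 e2.
Qed.

Lemma frame_scale a u : a != 0 -> dot u u != 0 -> f (comb a u 0 u) = f u.
Proof.
move=> a0 hu; have [e [e2 he hue]] := equator_perp u.
have h1 := frame_cross hu he hue.
have h2 : f (comb a u 0 u) + f e + f (cross u e) = W.
  apply: Hf; rewrite ?dot_combr ?dot_combl ?dot_crossl ?dot_crossr ?hue
    ?mulr0 ?mul0r ?addr0 ?add0r ?mulf_neq0 //.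
  by rewrite dot_cross hue expr0n subr0 mulf_neq0.
by apply: (addIr (f e)); apply: (addIr (f (cross u e))); rewrite h1 h2.
Qed.

End Frame.

(** The squared sine of the latitude, preferred to the angle because it is additive under
    [axial_split]. *)
Definition lat u := u.2 ^+ 2 / dot u u.

Lemma lat_ge0 u : 0 <= lat u.
Proof. by rewrite /lat divr_ge0 ?sqr_ge0 ?dot_ge0. Qed.

Section Axial.
Variables (G : vec3 -> R) (K eps : R).
Hypothesis HG : frame G K.
Hypothesis G_eq : forall e, dot e e != 0 -> e.2 = 0 -> G e = 0.
Hypothesis G_ge : forall e, dot e e != 0 -> - eps <= G e.

Lemma axial_eps_ge0 : 0 <= eps.
Proof.
have h : dot ((1, 0, 0) : vec3) (1, 0, 0) != 0 by rewrite /dot /= !mulr0 !addr0 mulr1 oner_neq0.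
by have := G_ge h; rewrite G_eq // oppr_le0.
Qed.

Lemma axial_compl s : dot s s != 0 ->
  exists s', [/\ dot s' s' != 0, lat s' = 1 - lat s & G s + G s' = K].
Proof.
move=> hs; have [e [e2 he hse]] := equator_perp s.
have hc : dot (cross s e) (cross s e) = dot s s * dot e e by rewrite dot_cross hse expr0n subr0.
have hc0 : dot (cross s e) (cross s e) != 0 by rewrite hc mulf_neq0.
exists (cross s e); split => //; last first.
  by rewrite -(frame_cross HG hs he hse) (G_eq he e2) addr0.
rewrite /lat hc; move: hs he; case: s hse {hc hc0} => [[x y] z]; case: e e2 => [[a b] c] /= ->.
rewrite /dot /= => h hs he.
have hz : (x * b - y * a) ^+ 2 = (x * x + y * y) * (a * a + b * b).
  transitivity ((x * x + y * y) * (a * a + b * b) - (x * a + y * b + z * 0) ^+ 2); first ring.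
  by rewrite h expr0n subr0.
rewrite hz; field; rewrite hs.
by move: he; rewrite mulr0 addr0.
Qed.

(** On the great circle whose northernmost point is [n], an orthogonal pair has latitudes adding up
    to that of [n], and the equatorial point of the circle contributes 0. The rotation angle has
    cosine and sine in the ratio sqrt x : sqrt y; the factors [p] and [q] compensate for the lengths
    of [n] and [e]. *)
Lemma axial_split n x y : dot n n != 0 -> 0 <= x -> 0 <= y -> lat n = x + y ->
  exists s t, [/\ dot s s != 0, dot t t != 0, lat s = x, lat t = y & G n = G s + G t].
Proof.
move=> hn x0 y0 hl.
have [n0|n0] := eqVneq n.2 0.
  move: hl; rewrite /lat n0 expr0n mul0r => hl; have ex : x = 0 by lra.
  have ey : y = 0 by lra.
  exists n, n; rewrite ex ey /lat n0 expr0n mul0r; split => //.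
  by rewrite (G_eq hn n0) addr0.
have [e [e2 he hne]] := equator_perp n.
have hen : dot e n = 0 by rewrite dotC.
have n1 := dot_gt0 hn; have e1 := dot_gt0 he.
have X0 : 0 < x + y by rewrite -hl /lat divr_gt0 // exprn_even_gt0.
pose a := Num.sqrt x; pose b := Num.sqrt y.
pose p := Num.sqrt (dot n n); pose q := Num.sqrt (dot e e).
have ha : a ^+ 2 = x by apply: sqr_sqrtr. have hb : b ^+ 2 = y by apply: sqr_sqrtr.
have hp : p ^+ 2 = dot n n by apply: sqr_sqrtr; apply: ltW.
have hq : q ^+ 2 = dot e e by apply: sqr_sqrtr; apply: ltW.
have p0 : p != 0 by apply/eqP => z; rewrite -hp z expr0n eqxx in hn.
have q0 : q != 0 by apply/eqP => z; rewrite -hq z expr0n eqxx in he.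
have hz : n.2 ^+ 2 = (a ^+ 2 + b ^+ 2) * p ^+ 2.
  by rewrite ha hb hp -hl /lat divfK.
have ab0 : a ^+ 2 + b ^+ 2 != 0 by rewrite ha hb gt_eqF.
have hab : (a * q != 0) || (b * p != 0).
  rewrite -negb_and; apply/negP => /andP[]; rewrite !mulf_eq0 (negbTE p0) (negbTE q0) !orbF.
  by move=> /eqP za /eqP zb; rewrite za zb expr0n addr0 eqxx in ab0.
have key := frame_rot HG hn he hne hab.
exists (comb (a * q) n (b * p) e), (comb (- (b * p) * dot e e) n (a * q * dot n n) e).
have d1 : dot (comb (a * q) n (b * p) e) (comb (a * q) n (b * p) e)
   = (a ^+ 2 + b ^+ 2) * p ^+ 2 * q ^+ 2.
  by rewrite dot_combr !dot_combl hne hen -hp -hq; ring.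
have d2 : dot (comb (- (b * p) * dot e e) n (a * q * dot n n) e)
    (comb (- (b * p) * dot e e) n (a * q * dot n n) e) = (a ^+ 2 + b ^+ 2) * p ^+ 4 * q ^+ 4.
  by rewrite dot_combr !dot_combl hne hen -hp -hq; ring.
split.
- by rewrite d1 !mulf_neq0 // expf_neq0.
- by rewrite d2 !mulf_neq0 // expf_neq0.
- rewrite /lat d1 /= e2 mulr0 addr0 exprMn hz -ha; field.
  by rewrite ab0 p0 q0.
- rewrite /lat d2 /= e2 mulr0 addr0 exprMn hz -hb -hq; field.
  by rewrite ab0 p0 q0.
by rewrite -key (G_eq he e2) addr0.
Qed.

Lemma axial_chain_le c A : 0 <= c ->
  (forall s, dot s s != 0 -> lat s = c -> G s <= A) ->
  forall j n, dot n n != 0 -> lat n = j.+1%:R * c -> G n <= j.+1%:R * A.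
Proof.
move=> c0 hA; elim=> [|j IH] n hn; first by rewrite !mul1r; apply: hA.
rewrite -(natr1 j.+1) !mulrDl !mul1r => hl.
have [s [t [hs ht ls lt ->]]] := axial_split hn (mulr_ge0 (ler0n _ j.+1) c0) c0 hl.
by apply: lerD; [apply: IH | apply: hA].
Qed.

Lemma axial_chain_ge c A : 0 <= c ->
  (forall s, dot s s != 0 -> lat s = c -> A <= G s) ->
  forall j n, dot n n != 0 -> lat n = j.+1%:R * c -> j.+1%:R * A <= G n.
Proof.
move=> c0 hA; elim=> [|j IH] n hn; first by rewrite !mul1r; apply: hA.
rewrite -(natr1 j.+1) !mulrDl !mul1r => hl.
have [s [t [hs ht ls lt ->]]] := axial_split hn (mulr_ge0 (ler0n _ j.+1) c0) c0 hl.
by apply: lerD; [apply: IH | apply: hA].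
Qed.

(** One factor [1 + i t] replaces a point by a rotated one, and [frame_rot] shows that [G] changes
    by minus its value at the partner point, hence increases by at most [eps]. *)
Lemma axial_spiral k (z u : R[i]) : z != 0 -> spiral k u ->
  G (complex.Re (z * u), complex.Im (z * u), 1)
    <= G (complex.Re z, complex.Im z, 1) + k%:R * eps.
Proof.
move=> z0 [l <- ->] {k u}; elim: l z z0 => [|t l IH] z z0.
  by rewrite big_nil mulr1 mul0r addr0.
rewrite big_cons mulrA; have t0 : Complex 1 t != 0.
  by rewrite eq_complex /= negb_and oner_neq0.
apply: le_trans (IH _ (mulf_neq0 z0 t0)) _; rewrite /= -addn1 natrD mulrDl mul1r.
rewrite [_ * eps + eps]addrC addrA lerD2r; case: z z0 => x y; rewrite eq_complex /= => z0.
have h1 : dot (x, y, 1) (x, y, 1) != 0 by rewrite /dot /= gt_eqF //; nra.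
have h2 : dot (- y, x, 0) (- y, x, 0) != 0.
  rewrite /dot /= mulr0 addr0 mulrNN -!expr2 paddr_eq0 ?sqr_ge0 // !sqrf_eq0.
  by rewrite andbC.
have h3 : dot (x, y, 1) (- y, x, 0) = 0 by rewrite /dot /=; ring.
have h := frame_rot HG (a := 1) (b := t) h1 h2 h3 _; move: h; rewrite oner_neq0 => /(_ isT).
rewrite (G_eq h2 erefl) addr0 => ->.
have -> : comb 1 (x, y, 1) t (- y, x, 0) = (x * 1 - y * t, x * t + y * 1, 1).
  by rewrite /comb /=; congr (_, _, _); ring.
set s := comb _ _ _ _; rewrite -addrA lerDl; have : - eps <= G s; last by lra.
apply: G_ge; rewrite /s dot_combr !dot_combl h3 dotC h3.
move: (dot_gt0 h1) (dot_gt0 h2); move: (dot (x, y, 1) (x, y, 1)) (dot (- y, x, 0) (- y, x, 0)).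
move=> q p q0 p0; rewrite gt_eqF //.
have : 0 < p * q * q by rewrite !mulr_gt0.
have : 0 <= (t * p) ^+ 2 * q by rewrite mulr_ge0 ?sqr_ge0 // ltW.
by nra.
Qed.

End Axial.
End Vec3.

(** * Axial frame functions are nearly proportional to the squared sine of the latitude *)

Section AxialApprox.
Variable R : realType.
Implicit Types (G : vec3 R -> R) (s t n : vec3 R) (K eps d : R).

Definition axial G (K eps : R) :=
  [/\ frame G K, (forall e, dot e e != 0 -> e.2 = 0 -> G e = 0)
    & (forall e, dot e e != 0 -> - eps <= G e)].

Lemma axial_pole G K eps : axial G K eps -> G (0, 0, 1) = K.
Proof.
case=> HG G_eq _; pose x : vec3 R := (1, 0, 0); pose y : vec3 R := (0, 1, 0).
have hx : dot x x != 0 by rewrite /dot /= !mulr0 !addr0 mulr1 oner_neq0.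
have hy : dot y y != 0 by rewrite /dot /= !mulr0 add0r !addr0 mulr1 oner_neq0.
have hxy : dot x y = 0 by rewrite /dot /=; ring.
have := frame_cross HG hx hy hxy.
have -> : cross x y = (0, 0, 1) by rewrite /cross /=; congr (_, _, _); ring.
by rewrite (G_eq _ hx) // (G_eq _ hy) // !add0r.
Qed.

Lemma axial_le_pole G K eps s : axial G K eps -> dot s s != 0 -> G s <= K + eps.
Proof.
case=> HG G_eq G_ge hs; have [s' [hs' _ <-]] := axial_compl HG G_eq hs.
by have := G_ge _ hs'; lra.
Qed.

(* Piron's geometric lemma: in the gnomonic chart z = 1 a step along the great
   circle through a point whose northernmost point it is reads as multiplication
   of the complex coordinate by 1 + it. *)
Lemma axial_descent d : 0 < d -> exists k : nat, forall G K eps, axial G K eps ->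
  forall s t, dot s s != 0 -> dot t t != 0 -> lat s + d <= lat t -> G s <= G t + k%:R * eps.
Proof.
move=> d0; have [k hk] := spiral_reach d0; exists k.+1 => G K eps ax s t hs ht hst.
have [HG G_eq G_ge] := ax; have eps0 := axial_eps_ge0 G_eq G_ge.
have keps : 0 <= k%:R * eps by rewrite mulr_ge0.
rewrite -(natr1 k) mulrDl mul1r.
have t2 : t.2 != 0.
  apply/eqP => z; move: hst; rewrite [lat t]/lat z expr0n mul0r => h.
  by have := lat_ge0 s; lra.
have [s2|s2] := eqVneq s.2 0.
  by rewrite (G_eq _ hs s2); have := G_ge _ ht; lra.
have scl : forall w : vec3 R, dot w w != 0 -> w.2 != 0 -> G w = G (w.1.1 / w.2, w.1.2 / w.2, 1).
  move=> w hw w2; rewrite -(frame_scale HG (a := w.2^-1) _ hw) ?invr_neq0 //.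
  by congr G; rewrite /comb; congr (_, _, _); rewrite mul0r addr0 ?mulVf // mulrC.
have lt1 : forall w : vec3 R, w.2 != 0 -> lat w = (1 + ((w.1.1 / w.2) ^+ 2 + (w.1.2 / w.2) ^+ 2))^-1.
  move=> [[x y] z] /= z0; rewrite /lat /dot /=; field; rewrite z0 !gt_eqF //.
  have : 0 < z ^+ 2 by rewrite exprn_even_gt0.
  by nra.
rewrite (scl s) // (scl t) //; move: hst; rewrite !lt1 //.
move: (s.1.1 / s.2) (s.1.2 / s.2) (t.1.1 / t.2) (t.1.2 / t.2) => x y a b.
have [h0|h0] := eqVneq (Complex a b) 0.
  move/eqP: h0; rewrite eq_complex /= => /andP[/eqP -> /eqP ->] _; rewrite (axial_pole ax).
  have h : dot (x, y, 1) (x, y, 1) != 0 by rewrite /dot /= gt_eqF //; nra.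
  by have := axial_le_pole ax h; lra.
move=> hst; pose u := Complex x y / Complex a b.
have hu : Complex a b * u = Complex x y by rewrite /u mulrC divfK.
suff su : spiral k u.
  have := axial_spiral HG G_eq G_ge h0 su; rewrite hu /=; lra.
have hA : 0 < a ^+ 2 + b ^+ 2.
  move: h0; rewrite eq_complex /= => h0.
  by rewrite lt_def addr_ge0 ?sqr_ge0 // paddr_eq0 ?sqr_ge0 // !sqrf_eq0 h0.
move: hu {h0}; case: u => p q [hx hy]; apply: hk.
have hX : x ^+ 2 + y ^+ 2 = (a ^+ 2 + b ^+ 2) * (p ^+ 2 + q ^+ 2) by rewrite -hx -hy; ring.
move: hst; rewrite {}hX; have : 0 <= p ^+ 2 + q ^+ 2 by rewrite addr_ge0 ?sqr_ge0.
move: (a ^+ 2 + b ^+ 2) (p ^+ 2 + q ^+ 2) hA => A P A0 P0.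
(* Clearing denominators turns the gap into A + d (1 + A P) (1 + A) <= A P. The middle term is at
   least d A, so P >= 1 + d, which is what [spiral_reach] asks for. *)
have AP : 0 <= A * P by rewrite mulr_ge0 // ltW.
rewrite -(ler_pM2r (_ : 0 < (1 + A * P) * (1 + A))); last by rewrite mulr_gt0 //; lra.
have -> : ((1 + A * P)^-1 + d) * ((1 + A * P) * (1 + A)) = (1 + A) + d * ((1 + A * P) * (1 + A)).
  by field; rewrite gt_eqF //; lra.
have -> : (1 + A)^-1 * ((1 + A * P) * (1 + A)) = 1 + A * P.
  by field; rewrite gt_eqF //; lra.
move=> h; have : d * A <= d * ((1 + A * P) * (1 + A)) by rewrite ler_wpM2l //; nra.
move=> h'; rewrite -(ler_pM2l A0); lra.
Qed.

Lemma lat_exists x : 0 <= x <= 1 -> exists n, dot n n != 0 /\ lat n = x.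
Proof.
move=> /andP[x0 x1]; pose a := Num.sqrt x; pose b := Num.sqrt (1 - x).
have ha : a ^+ 2 = x by apply: sqr_sqrtr.
have hb : b ^+ 2 = 1 - x by apply: sqr_sqrtr; lra.
have h : dot ((b, 0, a) : vec3 R) (b, 0, a) = 1 by rewrite /dot /= -!expr2 ha hb; ring.
by exists (b, 0, a); rewrite /lat h oner_neq0 divr1 /= ha.
Qed.

(* Superadditivity of [G] along latitudes and the descent lemma pin [G] at latitude
   1/b from below by about K/(b+1); complementing gives the upper bound at latitude a/b. *)
Lemma axial_upper (b : nat) G (K K0 eps e : R) : axial G K eps -> `|K| <= K0 -> 0 <= e ->
  (forall s t, dot s s != 0 -> dot t t != 0 ->
    lat s + (b.+1%:R * b.+2%:R)^-1 <= lat t -> G s <= G t + e) ->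
  forall s, dot s s != 0 -> G s <= K * lat s + 3 * K0 / b.+1%:R + b.+2%:R * e + eps.
Proof.
move=> ax hK e0 hmono s hs; have [HG G_eq G_ge] := ax; have eps0 := axial_eps_ge0 G_eq G_ge.
have [B EB] : exists B : R, B = b.+1%:R by eexists.
have hB : b.+2%:R = B + 1 :> R by rewrite -natr1 EB.
have B0 : 1 <= B by rewrite EB ler1n.
rewrite hB -EB in hmono *.
set d := (B * (B + 1))^-1 in hmono.
have Bn0 : B != 0 by rewrite gt_eqF //; lra.
have B1n0 : B + 1 != 0 by rewrite gt_eqF //; lra.
have dE : B^-1 - (B + 1)^-1 = d by rewrite /d; field; rewrite B1n0 Bn0.
have dB : d * B <= 1.
  have -> : d * B = (B + 1)^-1 by rewrite /d; field; rewrite B1n0 Bn0.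
  by rewrite invf_le1 //; lra.
have d0 : 0 <= d by rewrite invr_ge0 mulr_ge0 //; lra.
have K1 : 0 <= K0 by apply: le_trans hK.
have KK : K <= K0 by apply: le_trans hK; apply: ler_norm.
have pole : dot ((0, 0, 1) : vec3 R) (0, 0, 1) != 0 by rewrite /dot /= !mulr0 !add0r mulr1 oner_neq0.
have latpole : lat ((0, 0, 1) : vec3 R) = 1 by rewrite /lat /dot /=; field.
(* The pole is a sum of B + 1 points at latitude 1/(B + 1), and [d] is exactly the gap from there to
   1/B, so the descent hypothesis bounds all of them by [G t + e]. *)
have low1 t : dot t t != 0 -> lat t = B^-1 -> K / (B + 1) - e <= G t.
  move=> ht lt; have := axial_chain_le HG G_eq (c := (B + 1)^-1) (A := G t + e) _ _ (j := b.+1) pole.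
  rewrite invr_ge0 (axial_pole ax) latpole hB mulfV //; move=> H.
  have {}H : K <= (B + 1) * (G t + e).
    apply: H => //; first lra.
    by move=> s' hs' ls'; apply: hmono => //; rewrite ls' lt -dE; lra.
  have B1 : 0 < B + 1 by clear -B0; lra.
  by rewrite lerBlDr ler_pdivrMr // [_ * (B + 1)]mulrC.
(* The latitude a/B lies above that of [s] by at least [d], so that descent applies, and by at most
   d + 1/B. *)
have [a [ha1 ha2]] : exists a : nat, a%:R <= B * lat s + d * B + 1 /\ B * lat s + d * B <= a%:R.
  have y0 : 0 <= B * lat s + d * B by apply: addr_ge0; apply: mulr_ge0; rewrite ?lat_ge0 //; lra.
  have /andP[h1 h2] := truncn_itv y0.
  exists (Num.truncn (B * lat s + d * B)).+1; split; last exact: ltW.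
  by rewrite -natr1 lerD2r.
(* If no such multiple of 1/B lies below 1, then [s] is within 2/B of the pole and the crude bound
   [K + eps] is good enough. *)
have [lt_ab|le_ba] := ltnP a b.+1; last first.
  have hle : B <= a%:R by rewrite EB ler_nat.
  have := axial_le_pole ax hs => hu.
  have hl : B * (1 - lat s) <= 2 by lra.
  have : K * (1 - lat s) <= 3 * K0 / B; last by nra.
  rewrite ler_pdivlMr; last lra.
  have l1 : lat s <= 1.
    have [s' [_ hl' _]] := axial_compl HG G_eq hs.
    by have := lat_ge0 s'; lra.
  apply: (@le_trans _ _ (K0 * (B * (1 - lat s)))); last by nra.
  by rewrite -mulrA [_ * B]mulrC ler_wpM2r // mulr_ge0 //; lra.
have ha : a%:R + 1 <= B :> R by rewrite EB natr1 ler_nat.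
have hab : 0 <= a%:R / B <= 1.
  by rewrite divr_ge0 //=; [rewrite ler_pdivrMr; lra | lra].
have [n [hn ln]] := lat_exists hab.
have [n' [hn' ln' hnn']] := axial_compl HG G_eq hn.
have h1 : G s <= G n + e.
  by apply: hmono => //; rewrite ln ler_pdivlMr; lra.
have h2 : (B - a%:R) * (K / (B + 1) - e) <= G n'.
  have /subnKC hj : (a < b.+1)%N by [].
  have hj' : (b.+1 - a.+1).+1%:R = B - a%:R :> R.
    by rewrite -natr1 natrB // -natr1 EB; ring.
  rewrite -hj'; apply: (axial_chain_ge HG G_eq (c := B^-1) _ low1 hn').
    by rewrite invr_ge0; lra.
  by rewrite ln' ln hj'; field.
have h3 : G s <= K * ((a%:R + 1) / (B + 1)) + (B - a%:R + 1) * e.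
  have -> : K * ((a%:R + 1) / (B + 1)) + (B - a%:R + 1) * e
    = K - (B - a%:R) * (K / (B + 1) - e) + e by field.
  by lra.
have h4 : (B - a%:R + 1) * e <= (B + 1) * e by rewrite ler_wpM2r // lerD2r gerBl.
suff : K * ((a%:R + 1) / (B + 1) - lat s) <= 3 * K0 / B by lra.
have th0 : 0 <= (a%:R + 1) / (B + 1) - lat s.
  rewrite subr_ge0 ler_pdivlMr; last lra.
  have Bd0 : 0 <= d * B by rewrite mulr_ge0 //; lra.
  have lB : lat s * B <= B by lra.
  have : lat s <= 1 by move: lB; rewrite -{2}[B]mul1r ler_pM2r //; lra.
  by lra.
apply: (@le_trans _ _ (K0 * ((a%:R + 1) / (B + 1) - lat s))); first by rewrite ler_wpM2r.
rewrite -mulrA [3 * _]mulrC -mulrA; apply: ler_wpM2l => //.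
rewrite lerBlDr ler_pdivrMr; last lra.
have -> : (B^-1 * 3 + lat s) * (B + 1) = 3 + 3 / B + B * lat s + lat s by field.
have : 0 <= 3 / B by rewrite divr_ge0; lra.
by have := lat_ge0 s; lra.
Qed.

(** Half of [eta] pays for the mesh 1/b and half for the accumulated descent errors. The count [k]
    does not depend on [G], so neither does [eps]. The lower bound is the upper bound at a point of
    complementary latitude. *)
Lemma axial_approx (K0 eta : R) : 0 <= K0 -> 0 < eta -> exists2 eps, 0 < eps & forall G K,
  axial G K eps -> `|K| <= K0 -> forall s, dot s s != 0 -> `|G s - K * lat s| <= eta.
Proof.
move=> K1 eta0; pose b := Num.bound (6 * K0 / eta).
have hb : 6 * K0 / eta < b%:R.
  by apply: archi_boundP; rewrite divr_ge0 ?mulr_ge0 // ltW.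
have d0 : 0 < ((b.+1%:R * b.+2%:R)^-1 : R) by rewrite invr_gt0 mulr_gt0.
have [k hk] := axial_descent d0.
pose N : R := b.+2%:R * k%:R + 1; have N0 : 0 < N by rewrite ltr_wpDl // mulr_ge0.
exists (eta / 2 / N) => [|G K ax hK]; first by rewrite !divr_gt0.
set eps := eta / 2 / N in ax *; have eps0 : 0 <= eps by rewrite !divr_ge0 // ltW.
have hN : b.+2%:R * (k%:R * eps) + eps = eta / 2.
  by rewrite mulrA -[X in _ + X]mul1r -mulrDl -/N /eps mulrC divfK ?gt_eqF.
have hb2 : 3 * K0 / b.+1%:R <= eta / 2.
  rewrite ler_pdivrMr //; move: hb; rewrite ltr_pdivrMr // -(natr1 b).
  by move: (b%:R : R) => z; lra.
have up s : dot s s != 0 -> G s <= K * lat s + eta.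
  move=> hs; have := axial_upper ax hK (mulr_ge0 (ler0n _ k) eps0) (hk _ _ _ ax) hs.
  rewrite -addrA hN => h; apply: le_trans h _; rewrite -addrA lerD2l.
  by apply: le_trans (lerD hb2 (lexx _)) _; lra.
move=> s hs; rewrite ler_norml; apply/andP; split; last by have := up _ hs; lra.
have [HG G_eq _] := ax; have [s' [hs' ls' hss']] := axial_compl HG G_eq hs.
by have := up _ hs'; rewrite ls'; lra.
Qed.

End AxialApprox.

(** * Near maxima and quarter turns *)

Section RealGleason.
Variable R : realType.
Implicit Types (f h : vec3 R -> R) (s t u v w : vec3 R) (W M eta eps : R).

Definition comb3 s u v w : vec3 R :=
  (s.1.1 * u.1.1 + s.1.2 * v.1.1 + s.2 * w.1.1,
   s.1.1 * u.1.2 + s.1.2 * v.1.2 + s.2 * w.1.2,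
   s.1.1 * u.2 + s.1.2 * v.2 + s.2 * w.2).

Definition orthonormal u v w :=
  [/\ dot u u = 1, dot v v = 1 & dot w w = 1] /\ [/\ dot u v = 0, dot u w = 0 & dot v w = 0].

Lemma dot_comb3 u v w s t : orthonormal u v w -> dot (comb3 s u v w) (comb3 t u v w) = dot s t.
Proof.
move=> [[uu vv ww] [uv uw vw]].
have -> : dot (comb3 s u v w) (comb3 t u v w) =
  s.1.1 * t.1.1 * dot u u + s.1.2 * t.1.2 * dot v v + s.2 * t.2 * dot w w
  + (s.1.1 * t.1.2 + s.1.2 * t.1.1) * dot u v + (s.1.1 * t.2 + s.2 * t.1.1) * dot u w
  + (s.1.2 * t.2 + s.2 * t.1.2) * dot v w by rewrite /dot /=; ring.
by rewrite uu vv ww uv uw vw /dot; ring.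
Qed.

Lemma frame_comb3 f W u v w : orthonormal u v w -> frame f W ->
  frame (fun s => f (comb3 s u v w)) W.
Proof. by move=> ob Hf x y z *; apply: Hf; rewrite dot_comb3. Qed.

Lemma frame_lin f g a b c W W' : frame f W -> frame g W' ->
  frame (fun s => a * f s + b * g s + c) (a * W + b * W' + 3 * c).
Proof.
move=> Hf Hg x y z hx hy hz xy xz yz.
by rewrite -(Hf x y z) // -(Hg x y z) //; ring.
Qed.

Definition e1 : vec3 R := (1, 0, 0).
Definition e2 : vec3 R := (0, 1, 0).
Definition e3 : vec3 R := (0, 0, 1).
Definition rotz s : vec3 R := (- s.1.2, s.1.1, s.2).
Definition rotx s : vec3 R := (s.1.1, - s.2, s.1.2).
Definition cyc s : vec3 R := (s.2, s.1.1, s.1.2).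

Lemma dot_rotz s t : dot (rotz s) (rotz t) = dot s t.
Proof. rewrite /dot /=; ring. Qed.

Lemma dot_rotx s t : dot (rotx s) (rotx t) = dot s t.
Proof. rewrite /dot /=; ring. Qed.

Lemma dot_cyc s t : dot (cyc s) (cyc t) = dot s t.
Proof. rewrite /dot /=; ring. Qed.

Lemma frame_rotz f W : frame f W -> frame (fun s => f (rotz s)) W.
Proof. by move=> Hf x y z *; apply: Hf; rewrite dot_rotz. Qed.

Lemma frame_cyc f W : frame f W -> frame (fun s => f (cyc s)) W.
Proof. by move=> Hf x y z *; apply: Hf; rewrite dot_cyc. Qed.

Lemma e3_unit : dot e3 e3 = 1. Proof. by rewrite /dot /=; ring. Qed.
Lemma e1_unit : dot e1 e1 = 1. Proof. by rewrite /dot /=; ring. Qed.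
Lemma e2_unit : dot e2 e2 = 1. Proof. by rewrite /dot /=; ring. Qed.

Lemma frame_basis f W : frame f W -> f e1 + f e2 + f e3 = W.
Proof.
by move=> Hf; apply: Hf; rewrite ?e1_unit ?e2_unit ?e3_unit ?oner_neq0 // /dot /=; ring.
Qed.

(* The sum of [f] and its quarter turn about a near-maximal point is constant on the
   equator, where it is nearly minimal: it is an axial frame function. *)
Lemma near_max M eta : 0 <= M -> 0 < eta -> exists2 eps, 0 < eps & forall f W,
  frame f W -> (forall s, dot s s != 0 -> `|f s| <= M) ->
  (forall s, dot s s != 0 -> f s <= f e3 + eps) ->
  forall s, dot s s != 0 ->
    `|f s + f (rotz s) - ((W - f e3) + (3 * f e3 - W) * lat s)| <= eta.
Proof.
move=> M0 eta0; have [eps eps0 H] := axial_approx (mulr_ge0 (ler0n R 6) M0) eta0.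
exists (eps / 2) => [|f W Hf fM fmax s hs]; first by rewrite divr_gt0.
have h1 := e1_unit; have h2 := e2_unit; have h3 := e3_unit.
have hW := frame_basis Hf.
(* On the equator [e], [rotz e], [e3] form a frame, so the sum of [f] and its turn is the constant
   [W - f e3] there; subtracting it makes [G] vanish on the equator. *)
pose G s := 1 * f s + 1 * f (rotz s) + - (W - f e3).
have HG : frame G (3 * f e3 - W).
  have -> : 3 * f e3 - W = 1 * W + 1 * W + 3 * (- (W - f e3)) by ring.
  exact: frame_lin Hf (frame_rotz Hf).
have G_eq e : dot e e != 0 -> e.2 = 0 -> G e = 0.
  move=> he e0; rewrite /G.
  have := Hf e (rotz e) e3 he; rewrite dot_rotz h3 => /(_ he (oner_neq0 _)) <-; first by ring.
  - by rewrite /dot /= e0; ring.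
  - by rewrite /dot /= e0; ring.
  - by rewrite /dot /= e0; ring.
have n3 : dot e3 e3 != 0 by rewrite h3 oner_neq0.
(* Near-maximality bounds [G] from above; passing to a point of complementary latitude turns this
   into the lower bound required of an axial function. *)
have ax : axial G (3 * f e3 - W) eps.
  split=> // e he; have [e' [he' _ hee]] := axial_compl HG G_eq he.
  have a1 := fmax _ he'; have a2 : f (rotz e') <= f e3 + eps / 2 by apply: fmax; rewrite dot_rotz.
  have : G e' <= 3 * f e3 - W + eps by rewrite /G; lra.
  lra.
have K6 : `|3 * f e3 - W| <= 6 * M.
  have [n1 n2] : dot e1 e1 != 0 /\ dot e2 e2 != 0 by rewrite h1 h2 oner_neq0.
  have := fM _ n3; have := fM _ n1; have := fM _ n2; rewrite !ler_norml.
  by move=> /andP[? ?] /andP[? ?] /andP[? ?]; apply/andP; split; lra.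
have := H _ _ ax K6 s hs; rewrite /G; set A := (X in `|X|); set B := (X in _ -> `|X| <= _).
by have -> : A = B by rewrite /A /B; ring.
Qed.

(** Up to signs these are the inner products of a unit vector with its images under the
    transpositions, and 2|xy| + z^2 = 1 - (|x| - |y|)^2. If all three were below 2/3, the sorted
    absolute values would be spaced by more than 1/sqrt 3 and the largest would exceed 1. *)
Lemma swap_dot (x y z : R) : x ^+ 2 + y ^+ 2 + z ^+ 2 = 1 ->
  [\/ 2 / 3 <= 2 * `|x * y| + z ^+ 2, 2 / 3 <= 2 * `|y * z| + x ^+ 2
    | 2 / 3 <= 2 * `|x * z| + y ^+ 2].
Proof.
rewrite !normrM -(real_normK (num_real x)) -(real_normK (num_real y)) -(real_normK (num_real z)).
move: (normr_ge0 x) (normr_ge0 y) (normr_ge0 z).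
move: `|x| `|y| `|z| => a b c a0 b0 c0 h.
have [|h1] := lerP (2 / 3) (2 * (a * b) + c ^+ 2); first by constructor 1.
have [|h2] := lerP (2 / 3) (2 * (b * c) + a ^+ 2); first by constructor 2.
have [|h3] := lerP (2 / 3) (2 * (a * c) + b ^+ 2); first by constructor 3.
exfalso.
have k1 : 1 / 3 < (a - b) ^+ 2 by lra.
have k2 : 1 / 3 < (b - c) ^+ 2 by lra.
have k3 : 1 / 3 < (a - c) ^+ 2 by lra.
have aux (p q r : R) : 0 <= p -> p <= q -> q <= r -> p ^+ 2 + q ^+ 2 + r ^+ 2 = 1 ->
    1 / 3 < (p - q) ^+ 2 -> 1 / 3 < (q - r) ^+ 2 -> False.
  move=> p0 pq qr hs l1 l2.
  have : 0 <= (q - p) * (r - q) by rewrite mulr_ge0 ?subr_ge0.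
  have : 0 <= p * (q - p) by rewrite mulr_ge0 ?subr_ge0.
  have : 0 <= p * (r - q) by rewrite mulr_ge0 ?subr_ge0.
  by nra.
have sq (p q : R) : (p - q) ^+ 2 = (q - p) ^+ 2 by ring.
have [ab|ab] := lerP a b; have [bc|bc] := lerP b c; have [ac|ac] := lerP a c.
- by apply: (aux a b c).
- by lra.
- by apply: (aux a c b) => //; rewrite 1?sq //; lra.
- by apply: (aux c a b) => //; rewrite 1?sq //; lra.
- by apply: (aux b a c) => //; rewrite 1?sq //; lra.
- by apply: (aux b c a) => //; rewrite 1?sq //; lra.
- by lra.
- by apply: (aux c b a) => //; rewrite 1?sq //; lra.
Qed.

(* [f] is odd, up to [eta], under the two quarter turns, hence under the
   transpositions of coordinates; one of these moves [p] by a small angle. *)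
Lemma odd_witness f W eta p : frame f W -> 0 <= eta -> dot p p = 1 ->
  (forall s, dot s s != 0 -> `|f s + f (rotz s)| <= eta) ->
  (forall s, dot s s != 0 -> `|f s + f (rotx s)| <= eta) ->
  exists s, [/\ dot s s = 1, f s <= - f p + 17 * eta & 4 / 9 <= dot s p ^+ 2].
Proof.
move=> Hf eta0 hp hz hx.
have nz s : dot s s = 1 -> dot s s != 0 by move=> ->; apply: oner_neq0.
have opp s : dot s s = 1 -> f (- s.1.1, - s.1.2, - s.2) = f s.
  move=> hs; rewrite -(frame_scale Hf (a := -1) _ (nz _ hs)) ?oppr_eq0 ?oner_neq0 //.
  by congr f; rewrite /comb; congr (_, _, _); ring.
have Hz (x y z : R) : dot (x, y, z) (x, y, z) = 1 ->
    - eta <= f (x, y, z) + f (- y, x, z) <= eta.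
  by move=> /nz /hz; rewrite ler_norml.
have Hx (x y z : R) : dot (x, y, z) (x, y, z) = 1 ->
    - eta <= f (x, y, z) + f (x, - z, y) <= eta.
  by move=> /nz /hx; rewrite ler_norml.
have Ho (x y z : R) : dot (x, y, z) (x, y, z) = 1 -> f (- x, - y, - z) = f (x, y, z).
  by move=> /opp.
have dE (x y z : R) : x ^+ 2 + y ^+ 2 + z ^+ 2 = 1 -> dot (x, y, z) (x, y, z) = 1.
  by rewrite /dot /= !expr2.
(* Two quarter turns make a half turn, and a half turn followed by the antipodal map is a reflection
   in one coordinate; a quarter turn followed by a reflection is a transposition. Each factor adds
   its error. *)
have Fxy (x y z : R) : x ^+ 2 + y ^+ 2 + z ^+ 2 = 1 ->
    - (2 * eta) <= f (x, y, z) - f (- x, - y, z) <= 2 * eta.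
  move=> h; have /andP[a1 a2] := Hz x y z (dE _ _ _ h).
  have /andP[b1 b2] : - eta <= f (- y, x, z) + f (- x, - y, z) <= eta.
    by apply: Hz; apply: dE; rewrite sqrrN; lra.
  by apply/andP; split; lra.
have Fyz (x y z : R) : x ^+ 2 + y ^+ 2 + z ^+ 2 = 1 ->
    - (2 * eta) <= f (x, y, z) - f (x, - y, - z) <= 2 * eta.
  move=> h; have /andP[a1 a2] := Hx x y z (dE _ _ _ h).
  have /andP[b1 b2] : - eta <= f (x, - z, y) + f (x, - y, - z) <= eta.
    by apply: Hx; apply: dE; rewrite sqrrN; lra.
  by apply/andP; split; lra.
have Fx (x y z : R) : x ^+ 2 + y ^+ 2 + z ^+ 2 = 1 ->
    - (2 * eta) <= f (x, y, z) - f (- x, y, z) <= 2 * eta.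
  move=> h; have := Fyz x y z h; rewrite -(Ho (- x) y z) ?opprK //.
  by apply: dE; rewrite sqrrN.
have Fy (x y z : R) : x ^+ 2 + y ^+ 2 + z ^+ 2 = 1 ->
    - (4 * eta) <= f (x, y, z) - f (x, - y, z) <= 4 * eta.
  move=> h; have /andP[a1 a2] := Fxy x y z h.
  have /andP[b1 b2] := Fx x (- y) z ltac:(by rewrite sqrrN).
  by apply/andP; split; lra.
have Sxy (x y z : R) : x ^+ 2 + y ^+ 2 + z ^+ 2 = 1 ->
    - (3 * eta) <= f (x, y, z) + f (y, x, z) <= 3 * eta.
  move=> h; have /andP[a1 a2] := Hz x y z (dE _ _ _ h).
  have /andP[b1 b2] := Fx y x z ltac:(lra).
  by apply/andP; split; lra.
have Syz (x y z : R) : x ^+ 2 + y ^+ 2 + z ^+ 2 = 1 ->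
    - (5 * eta) <= f (x, y, z) + f (x, z, y) <= 5 * eta.
  move=> h; have /andP[a1 a2] := Hx x y z (dE _ _ _ h).
  have /andP[b1 b2] := Fy x z y ltac:(lra).
  by apply/andP; split; lra.
(* This transposition is a product of the three others, whence 5 + 3 + 5; the reflection in [y]
   needed when [x z < 0] adds 4, which gives the constant 17. *)
have Sxz (x y z : R) : x ^+ 2 + y ^+ 2 + z ^+ 2 = 1 ->
    - (13 * eta) <= f (x, y, z) + f (z, y, x) <= 13 * eta.
  move=> h; have /andP[a1 a2] := Syz x y z h.
  have /andP[b1 b2] := Sxy x z y ltac:(lra).
  have /andP[c1 c2] := Syz z x y ltac:(lra).
  by apply/andP; split; lra.
case: p hp => [[x y] z] hp.
have hp' : x ^+ 2 + y ^+ 2 + z ^+ 2 = 1 by rewrite -hp /dot /= !expr2.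
have sq (a b : R) : 0 <= b -> 2 / 3 <= 2 * a + b -> 4 / 9 <= (2 * a + b) ^+ 2 by nra.
have [h|h|h] := swap_dot hp'.
- have := sq _ _ (sqr_ge0 z) h; have [xy|xy] := ger0P (x * y) => h'.
    exists (y, x, z); split; first by apply: dE; lra.
      by have /andP[a1 a2] := Sxy x y z hp'; lra.
    by rewrite /dot /=; have -> : y * x + x * y + z * z = 2 * (x * y) + z ^+ 2 by ring.
  exists (- y, - x, z); split; first by apply: dE; rewrite !sqrrN; lra.
    have /andP[a1 a2] := Sxy x y z hp'; have /andP[b1 b2] := Fxy y x z ltac:(lra).
    by lra.
  by rewrite /dot /=; have -> : - y * x + - x * y + z * z = 2 * (- (x * y)) + z ^+ 2 by ring.
- have := sq _ _ (sqr_ge0 x) h; have [yz|yz] := ger0P (y * z) => h'.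
    exists (x, z, y); split; first by apply: dE; lra.
      by have /andP[a1 a2] := Syz x y z hp'; lra.
    by rewrite /dot /=; have -> : x * x + z * y + y * z = 2 * (y * z) + x ^+ 2 by ring.
  exists (x, - z, - y); split; first by apply: dE; rewrite !sqrrN; lra.
    have /andP[a1 a2] := Syz x y z hp'; have /andP[b1 b2] := Fyz x z y ltac:(lra).
    by lra.
  by rewrite /dot /=; have -> : x * x + - z * y + - y * z = 2 * (- (y * z)) + x ^+ 2 by ring.
have := sq _ _ (sqr_ge0 y) h; have [xz|xz] := ger0P (x * z) => h'.
  exists (z, y, x); split; first by apply: dE; lra.
    by have /andP[a1 a2] := Sxz x y z hp'; lra.
  by rewrite /dot /=; have -> : z * x + y * y + x * z = 2 * (x * z) + y ^+ 2 by ring.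
exists (- z, y, - x); split; first by apply: dE; rewrite !sqrrN; lra.
  have /andP[a1 a2] := Sxz x y z hp'; have /andP[b1 b2] := Fy z y x ltac:(lra).
  by rewrite -(Ho (- z) y (- x)) ?opprK; [lra | apply: dE; rewrite !sqrrN; lra].
by rewrite /dot /=; have -> : - z * x + y * y + - x * z = 2 * (- (x * z)) + y ^+ 2 by ring.
Qed.

End RealGleason.

(** * Gleason's theorem on R^3 *)

Section RealGleasonMain.
Variable R : realType.
Implicit Types (f h : vec3 R -> R) (s t u v w p : vec3 R) (W M eta eps : R).

(** Parseval's identity. Orthogonality says that a square matrix has a right inverse; completeness
    is the fact that this inverse is two-sided. *)
Lemma dual_basis u v w : dot u u != 0 -> dot v v != 0 -> dot w w != 0 ->
  dot u v = 0 -> dot u w = 0 -> dot v w = 0 -> forall s t,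
  dot s t = dot s u * dot t u / dot u u + dot s v * dot t v / dot v v
    + dot s w * dot t w / dot w w.
Proof.
move=> u0 v0 w0 uv uw vw s t.
pose row x : 'rV[R]_3 := \row_j [:: x.1.1; x.1.2; x.2]`_j.
have rowE x y : (row x *m (row y)^T) 0 0 = dot x y.
  by rewrite mxE !big_ord_recl big_ord0 !mxE /= /dot addr0 addrA.
pose c : 'I_3 -> vec3 R := fun i => nth 0 [:: u; v; w] i.
pose A : 'M[R]_3 := \matrix_(i, j) row (c i) 0 j.
pose B : 'M[R]_3 := \matrix_(i, j) (row (c i) 0 j / dot (c i) (c i)).
have AB : A *m B^T = 1%:M.
  apply/matrixP => i j; rewrite !mxE.
  have -> : \sum_k A i k * B^T k j = dot (c i) (c j) / dot (c j) (c j).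
    rewrite -rowE mxE mulr_suml; apply: eq_bigr => k _.
    by rewrite !mxE mulrA.
  have vu : dot v u = 0 by rewrite dotC. have wu : dot w u = 0 by rewrite dotC.
  have wv : dot w v = 0 by rewrite dotC.
  case: i => [[|[|[|//]]] hi]; case: j => [[|[|[|//]]] hj];
    by rewrite /c /= ?uv ?uw ?vw ?vu ?wu ?wv ?mul0r ?divff // mxE.
have BA := mulmx1C AB.
have : (row s *m (B^T *m A) *m (row t)^T) 0 0 = dot s t by rewrite BA mulmx1 rowE.
move=> <-; rewrite mulmxA -mulmxA mxE !big_ord_recl big_ord0 addr0 addrA.
have hl i : (row s *m B^T) 0 i = dot s (c i) / dot (c i) (c i).
  by rewrite -rowE !mxE mulr_suml; apply: eq_bigr => k _; rewrite !mxE mulrA.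
have hr i : (A *m (row t)^T) i 0 = dot t (c i).
  by rewrite dotC -rowE !mxE; apply: eq_bigr => k _; rewrite !mxE.
by rewrite !hl !hr /c /=; congr (_ + _ + _); rewrite mulrAC.
Qed.

Lemma orthonormal_expand u v w s : orthonormal u v w ->
  s = comb3 (dot s u, dot s v, dot s w) u v w.
Proof.
move=> [[uu vv ww] [uv uw vw]].
have H := @dual_basis u v w; rewrite uu vv ww oner_neq0 in H.
have {}H t : dot s t = dot s u * dot t u + dot s v * dot t v + dot s w * dot t w.
  by rewrite (H isT isT isT uv uw vw s t) !divr1.
have d1 t : dot t (e1 R) = t.1.1 by rewrite /dot /=; ring.
have d2 t : dot t (e2 R) = t.1.2 by rewrite /dot /=; ring.
have d3 t : dot t (e3 R) = t.2 by rewrite /dot /=; ring.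
have := H (e1 R); have := H (e2 R); have := H (e3 R).
rewrite d1 d2 d3 ![dot (e1 R) _]dotC ![dot (e2 R) _]dotC ![dot (e3 R) _]dotC !d1 !d2 !d3.
rewrite /comb3 /=; move: (dot s u) (dot s v) (dot s w) => a b c.
by case: s {H} => [[x y] z] /= -> -> ->.
Qed.

Lemma orthonormal_cross u w : dot u u = 1 -> dot w w = 1 -> dot u w = 0 ->
  orthonormal u (cross w u) w.
Proof.
move=> uu ww uw; have wu : dot w u = 0 by rewrite dotC.
split; split => //; rewrite ?dot_crossr ?dot_cross ?uu ?ww ?wu; try by ring.
by rewrite dotC dot_crossl.
Qed.

Lemma frame_unit f W s : frame f W -> dot s s != 0 ->
  exists p, [/\ dot p p = 1, f p = f s & exists2 c, c != 0 & p = comb c s 0 s].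
Proof.
move=> Hf hs; have s0 := dot_gt0 hs.
pose c := (Num.sqrt (dot s s))^-1.
have hc : c ^+ 2 = (dot s s)^-1 by rewrite exprVn sqr_sqrtr // ltW.
have c0 : c != 0 by rewrite invr_eq0 gt_eqF // sqrtr_gt0.
exists (comb c s 0 s); split; [|exact: (frame_scale Hf c0 hs) | by exists c].
by rewrite dot_combr dot_combl !mul0r !addr0 mulrA -expr2 hc mulVf.
Qed.

Lemma near_sup f W M eps : 0 < eps -> frame f W ->
  (forall s, dot s s != 0 -> f s <= M) ->
  exists p, dot p p = 1 /\ forall s, dot s s != 0 -> f s <= f p + eps.
Proof.
move=> eps0 Hf fM; pose E : set R := fun y => exists2 s, dot s s != 0 & y = f s.
have n1 : dot (e1 R) (e1 R) != 0 by rewrite e1_unit oner_neq0.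
have ub : ubound E M by move=> y [s hs ->]; apply: fM.
have hE : has_sup E by split; [exists (f (e1 R)); exists (e1 R) | exists M].
have [y [s hs ->] hy] := sup_adherent eps0 hE.
have [p [pp fp _]] := frame_unit Hf hs; exists p; split => // t ht; rewrite fp.
have : f t <= sup E by apply: sup_upper_bound => //; exists t.
by lra.
Qed.

(** At a near maximum [p] the weight 0 makes [h] plus its turn about [p] nearly equal to h p (3 lat
    - 1). At the odd witness [lat >= 4/9], so the two values there sum to at least h p / 3 - eta,
    while oddness bounds them by 17 eta + ep. Hence h p <= 57 eta, and near-maximality adds the last
    [eta]. *)
Lemma odd_small M eta : 0 <= M -> 0 < eta -> forall h, frame h 0 ->
  (forall s, dot s s != 0 -> `|h s| <= M) ->
  (forall s, dot s s != 0 -> `|h s + h (rotz s)| <= eta) ->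
  (forall s, dot s s != 0 -> `|h s + h (rotx s)| <= eta) ->
  forall s, dot s s != 0 -> h s <= 58 * eta.
Proof.
move=> M0 eta0 h Hh hM hz hx.
have [eps eps0 H] := near_max M0 eta0.
pose ep := Num.min eps eta; have ep0 : 0 < ep by rewrite lt_min eps0 eta0.
have ep1 : ep <= eps by rewrite ge_min lexx.
have ep2 : ep <= eta by rewrite ge_min lexx orbT.
have [p [pp hp]] : exists p, dot p p = 1 /\ forall s, dot s s != 0 -> h s <= h p + ep.
  by apply: (near_sup (M := M) ep0 Hh) => s /hM; rewrite ler_norml => /andP[].
have n0 : dot p p != 0 by rewrite pp oner_neq0.
have [e [_ he pe]] := equator_perp p.
have [u [uu _ [c c0 ue]]] := frame_unit Hh he.
have up : dot u p = 0 by rewrite dotC ue dot_combr pe; ring.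
have ob := orthonormal_cross uu pp up.
set v := cross p u in ob.
have [s [ss hs1 hs2]] := odd_witness Hh (ltW eta0) pp hz hx.
pose h' t := h (comb3 t u v p).
have h'3 : h' (e3 R) = h p.
  by congr h; rewrite /comb3 /=; case: (p) => [[x y] z]; congr (_, _, _) => /=; ring.
have key : h p <= 57 * eta.
  pose s' : vec3 R := (dot s u, dot s v, dot s p).
  have s's' : dot s' s' = 1 by rewrite -(dot_comb3 _ _ ob) -orthonormal_expand.
  have ns' : dot s' s' != 0 by rewrite s's' oner_neq0.
  have := H h' 0 (frame_comb3 ob Hh) _ _ s' ns'.
  rewrite h'3 /lat s's' divr1 sub0r subr0 ler_norml.
  have -> : h' s' = h s by rewrite /h' -orthonormal_expand.
  have b1 : h' (rotz s') <= h p + ep by apply: hp; rewrite dot_comb3 // dot_rotz.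
  move=> H'; have {H'} /andP[b2 _] : - eta <= h s + h' (rotz s') - (- h p + 3 * h p * s'.2 ^+ 2) <= eta.
    apply: H' => t ht; rewrite /h'; first by apply: hM; rewrite dot_comb3.
    have /hp : dot (comb3 t u v p) (comb3 t u v p) != 0 by rewrite dot_comb3.
    by lra.
  rewrite leNgt; apply/negP => hlt.
  have : 4 / 9 * h p <= s'.2 ^+ 2 * h p by rewrite ler_wpM2r //; lra.
  by lra.
by move=> t /hp; lra.
Qed.

Definition diagq (a b c : R) s := (a * s.1.1 ^+ 2 + b * s.1.2 ^+ 2 + c * s.2 ^+ 2) / dot s s.

(** The sum over a frame is a trace: Parseval at each coordinate axis gives the coefficient 1 to
    [a], [b] and [c]. *)
Lemma frame_diagq a b c : frame (diagq a b c) (a + b + c).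
Proof.
move=> u v w u0 v0 w0 uv uw vw; have H := dual_basis u0 v0 w0 uv uw vw.
have := H (e1 R) (e1 R); have := H (e2 R) (e2 R); have := H (e3 R) (e3 R).
rewrite e1_unit e2_unit e3_unit ![dot (e1 R) _]dotC ![dot (e2 R) _]dotC ![dot (e3 R) _]dotC.
have d1 t : dot t (e1 R) = t.1.1 by rewrite /dot /=; ring.
have d2 t : dot t (e2 R) = t.1.2 by rewrite /dot /=; ring.
have d3 t : dot t (e3 R) = t.2 by rewrite /dot /=; ring.
rewrite !d1 !d2 !d3 /diagq => h3 h2 h1.
have -> : a + b + c = a * 1 + b * 1 + c * 1 by ring.
rewrite [X in _ = a * X + _ + _]h1 [X in _ = _ + b * X + _]h2 [X in _ = _ + c * X]h3.
by field; rewrite w0 v0 u0.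
Qed.

Lemma diagq_bound a b c M s : `|a| <= M -> `|b| <= M -> `|c| <= M -> dot s s != 0 ->
  `|diagq a b c s| <= M.
Proof.
move=> ha hb hc hs; have s0 := dot_gt0 hs.
rewrite normrM normfV (gtr0_norm s0) ler_pdivrMr // ler_norml.
move: ha hb hc; rewrite !ler_norml => /andP[a1 a2] /andP[b1 b2] /andP[c1 c2].
case: s {s0 hs} => [[x y] z]; rewrite /dot /= -!expr2.
have := sqr_ge0 x; have := sqr_ge0 y; have := sqr_ge0 z.
move: (x ^+ 2) (y ^+ 2) (z ^+ 2) => X Y Z z0 y0 x0.
have := ler_wpM2r x0 a1; have := ler_wpM2r x0 a2.
have := ler_wpM2r y0 b1; have := ler_wpM2r y0 b2.
have := ler_wpM2r z0 c1; have := ler_wpM2r z0 c2.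
by move=> *; apply/andP; split; lra.
Qed.

(** Take a near minimum [r] and its component [e] orthogonal to [p]. In the plane of [p] and [r], f
    p + f e = f r + f r', and [r'] cannot beat [p] by more than [eps], so [e] is nearly minimal too.
    If [r] is parallel to [p], then [f] is nearly constant and any orthogonal direction serves. *)
Lemma near_min_perp f W M eps p : 0 < eps -> frame f W ->
  (forall s, dot s s != 0 -> `|f s| <= M) -> dot p p = 1 ->
  (forall s, dot s s != 0 -> f s <= f p + eps) ->
  exists e, [/\ dot e e = 1, dot e p = 0 & forall s, dot s s != 0 -> f e - 2 * eps <= f s].
Proof.
move=> eps0 Hf fM pp fp.
have HN : frame (fun s => - f s) (- W).
  by move=> x y z hx hy hz xy xz yz; rewrite -(Hf x y z) //; ring.
have [r [rr hr]] : exists r, dot r r = 1 /\ forall s, dot s s != 0 -> - f s <= - f r + eps.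
  by apply: (near_sup (M := M) eps0 HN) => s /fM; rewrite ler_norml; lra.
have n0 : dot p p != 0 by rewrite pp oner_neq0.
suff [e [he ep fe]] : exists e, [/\ dot e e != 0, dot e p = 0 & f e <= f r + eps].
  have [e' [ee fe' [c c0 e'E]]] := frame_unit Hf he.
  exists e'; split=> //; first by rewrite e'E dot_combl ep; ring.
  by move=> s /hr; rewrite fe'; lra.
pose e := comb 1 r (- dot r p) p.
have pe : dot p e = 0 by rewrite dot_combr pp dotC; ring.
have rE : comb (dot r p) p 1 e = r.
  rewrite /e /comb /=; move: (dot r p) => c; case: (r) => [[x y] z] /=.
  by congr (_, _, _); ring.
clearbody e; have [e0|ne0] := eqVneq (dot e e) 0.
  have [g [_ gg pg]] := equator_perp p; exists g; split=> //; first by rewrite dotC.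
  have ez : e = (0, 0, 0).
    move: e0; rewrite /dot; case: (e) => [[x y] z] /= /eqP.
    rewrite -!expr2 !paddr_eq0 ?addr_ge0 ?sqr_ge0 // !sqrf_eq0.
    by move=> /andP[/andP[/eqP -> /eqP ->] /eqP ->].
  have rp0 : dot r p != 0.
    apply/eqP => z; move: rr; rewrite -rE ez z /dot /=; lra.
  have -> : f r = f p.
    rewrite -(frame_scale Hf rp0 n0) -[in LHS]rE ez; congr f.
    by rewrite /comb; congr (_, _, _) => /=; ring.
  exact: fp.
exists e; split; [by []|by rewrite dotC|].
have := frame_rot Hf (a := dot r p) (b := 1) n0 ne0 pe.
rewrite oner_neq0 orbT rE => /(_ isT) h.
set r' := comb _ _ _ _ in h.
have /fp : dot r' r' != 0; last by lra.
have ep : dot e p = 0 by rewrite dotC.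
have -> : dot r' r' = dot e e * dot e e + (dot r p) ^+ 2 * dot e e.
  by rewrite /r' dot_combr !dot_combl pp pe ep; ring.
have e0 := dot_gt0 ne0; rewrite gt_eqF //.
by rewrite ltr_pwDl ?mulr_gt0 // mulr_ge0 ?sqr_ge0 // ltW.
Qed.

(* With [p] nearly maximal and [e] nearly minimal on the equator of [p], the difference
   of [f] and the diagonal form in this frame is nearly odd under both quarter turns. *)
Lemma approx_quadratic M eta f W : 0 <= M -> 0 < eta -> frame f W ->
  (forall s, dot s s != 0 -> `|f s| <= M) ->
  exists u v w, orthonormal u v w /\ exists a b c : R, forall s, dot s s != 0 ->
    `|f (comb3 s u v w) - diagq a b c s| <= 58 * eta.
Proof.
move=> M0 eta0 Hf fM; have [eps eps0 H] := near_max M0 eta0.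
have eps20 : 0 < eps / 2 by rewrite divr_gt0.
have [p [pp hp]] : exists p, dot p p = 1 /\ forall s, dot s s != 0 -> f s <= f p + eps / 2.
  by apply: (near_sup (M := M) eps20 Hf) => s /fM; rewrite ler_norml => /andP[].
have [e [ee ep fe]] := near_min_perp eps20 Hf fM pp hp.
have ob := orthonormal_cross ee pp ep; set v := cross p e in ob.
exists e, v, p; split => //.
pose g s := f (comb3 s e v p).
have Hg : frame g W := frame_comb3 ob Hf.
have gM s : dot s s != 0 -> `|g s| <= M by move=> hs; apply: fM; rewrite dot_comb3.
have g1 : g (e1 R) = f e.
  by congr f; rewrite /comb3 /=; case: (e) => [[x y] z]; congr (_, _, _) => /=; ring.
have g3 : g (e3 R) = f p.
  by congr f; rewrite /comb3 /=; case: (p) => [[x y] z]; congr (_, _, _) => /=; ring.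
have gmax s : dot s s != 0 -> g s <= g (e3 R) + eps.
  move=> hs; rewrite g3; have /hp : dot (comb3 s e v p) (comb3 s e v p) != 0 by rewrite dot_comb3.
  by rewrite /g; lra.
have gmin s : dot s s != 0 -> - g s <= - g (e1 R) + eps.
  move=> hs; rewrite g1; have /fe : dot (comb3 s e v p) (comb3 s e v p) != 0 by rewrite dot_comb3.
  by rewrite /g; lra.
have hW := frame_basis Hg.
have [n1 n2 n3] : [/\ dot (e1 R) (e1 R) != 0, dot (e2 R) (e2 R) != 0 & dot (e3 R) (e3 R) != 0].
  by rewrite e1_unit e2_unit e3_unit oner_neq0.
pose q := diagq (g (e1 R)) (g (e2 R)) (g (e3 R)).
pose h s := g s - q s.
have Hh : frame h 0.
  move=> x y z x0 y0 z0 xy xz yz; rewrite /h.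
  have a1 := Hg x y z x0 y0 z0 xy xz yz.
  have := frame_diagq (g (e1 R)) (g (e2 R)) (g (e3 R)) x0 y0 z0 xy xz yz.
  by rewrite -/q hW; lra.
have hM s : dot s s != 0 -> `|h s| <= 2 * M.
  move=> hs; have := gM _ hs; have := diagq_bound (gM _ n1) (gM _ n2) (gM _ n3) hs.
  rewrite -/(q s) /h !ler_norml => /andP[? ?] /andP[? ?]; apply/andP; split; lra.
(* The sum of [q] and its quarter turn is exactly the affine function of [lat] that [near_max]
   provides for [g]. *)
have hz s : dot s s != 0 -> `|h s + h (rotz s)| <= eta.
  move=> hs; have := H g W Hg gM gmax s hs; congr (`|_| <= _).
  rewrite /h /q /diagq dot_rotz /lat -hW; move: (g s) (g (rotz s)) => A B.
  by case: s hs => [[x y] z]; rewrite /dot /= => hs; field; rewrite -?expr2 in hs *.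
(* The cyclic shift carries [e3] to [e1], where [g] is nearly minimal, so [near_max] applies to
   [- g] after the shift and turns about the [x] axis. *)
have hx s : dot s s != 0 -> `|h s + h (rotx s)| <= eta.
  move=> hs; pose k t := - g (cyc t).
  have Hk : frame k (- W).
    move=> x y z x0 y0 z0 xy xz yz; rewrite /k -(frame_cyc Hg x0 y0 z0 xy xz yz); ring.
  have kM t : dot t t != 0 -> `|k t| <= M by move=> ht; rewrite normrN; apply: gM; rewrite dot_cyc.
  have kmax t : dot t t != 0 -> k t <= k (e3 R) + eps by move=> ht; apply: gmin; rewrite dot_cyc.
  case: s hs => [[x y] z] hs; pose s : vec3 R := (y, z, x).
  have hs' : dot s s != 0 by rewrite -dot_cyc.
  have := H k _ Hk kM kmax s hs'; rewrite -normrN; congr (`|_| <= _).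
  rewrite /h /q /diagq dot_rotx /lat -hW /k /= -[cyc (e3 R)]/(e1 R) -[cyc s]/(x, y, z).
  rewrite -[cyc (rotz s)]/(rotx (x, y, z)).
  have -> : dot s s = dot ((x, y, z) : vec3 R) (x, y, z) by rewrite -dot_cyc.
  move: (g (x, y, z)) (g (rotx (x, y, z))) => A B.
  by move: hs; rewrite /dot /= => hs; field.
exists (g (e1 R)), (g (e2 R)), (g (e3 R)) => s hs; rewrite ler_norml; apply/andP; split; last first.
  by apply: (odd_small (mulr_ge0 (ler0n R 2) M0) eta0 Hh hM hz hx hs).
have HN : frame (fun s => - h s) 0.
  by move=> x y z x0 y0 z0 xy xz yz; rewrite -[RHS]oppr0 -(Hh x y z) //; ring.
rewrite lerNl; apply: (odd_small (mulr_ge0 (ler0n R 2) M0) eta0 HN _ _ _ hs).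
- by move=> t ht; rewrite normrN; apply: hM.
- by move=> t ht; rewrite -opprD normrN; apply: hz.
- by move=> t ht; rewrite -opprD normrN; apply: hx.
Qed.

Lemma le0_scaled (x C : R) : 0 <= C -> (forall eta, 0 < eta -> x <= C * eta) -> x <= 0.
Proof.
move=> C0 h; rewrite leNgt; apply/negP => x0.
have C1 : 0 < 2 * (C + 1) by lra.
have := h (x / (2 * (C + 1))) (divr_gt0 x0 C1).
rewrite mulrA ler_pdivlMr // => h'.
have : 0 <= C * x by rewrite mulr_ge0 // ltW.
by nra.
Qed.

Lemma quadratic_error (k x y z d0 d1 d2 d3 d4 d5 d6 : R) :
  `|d0| <= k * (x ^+ 2 + y ^+ 2 + z ^+ 2) -> `|d1| <= k -> `|d2| <= k -> `|d3| <= k ->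
  `|d4| <= 2 * k -> `|d5| <= 2 * k -> `|d6| <= 2 * k ->
  `|d0 - x ^+ 2 * d1 - y ^+ 2 * d2 - z ^+ 2 * d3 - x * y * (d4 - d1 - d2)
    - x * z * (d5 - d1 - d3) - y * z * (d6 - d2 - d3)|
  <= k * (2 * (x ^+ 2 + y ^+ 2 + z ^+ 2) + 4 * (`|x * y| + `|x * z| + `|y * z|)).
Proof.
move=> l0 l1 l2 l3 l4 l5 l6.
have t4 (p q r : R) : `|p| <= k -> `|q| <= k -> `|r| <= 2 * k -> `|r - p - q| <= 4 * k.
  rewrite !ler_norml => /andP[a1 b1] /andP[a2 b2] /andP[a3 b3].
  by apply/andP; split; lra.
have {}l4 := t4 _ _ _ l1 l2 l4; have {}l5 := t4 _ _ _ l1 l3 l5; have {}l6 := t4 _ _ _ l2 l3 l6.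
have B (i j m : R) : `|j| <= m -> - (`|i| * m) <= i * j <= `|i| * m.
  by move=> h; rewrite -ler_norml normrM ler_wpM2l.
have nsq (p : R) : `|p ^+ 2| = p ^+ 2 by rewrite ger0_norm ?sqr_ge0.
have /andP[a1 b1] := B (x ^+ 2) _ _ l1; have /andP[a2 b2] := B (y ^+ 2) _ _ l2.
have /andP[a3 b3] := B (z ^+ 2) _ _ l3; have /andP[a4 b4] := B (x * y) _ _ l4.
have /andP[a5 b5] := B (x * z) _ _ l5; have /andP[a6 b6] := B (y * z) _ _ l6.
rewrite !nsq in a1 b1 a2 b2 a3 b3.
move: l0; rewrite !ler_norml => /andP[a0 b0].
by apply/andP; split; lra.
Qed.

Definition quadr f s := dot s s * f s.

(** A quadratic form is determined by its values at six vectors, so the identity is exact for each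
    approximant. For [F] at fixed [x], [y], [z] it fails by at most a constant times [eta], with
    [eta] arbitrary. *)
Theorem real_gleason f W M : frame f W -> (forall s, dot s s != 0 -> `|f s| <= M) ->
  forall x y z : R, let F := quadr f in
  F (x, y, z) = x ^+ 2 * F (1, 0, 0) + y ^+ 2 * F (0, 1, 0) + z ^+ 2 * F (0, 0, 1)
    + x * y * (F (1, 1, 0) - F (1, 0, 0) - F (0, 1, 0))
    + x * z * (F (1, 0, 1) - F (1, 0, 0) - F (0, 0, 1))
    + y * z * (F (0, 1, 1) - F (0, 1, 0) - F (0, 0, 1)).
Proof.
move=> Hf fM x y z F.
have M0 : 0 <= M by apply: le_trans (fM (e1 R) _); rewrite ?e1_unit ?oner_neq0.
pose D := `|x * y| + `|x * z| + `|y * z|.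
pose N := x ^+ 2 + y ^+ 2 + z ^+ 2.
have N0 : 0 <= N by rewrite !addr_ge0 ?sqr_ge0.
have D0 : 0 <= D by rewrite !addr_ge0.
apply/eqP; rewrite -subr_eq0 -normr_le0; apply: (@le0_scaled _ (58 * (2 * N + 4 * D))) => [|eta eta0].
  by rewrite mulr_ge0 // addr_ge0 ?mulr_ge0.
have [u [v [w [ob [a [b [c H]]]]]]] := approx_quadratic M0 eta0 Hf fM.
pose q s := a * dot s u ^+ 2 + b * dot s v ^+ 2 + c * dot s w ^+ 2.
have qF s : - (58 * eta * dot s s) <= F s - q s <= 58 * eta * dot s s.
  rewrite -ler_norml; have [hs|hs] := eqVneq (dot s s) 0.
    have s0 : s = (0, 0, 0).
      move: hs; rewrite /dot; case: (s) => [[x1 y1] z1] /= /eqP.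
      rewrite -!expr2 !paddr_eq0 ?addr_ge0 ?sqr_ge0 // !sqrf_eq0.
      by move=> /andP[/andP[/eqP -> /eqP ->] /eqP ->].
    rewrite /F /quadr hs s0 /q /dot /= !(mul0r, mulr0, addr0) expr0n /= !mulr0 !addr0 subrr.
    by rewrite normr0.
  have sE := orthonormal_expand s ob; pose s' : vec3 R := (dot s u, dot s v, dot s w).
  have ss' : dot s' s' = dot s s by rewrite -(dot_comb3 _ _ ob) -sE.
  have := H s'; rewrite ss' => /(_ hs); rewrite -sE /diagq ss' => h.
  have -> : F s - q s = dot s s * (f s - (a * dot s u ^+ 2 + b * dot s v ^+ 2 + c * dot s w ^+ 2) / dot s s).
    by rewrite /F /quadr /q; field.
  by rewrite normrM (ger0_norm (dot_ge0 s)) mulrC ler_wpM2r ?dot_ge0.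
have E (i j k : R) : exists2 d, - (58 * eta * (i ^+ 2 + j ^+ 2 + k ^+ 2)) <= d
   <= 58 * eta * (i ^+ 2 + j ^+ 2 + k ^+ 2) & F (i, j, k) = q (i, j, k) + d.
  exists (F (i, j, k) - q (i, j, k)); last by ring.
  by have := qF (i, j, k); rewrite [dot _ _]/dot /= -!expr2.
have [d0 /andP[l0 m0] ->] := E x y z.
have [d1 /andP[l1 m1] ->] := E 1 0 0; have [d2 /andP[l2 m2] ->] := E 0 1 0.
have [d3 /andP[l3 m3] ->] := E 0 0 1; have [d4 /andP[l4 m4] ->] := E 1 1 0.
have [d5 /andP[l5 m5] ->] := E 1 0 1; have [d6 /andP[l6 m6] ->] := E 0 1 1.
set L := (X in `|X|).
have -> : L = d0 - x ^+ 2 * d1 - y ^+ 2 * d2 - z ^+ 2 * d3 - x * y * (d4 - d1 - d2)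
   - x * z * (d5 - d1 - d3) - y * z * (d6 - d2 - d3).
  by rewrite /L /q /dot /=; ring.
clear L; have -> : 58 * (2 * N + 4 * D) * eta = 58 * eta * (2 * N + 4 * D) by ring.
clear -l0 m0 l1 m1 l2 m2 l3 m3 l4 m4 l5 m5 l6 m6.
by apply: quadratic_error; rewrite ler_norml; apply/andP; split; lra.
Qed.

End RealGleasonMain.

(** * Frame functions on the sphere of C^n *)

Section ComplexGleason.
Variable R : realType.
Local Notation C := (R[i]).
Local Notation rc := (@real_complex R).
Implicit Types (c d : C) (r : R).

Definition nsq c : R := complex.Re c ^+ 2 + complex.Im c ^+ 2.

Lemma nsqE c : rc (nsq c) = c * Num.conj c.
Proof.
case: c => a b; rewrite -[Num.conj _]/(Complex a (- b)) /nsq /=.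
by apply/eqP; rewrite eq_complex /=; apply/andP; split; apply/eqP; ring.
Qed.

Lemma conj_rc r : Num.conj (rc r) = rc r.
Proof. by rewrite -[LHS]/(Complex r (- 0)) oppr0. Qed.

Lemma rc_inj : injective rc.
Proof. by move=> a b []. Qed.

Lemma nsq_ge0 c : 0 <= nsq c.
Proof. by rewrite addr_ge0 ?sqr_ge0. Qed.

Lemma nsq_eq0 c : (nsq c == 0) = (c == 0).
Proof. by rewrite paddr_eq0 ?sqr_ge0 // !sqrf_eq0 eq_complex. Qed.

Lemma nsq0 : nsq 0 = 0.
Proof. by apply/eqP; rewrite nsq_eq0. Qed.

Lemma nsq1 : nsq 1 = 1.
Proof. by rewrite /nsq /=; ring. Qed.

Lemma nsqN c : nsq (- c) = nsq c.
Proof. by case: c => a b; rewrite /nsq /= !sqrrN. Qed.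

Lemma nsqM c d : nsq (c * d) = nsq c * nsq d.
Proof. by apply: rc_inj; rewrite rmorphM /= !nsqE rmorphM /=; ring. Qed.

Lemma nsq_rc r : nsq (rc r) = r ^+ 2.
Proof. by rewrite /nsq /= expr0n addr0. Qed.

Variable I : finType.
Local Notation V := {ffun I -> C}.
Implicit Types (x y z : V).

Definition hdot x y : C := \sum_i x i * Num.conj (y i).

Lemma hdotDl x y z : hdot (x + y) z = hdot x z + hdot y z.
Proof. by rewrite -big_split /=; apply: eq_bigr => i _; rewrite ffunE mulrDl. Qed.

Lemma hdotDr x y z : hdot x (y + z) = hdot x y + hdot x z.
Proof. by rewrite -big_split /=; apply: eq_bigr => i _; rewrite ffunE rmorphD mulrDr. Qed.

Lemma scaleE c x i : (c *: x) i = c * x i.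
Proof. by rewrite ffunE. Qed.

Lemma hdotZl c x y : hdot (c *: x) y = c * hdot x y.
Proof. by rewrite mulr_sumr; apply: eq_bigr => i _; rewrite ffunE mulrA. Qed.

Lemma hdotZr c x y : hdot x (c *: y) = Num.conj c * hdot x y.
Proof. by rewrite mulr_sumr; apply: eq_bigr => i _; rewrite ffunE rmorphM mulrCA. Qed.

Lemma hdotC x y : hdot y x = Num.conj (hdot x y).
Proof. by rewrite rmorph_sum; apply: eq_bigr => i _; rewrite rmorphM /= conjCK mulrC. Qed.

Lemma hdot0l x : hdot 0 x = 0.
Proof. by rewrite -(scale0r 0) hdotZl mul0r. Qed.

Lemma hdot0r x : hdot x 0 = 0.
Proof. by rewrite hdotC hdot0l rmorph0. Qed.

Lemma hdot_sym0 x y : hdot x y = 0 -> hdot y x = 0.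
Proof. by move=> h; rewrite hdotC h rmorph0. Qed.

Definition vnsq x : R := \sum_i nsq (x i).

Lemma hdotxx x : hdot x x = rc (vnsq x).
Proof. by rewrite rmorph_sum; apply: eq_bigr => i _; rewrite /= nsqE. Qed.

Lemma vnsq_ge0 x : 0 <= vnsq x.
Proof. by apply: sumr_ge0 => i _; apply: nsq_ge0. Qed.

Lemma vnsq_eq0 x : (vnsq x == 0) = (x == 0).
Proof.
apply/eqP/eqP => [/eqP|->].
  rewrite psumr_eq0 => [/allP h|i _]; last exact: nsq_ge0.
  by apply/ffunP => i; rewrite ffunE; apply/eqP; have := h i (mem_index_enum i); rewrite nsq_eq0.
by rewrite /vnsq big1 // => i _; rewrite ffunE; apply/eqP; rewrite nsq_eq0.
Qed.

Lemma vnsqZ c x : vnsq (c *: x) = nsq c * vnsq x.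
Proof. by rewrite mulr_sumr; apply: eq_bigr => i _; rewrite ffunE nsqM. Qed.

Definition delta (i : I) : V := [ffun k => (k == i)%:R].

Lemma hdot_delta i j : hdot (delta i) (delta j) = (i == j)%:R.
Proof.
rewrite /hdot (bigD1 i) //= big1 => [|k /negbTE ki]; rewrite !ffunE.
  by rewrite eqxx mul1r addr0 rmorph_nat.
by rewrite ki mul0r.
Qed.

Lemma sum_delta x : x = \sum_i x i *: delta i.
Proof.
apply/ffunP => k; rewrite sum_ffunE (bigD1 k) //= !(scaleE, ffunE) eqxx mulr1 big1 ?addr0 //.
by move=> i ki; rewrite !(scaleE, ffunE) eq_sym (negbTE ki) mulr0.
Qed.

Lemma delta_neq0 i : delta i != 0.
Proof.
by apply/eqP => /ffunP/(_ i); rewrite !ffunE eqxx => /eqP; rewrite oner_eq0.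
Qed.

Definition hunit3 x y z := [/\ hdot x x = 1, hdot y y = 1 & hdot z z = 1] /\
  [/\ hdot x y = 0, hdot x z = 0 & hdot y z = 0].

Variables (P : V -> R) (M : R).
Hypothesis P_bound : forall x, hdot x x = 1 -> `|P x| <= M.
Hypothesis P_phase : forall x y, hdot x x = 1 -> hdot y y = 1 ->
  (forall i j, x i * Num.conj (x j) = y i * Num.conj (y j)) -> P x = P y.
Hypothesis P_frame : forall x y z x' y' z', hunit3 x y z -> hunit3 x' y' z' ->
  (forall i j, x i * Num.conj (x j) + y i * Num.conj (y j) + z i * Num.conj (z j)
     = x' i * Num.conj (x' j) + y' i * Num.conj (y' j) + z' i * Num.conj (z' j)) ->
  P x + P y + P z = P x' + P y' + P z'.

Definition normalize x : V := rc (Num.sqrt (vnsq x))^-1 *: x.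
(** The candidate quadratic form on all vectors; the factor [vnsq x] makes the value of [P] at
    [normalize 0] harmless. *)
Definition qext x : R := vnsq x * P (normalize x).

Lemma sqr_invsqrt r : 0 <= r -> ((Num.sqrt r)^-1) ^+ 2 = r^-1.
Proof. by move=> h; rewrite exprVn sqr_sqrtr. Qed.

Lemma normalize_unit x : x != 0 -> hdot (normalize x) (normalize x) = 1.
Proof.
move=> x0; rewrite hdotxx vnsqZ nsq_rc sqr_invsqrt ?vnsq_ge0 //.
by rewrite mulVf // vnsq_eq0.
Qed.

Lemma qext0 : qext 0 = 0.
Proof.
have h : vnsq 0 = 0 by apply/eqP; rewrite vnsq_eq0; apply/eqP.
by rewrite /qext h mul0r.
Qed.

Lemma qextZ c x : qext (c *: x) = nsq c * qext x.
Proof.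
have [->|c0] := eqVneq c 0; first by rewrite scale0r qext0 nsq0 mul0r.
have [->|x0] := eqVneq x 0; first by rewrite scaler0 qext0 mulr0.
rewrite /qext vnsqZ -mulrA; congr (_ * (_ * _)).
have cx0 : c *: x != 0 by rewrite scaler_eq0 negb_or c0.
apply: P_phase; rewrite ?normalize_unit // => i j.
rewrite !scaleE !rmorphM /= !conj_rc.
have sq y : rc (Num.sqrt (vnsq y))^-1 * rc (Num.sqrt (vnsq y))^-1 = rc (vnsq y)^-1.
  by rewrite -rmorphM /= -expr2 sqr_invsqrt ?vnsq_ge0.
set k1 := rc _; set k2 := rc _.
transitivity ((k1 * k1) * (c * Num.conj c) * (x i * Num.conj (x j))); first ring.
transitivity ((k2 * k2) * (x i * Num.conj (x j))); last ring.
rewrite !sq -nsqE -rmorphM /= vnsqZ; congr (rc _ * _); field.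
by rewrite vnsq_eq0 x0 nsq_eq0.
Qed.

Definition lin3 x y z (s : vec3 R) : V := rc s.1.1 *: x + rc s.1.2 *: y + rc s.2 *: z.

Lemma hdot_lin3 x y z s t : hunit3 x y z -> hdot (lin3 x y z s) (lin3 x y z t) = rc (dot s t).
Proof.
move=> [[xx yy zz] [xy xz yz]].
have yx := hdot_sym0 xy; have zx := hdot_sym0 xz; have zy := hdot_sym0 yz.
rewrite /lin3 !hdotDl !hdotDr !hdotZl !hdotZr xx yy zz xy xz yz yx zx zy !conj_rc.
by rewrite /dot !rmorphD !rmorphM /=; ring.
Qed.

Lemma vnsq_lin3 x y z s : hunit3 x y z -> vnsq (lin3 x y z s) = dot s s.
Proof. by move=> h; apply: rc_inj; rewrite /= -hdotxx hdot_lin3. Qed.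

(** The real span of an orthonormal triple is an isometric copy of R^3, and an orthogonal frame in
    it has the same sum of rank-one projections as the triple itself. *)
Lemma frame_lin3 x y z : hunit3 x y z ->
  frame (fun s => P (normalize (lin3 x y z s))) (P x + P y + P z).
Proof.
move=> h s t u s0 t0 u0 st su tu.
have nz a : dot a a != 0 -> lin3 x y z a != 0.
  by move=> a0; rewrite -vnsq_eq0 vnsq_lin3.
have orth a b : dot a b = 0 -> hdot (normalize (lin3 x y z a)) (normalize (lin3 x y z b)) = 0.
  by move=> ab; rewrite hdotZl hdotZr hdot_lin3 // ab !mulr0.
symmetry; apply: P_frame => //.
  split; first by split; apply/normalize_unit/nz.
  by split; apply: orth.
move=> i j; have H := dual_basis s0 t0 u0 st su tu.
(* [m p q a] is an entry of the real rank-one projection along [a]; Parseval says that over a frame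
   these entries add up to the identity matrix. *)
pose m (p q : vec3 R) (a : vec3 R) : C := rc (dot p a * dot q a / dot a a).
have hm p q : m p q s + m p q t + m p q u = rc (dot p q) by rewrite -!rmorphD /= -H.
have hE a : dot a a != 0 -> normalize (lin3 x y z a) i * Num.conj (normalize (lin3 x y z a) j) =
   m (e1 R) (e1 R) a * (x i * Num.conj (x j)) + m (e2 R) (e2 R) a * (y i * Num.conj (y j))
   + m (e3 R) (e3 R) a * (z i * Num.conj (z j))
   + m (e1 R) (e2 R) a * (x i * Num.conj (y j) + y i * Num.conj (x j))
   + m (e1 R) (e3 R) a * (x i * Num.conj (z j) + z i * Num.conj (x j))
   + m (e2 R) (e3 R) a * (y i * Num.conj (z j) + z i * Num.conj (y j)).
  move=> a0; rewrite /normalize vnsq_lin3 // !(scaleE, ffunE) !(rmorphM, rmorphD) /= !conj_rc.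
  have sq : rc (Num.sqrt (dot a a))^-1 * rc (Num.sqrt (dot a a))^-1 = rc (dot a a)^-1.
    by rewrite -rmorphM /= -expr2 sqr_invsqrt ?dot_ge0.
  have d1 : dot (e1 R) a = a.1.1 by rewrite /dot /=; ring.
  have d2 : dot (e2 R) a = a.1.2 by rewrite /dot /=; ring.
  have d3 : dot (e3 R) a = a.2 by rewrite /dot /=; ring.
  rewrite /m d1 d2 d3 !rmorphM /= -sq.
  by move: (rc _) => k; ring.
rewrite [X in _ = X + _ + _](hE s s0) [X in _ = _ + X + _](hE t t0) [X in _ = _ + X](hE u u0).
have h11 := hm (e1 R) (e1 R); have h22 := hm (e2 R) (e2 R); have h33 := hm (e3 R) (e3 R).
have h12 := hm (e1 R) (e2 R); have h13 := hm (e1 R) (e3 R); have h23 := hm (e2 R) (e3 R).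
rewrite ?e1_unit ?e2_unit ?e3_unit in h11 h22 h33.
have d12 : dot (e1 R) (e2 R) = 0 by rewrite /dot /=; ring.
have d13 : dot (e1 R) (e3 R) = 0 by rewrite /dot /=; ring.
have d23 : dot (e2 R) (e3 R) = 0 by rewrite /dot /=; ring.
rewrite d12 in h12; rewrite d13 in h13; rewrite d23 in h23.
have sub (p q r w : C) : p + q + r = w -> p = w - q - r by move=> <-; ring.
rewrite (sub _ _ _ _ h11) (sub _ _ _ _ h22) (sub _ _ _ _ h33).
rewrite (sub _ _ _ _ h12) (sub _ _ _ _ h13) (sub _ _ _ _ h23).
by rewrite /= rmorph0 rmorph1; ring.
Qed.

Definition qext_pol x y : R := qext (x + y) - qext x - qext y.

Lemma qext_lin3 x y z (a b c : R) : hunit3 x y z ->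
  qext (rc a *: x + rc b *: y + rc c *: z) =
   a ^+ 2 * qext x + b ^+ 2 * qext y + c ^+ 2 * qext z
   + a * b * qext_pol x y + a * c * qext_pol x z + b * c * qext_pol y z.
Proof.
move=> h; pose f s := P (normalize (lin3 x y z s)).
have fM s : dot s s != 0 -> `|f s| <= M.
  by move=> s0; apply/P_bound/normalize_unit; rewrite -vnsq_eq0 vnsq_lin3.
have qE s : quadr f s = qext (lin3 x y z s) by rewrite /quadr /qext vnsq_lin3.
have := @real_gleason _ f _ M (frame_lin3 h) fM a b c; cbv zeta.
by rewrite !qE /lin3 /= !rmorph0 !rmorph1 !scale0r !scale1r !(add0r, addr0).
Qed.

Lemma normalizeK x : x = rc (Num.sqrt (vnsq x)) *: normalize x.
Proof.
have [->|x0] := eqVneq x 0; first by rewrite /normalize !scaler0.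
rewrite /normalize scalerA -rmorphM /= divff ?rmorph1 ?scale1r //.
by rewrite gt_eqF // sqrtr_gt0 lt_def vnsq_ge0 vnsq_eq0 x0.
Qed.

Lemma normalize3 x y z : x != 0 -> y != 0 -> z != 0 ->
  hdot x y = 0 -> hdot x z = 0 -> hdot y z = 0 ->
  hunit3 (normalize x) (normalize y) (normalize z).
Proof.
move=> x0 y0 z0 xy xz yz.
by split; split; rewrite ?normalize_unit // hdotZl hdotZr ?xy ?xz ?yz !mulr0.
Qed.

Lemma qext_orth_form x y z : x != 0 -> y != 0 -> z != 0 ->
  hdot x y = 0 -> hdot x z = 0 -> hdot y z = 0 ->
  exists X Y Z A B D : R, forall a b c : R, qext (rc a *: x + rc b *: y + rc c *: z) =
    a ^+ 2 * X + b ^+ 2 * Y + c ^+ 2 * Z + a * b * A + a * c * B + b * c * D.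
Proof.
move=> x0 y0 z0 xy xz yz; have h := normalize3 x0 y0 z0 xy xz yz.
set x' := normalize x in h; set y' := normalize y in h; set z' := normalize z in h.
pose p := Num.sqrt (vnsq x); pose q := Num.sqrt (vnsq y); pose r := Num.sqrt (vnsq z).
exists (p ^+ 2 * qext x'), (q ^+ 2 * qext y'), (r ^+ 2 * qext z').
exists (p * q * qext_pol x' y'), (p * r * qext_pol x' z'), (q * r * qext_pol y' z') => a b c.
have -> : rc a *: x = rc (a * p) *: x' by rewrite rmorphM /= -scalerA -normalizeK.
have -> : rc b *: y = rc (b * q) *: y' by rewrite rmorphM /= -scalerA -normalizeK.
have -> : rc c *: z = rc (c * r) *: z' by rewrite rmorphM /= -scalerA -normalizeK.
rewrite (qext_lin3 (a * p) (b * q) (c * r) h).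
move: (qext x') (qext y') (qext z') (qext_pol x' y') (qext_pol x' z') (qext_pol y' z') p q r.
by clear=> *; ring.
Qed.

End ComplexGleason.

(** * Polarization and sesquilinearity in dimension at least three *)

Section Polarization.
Variables (R : realType) (I : finType).
Local Notation C := (R[i]).
Local Notation rc := (@real_complex R).
Local Notation V := {ffun I -> C}.
Implicit Types (x y z : V) (c d : C).
Local Notation delta := (@delta R I).
Variable F : V -> R.
Hypothesis F0 : F 0 = 0.
Hypothesis FZ : forall c x, F (c *: x) = nsq c * F x.
Hypothesis F_form : forall x y z, x != 0 -> y != 0 -> z != 0 ->
  hdot x y = 0 -> hdot x z = 0 -> hdot y z = 0 ->
  exists X Y Z A B D : R, forall a b c : R, F (rc a *: x + rc b *: y + rc c *: z) =
    a ^+ 2 * X + b ^+ 2 * Y + c ^+ 2 * Z + a * b * A + a * c * B + b * c * D.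

Definition qpol x y : R := F (x + y) - F x - F y.

Lemma rc0 : rc 0 = 0. Proof. by []. Qed.
Lemma rc1 : rc 1 = 1. Proof. by []. Qed.

Lemma qf_orth3 x y z : hdot x y = 0 -> hdot x z = 0 -> hdot y z = 0 ->
  F (x + y + z) = F (x + y) + F (x + z) + F (y + z) - F x - F y - F z.
Proof.
move=> xy xz yz.
have [->|x0] := eqVneq x 0; first by rewrite !add0r F0; ring.
have [->|y0] := eqVneq y 0; first by rewrite add0r addr0 F0; ring.
have [->|z0] := eqVneq z 0; first by rewrite !addr0 F0; ring.
have [X [Y [Z [A [B [D H]]]]]] := F_form x0 y0 z0 xy xz yz.
have := H 1 1 1; have := H 1 1 0; have := H 1 0 1; have := H 0 1 1.
have := H 1 0 0; have := H 0 1 0; have := H 0 0 1.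
rewrite rc0 rc1 !scale0r !scale1r !add0r !addr0.
by move=> -> -> -> -> -> -> ->; ring.
Qed.

Lemma qpolC x y : qpol x y = qpol y x.
Proof. by rewrite /qpol [y + x]addrC; ring. Qed.

Lemma qpol0l y : qpol 0 y = 0.
Proof. by rewrite /qpol add0r F0; ring. Qed.

(** The third vector completes [x], [y] to a triple on which the real form is available; this is
    where dimension at least 3 enters. *)
Lemma qpol_real x y z (t : R) : z != 0 -> hdot x y = 0 -> hdot x z = 0 -> hdot y z = 0 ->
  qpol (rc t *: x) y = t * qpol x y.
Proof.
move=> z0 xy xz yz.
have [->|x0] := eqVneq x 0; first by rewrite scaler0 qpol0l mulr0.
have [->|y0] := eqVneq y 0.
  by rewrite ![qpol _ 0]qpolC !qpol0l mulr0.
have [X [Y [Z [A [B [D H]]]]]] := F_form x0 y0 z0 xy xz yz.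
have := H 1 1 0; have := H t 1 0; have := H 1 0 0; have := H 0 1 0; have := H t 0 0.
rewrite rc0 rc1 !scale0r !scale1r !add0r !addr0 /qpol.
by move=> -> -> -> -> ->; ring.
Qed.

Lemma qpolZ c x y : qpol (c *: x) (c *: y) = nsq c * qpol x y.
Proof. by rewrite /qpol -scalerDr !FZ; ring. Qed.

Lemma qf_sum (s : seq I) (G : I -> V) x : uniq s ->
  (forall i, i \in s -> hdot x (G i) = 0) ->
  (forall i j, i \in s -> j \in s -> i != j -> hdot (G i) (G j) = 0) ->
  F (x + \sum_(i <- s) G i)
    = F x + F (\sum_(i <- s) G i) + \sum_(i <- s) qpol x (G i).
Proof.
elim: s x => [|a s IH] x /=; first by rewrite !big_nil F0 !addr0.
move=> /andP[as_ us] xF FF; rewrite !big_cons addrA.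
have Fs i : i \in s -> i \in a :: s by move=> h; rewrite inE h orbT.
have Fa : a \in a :: s by rewrite mem_head.
have hsum y : (forall i, i \in s -> hdot y (G i) = 0) -> hdot y (\sum_(i <- s) G i) = 0.
  move=> h; rewrite big_seq; elim/big_ind: _ => [|u v hu hv|i /h //]; first exact: hdot0r.
  by rewrite hdotDr hu hv addr0.
have aF i : i \in s -> hdot (G a) (G i) = 0.
  move=> hi; apply: (FF _ _ Fa (Fs _ hi)); apply/eqP => ai.
  by rewrite ai hi in as_.
have {}IH := IH x us (fun i hi => xF i (Fs i hi)) (fun i j hi hj => FF i j (Fs i hi) (Fs j hj)).
rewrite qf_orth3 ?xF ?hsum // => [|i hi]; last by rewrite xF ?Fs.
by rewrite IH /qpol; ring.
Qed.

Lemma sum_pairs_cons (q : I -> I -> R) a s : a \notin s -> (forall i j, q i j = q j i) ->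
  \sum_(i <- a :: s) \sum_(j <- a :: s | j != i) q i j =
  2 * (\sum_(j <- s) q a j) + \sum_(i <- s) \sum_(j <- s | j != i) q i j.
Proof.
move=> as_ qC; have ne i : i \in s -> i != a.
  by move=> hi; apply/eqP => ia; rewrite -ia hi in as_.
rewrite big_cons; have -> : \sum_(j <- a :: s | j != a) q a j = \sum_(j <- s) q a j.
  rewrite big_cons eqxx /= big_seq_cond [RHS]big_seq; apply: eq_bigl => i.
  by case hi: (i \in s) => //=; rewrite ne.
have -> : \sum_(i <- s) \sum_(j <- a :: s | j != i) q i j =
   \sum_(j <- s) q a j + \sum_(i <- s) \sum_(j <- s | j != i) q i j.
  rewrite -big_split /= big_seq [RHS]big_seq; apply: eq_bigr => i hi.
  by rewrite big_cons eq_sym ne //= qC.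
by rewrite mulr_natl mulr2n addrA.
Qed.

(** Doubling both sides lets the cross terms run over ordered pairs, so that no order on [I] is
    needed. *)
Lemma qf_sum2 (s : seq I) (G : I -> V) : uniq s ->
  (forall i j, i \in s -> j \in s -> i != j -> hdot (G i) (G j) = 0) ->
  2 * F (\sum_(i <- s) G i) = 2 * (\sum_(i <- s) F (G i)) +
    \sum_(i <- s) \sum_(j <- s | j != i) qpol (G i) (G j).
Proof.
elim: s => [|a s IH]; first by rewrite !big_nil F0 !mulr0 addr0.
rewrite cons_uniq => /andP[as_ us] FF.
have Fs i : i \in s -> i \in a :: s by move=> h; rewrite inE h orbT.
have Fa : a \in a :: s by rewrite mem_head.
have ne i : i \in s -> a != i by move=> hi; apply/eqP => ia; rewrite ia hi in as_.
have {}IH := IH us (fun i j hi hj => FF i j (Fs i hi) (Fs j hj)).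
have qC i j : qpol (G i) (G j) = qpol (G j) (G i) by apply: qpolC.
rewrite (sum_pairs_cons as_ qC) big_cons [\sum_(i <- a :: s) F _]big_cons.
have H := qf_sum us (fun i hi => FF a i Fa (Fs i hi) (ne i hi))
  (fun i j hi hj => FF i j (Fs i hi) (Fs j hj)).
rewrite {}H; move: IH; move: (F (G a)) (F _) (\sum_(i <- s) F _).
move: (\sum_(i <- s) qpol _ _) (\sum_(i <- s) \sum_(j <- s | _) _) => A B X Y Z IH.
by rewrite mulrDr [2 * (X + Y)]mulrDr IH; ring.
Qed.

Hypothesis card3 : (3 <= #|I|)%N.

Lemma third (i j : I) : exists k, (k != i) && (k != j).
Proof.
have /subsetPn[k _ hk] : ~~ ([set: I] \subset [set i; j]).
  apply/negP => /subset_leq_card; rewrite cardsT leqNgt (leq_ltn_trans _ card3) //.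
  by rewrite cards2; case: eqP.
by exists k; move: hk; rewrite !inE negb_or.
Qed.

Definition bet i j c : R := qpol (c *: delta i) (delta j).

Lemma bet_real i j (t : R) c : i != j -> bet i j (rc t * c) = t * bet i j c.
Proof.
move=> ij; have [k /andP[ki kj]] := third i j.
rewrite /bet -scalerA (qpol_real (z := delta k)) ?delta_neq0 //.
- by rewrite hdotZl hdot_delta (negbTE ij) mulr0.
- by rewrite hdotZl hdot_delta eq_sym (negbTE ki) mulr0.
- by rewrite hdot_delta eq_sym (negbTE kj).
Qed.

(** Multiplying both arguments by the conjugate of [d] scales the polarization by |d|^2 and makes
    the second coefficient the real number |d|^2, which real homogeneity extracts again. *)
Lemma qpol_bet i j c d : i != j ->
  qpol (c *: delta i) (d *: delta j) = bet i j (c * Num.conj d).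
Proof.
move=> ij; have [->|d0] := eqVneq d 0.
  by rewrite scale0r rmorph0 mulr0 qpolC qpol0l /bet scale0r qpol0l.
have nd0 : nsq d != 0 by rewrite nsq_eq0.
have nd : nsq (Num.conj d) = nsq d by apply: rc_inj; rewrite /= !nsqE conjCK mulrC.
have [k /andP[ki kj]] := third i j.
have dd : Num.conj d * d = rc (nsq d) by rewrite nsqE mulrC.
have E1 := qpolZ (Num.conj d) (c *: delta i) (d *: delta j).
rewrite nd !scalerA dd [Num.conj d * c]mulrC in E1.
apply: (mulfI nd0); refine (etrans (esym E1) (etrans (qpolC _ _) _)).
refine (etrans _ (congr1 _ (qpolC _ _))).
apply: (@qpol_real _ _ (delta k)); first exact: delta_neq0.
- by rewrite hdotZr hdot_delta eq_sym (negbTE ij) mulr0.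
- by rewrite hdot_delta eq_sym (negbTE kj).
- by rewrite hdotZl hdot_delta eq_sym (negbTE ki) mulr0.
Qed.

Lemma bet_conj i j c : i != j -> bet j i (Num.conj c) = bet i j c.
Proof.
move=> ij; have ji : j != i by rewrite eq_sym.
have := qpol_bet 1 c ji; rewrite mul1r scale1r => E.
exact: (etrans (esym E) (qpolC _ _)).
Qed.

Lemma qf_three i j k (p q r : C) : i != j -> i != k -> j != k ->
  F (p *: delta i + q *: delta j + r *: delta k) =
  nsq p * F (delta i) + nsq q * F (delta j) + nsq r * F (delta k) +
  bet i j (p * Num.conj q) + bet i k (p * Num.conj r) + bet j k (q * Num.conj r).
Proof.
move=> ij ik jk.
have E1 := qpol_bet p q ij; have E2 := qpol_bet p r ik; have E3 := qpol_bet q r jk.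
have F1 := FZ p (delta i); have F2 := FZ q (delta j); have F3 := FZ r (delta k).
have orth a b (c d : C) : a != b -> hdot (c *: delta a) (d *: delta b) = 0.
  by move=> ab; rewrite hdotZl hdotZr hdot_delta (negbTE ab) !mulr0.
have := qf_orth3 (orth _ _ p q ij) (orth _ _ p r ik) (orth _ _ q r jk).
move=> H; apply: (etrans H); rewrite {H} /qpol in E1 E2 E3 *.
have add6 (a1 a2 a3 a4 a5 a6 b1 b2 b3 b4 b5 b6 : R) : a1 = b1 -> a2 = b2 -> a3 = b3 ->
    a4 = b4 -> a5 = b5 -> a6 = b6 -> a1 + a2 + a3 + a4 + a5 + a6 = b1 + b2 + b3 + b4 + b5 + b6.
  by move=> -> -> -> -> -> ->.
apply: (etrans _ (add6 _ _ _ _ _ _ _ _ _ _ _ _ F1 F2 F3 E1 E2 E3)).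
have aux (a b c d e f : R) : d + e + f - a - b - c
    = a + b + c + (d - a - b) + (e - a - c) + (f - b - c) by ring.
exact: aux.
Qed.

Lemma qf_orth_parallelogram x y z : z != 0 -> hdot x y = 0 -> hdot x z = 0 -> hdot y z = 0 ->
  F (x + y) + F (x - y) = 2 * F x + 2 * F y.
Proof.
move=> z0 xy xz yz; have := qpol_real (-1) z0 (hdot_sym0 xy) yz xz.
have -> : rc (-1) *: y = - y by rewrite rmorphN rmorph1 scaleN1r.
rewrite /qpol [- y + x]addrC [y + x]addrC -[- y]scaleN1r FZ.
by rewrite nsqN nsq1; lra.
Qed.

(** The computation behind [bet_midpoint], on abstract functions. Adding the identities for s = 1
    and s = -1 removes the odd terms [B2] and [B3], and the parallelogram law for [nsq] removes the
    diagonal ones. *)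
Lemma midpoint_cancel (T : C -> C -> C -> R) (B1 B2 B3 : C -> R) (f1 f2 f3 : R) (b b' e : C) :
  (forall p q r, T p q r = nsq p * f1 + nsq q * f2 + nsq r * f3 + B1 (p * Num.conj q)
     + B2 (p * Num.conj r) + B3 (q * Num.conj r)) ->
  B1 0 = 0 -> (forall d, B2 (- d) = - B2 d) -> (forall d, B3 (- d) = - B3 d) ->
  (forall s, s * s = 1 -> Num.conj s = s ->
    T 1 (b + b') (s - s * e) + T 1 (b - b') (s + s * e)
    = 2 * T 1 b s + 2 * T 0 b' (- (s * e))) ->
  B1 (Num.conj (b + b')) + B1 (Num.conj (b - b')) = 2 * B1 (Num.conj b).
Proof.
move=> FT b0 odd2 odd3 par.
have avg (p q r : C) : T p q r + T p q (- r) = 2 * (nsq p * f1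
    + nsq q * f2 + nsq r * f3 + B1 (p * Num.conj q)).
  by rewrite !FT nsqN rmorphN !mulrN odd2 odd3; ring.
have p1 := par 1 (mulr1 1) (rmorph1 _).
have p2 : (T 1 (b + b') (- (1 - e))) + (T 1 (b - b') (- (1 + e)))
    = 2 * (T 1 b (- 1)) + 2 * (T 0 b' (- (- e))).
  have -> : - (1 - e) = -1 - -1 * e by ring.
  have -> : - (1 + e) = -1 + -1 * e by ring.
  have -> : - - e = - (-1 * e) by ring.
  by apply: par; rewrite ?mulrNN ?mulr1 // rmorphN rmorph1.
rewrite !mul1r in p1.
have a1 := avg 1 (b + b') (1 - e); have a2 := avg 1 (b - b') (1 + e).
have a3 := avg 1 b 1; have a4 := avg 0 b' (- e).
rewrite !mul1r in a1 a2 a3; rewrite mul0r in a4.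
have npar (u v : C) : nsq (u + v) = 2 * nsq u + 2 * nsq v - nsq (u - v).
  by rewrite /nsq; case: (u) => ? ?; case: (v) => ? ? /=; ring.
rewrite b0 nsq0 nsqN (npar b b') nsq1 (npar 1 e) nsq1 in a1 a2 a3 a4.
lra.
Qed.

(* Adding the parallelogram identities of the two orthogonal pairs
   (1, b, 1), (0, b', - b' b^* ) and (1, b, - 1), (0, b', b' b^* )
   cancels every cross term except those between the coordinates i and j. *)
Lemma bet_midpoint i j (b b' : C) : i != j ->
  bet i j (Num.conj (b + b')) + bet i j (Num.conj (b - b')) = 2 * bet i j (Num.conj b).
Proof.
move=> ij; have [k /andP[ki kj]] := third i j.
have [->|b'0] := eqVneq b' 0; first by rewrite addr0 subr0; ring.
have ik : i != k by rewrite eq_sym.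
have jk : j != k by rewrite eq_sym.
pose w (p q r : C) : V := p *: delta i + q *: delta j + r *: delta k.
have wdot p q r p' q' r' : hdot (w p q r) (w p' q' r') =
    p * Num.conj p' + q * Num.conj q' + r * Num.conj r'.
  rewrite !hdotDl !hdotDr !hdotZl !hdotZr !hdot_delta !eqxx.
  by rewrite [j == i]eq_sym [k == i]eq_sym [k == j]eq_sym
    (negbTE ij) (negbTE ik) (negbTE jk) /=; ring.
have wD p q r p' q' r' : w p q r + w p' q' r' = w (p + p') (q + q') (r + r').
  rewrite /w !scalerDl; have ac (a1 a2 b1 b2 c1 c2 : V) :
      a1 + b1 + c1 + (a2 + b2 + c2) = (a1 + a2) + (b1 + b2) + (c1 + c2).
    by rewrite addrACA (addrACA a1).
  exact: ac.
have wB p q r p' q' r' : w p q r - w p' q' r' = w (p - p') (q - q') (r - r').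
  have -> : - w p' q' r' = w (- p') (- q') (- r') by rewrite /w !scaleNr !opprD.
  exact: wD.
pose e := Num.conj b * b'.
have par s : s * s = 1 -> Num.conj s = s ->
    F (w 1 (b + b') (s - s * e)) + F (w 1 (b - b') (s + s * e))
    = 2 * F (w 1 b s) + 2 * F (w 0 b' (- (s * e))).
  move=> ss cs.
  (* The conjugated cross product of the two vectors, orthogonal to both; its last coordinate shows
     that it is nonzero. *)
  pose z := w (- (s * Num.conj b') - s * b * Num.conj b * Num.conj b') (s * b * Num.conj b') (Num.conj b').
  have z0 : z != 0.
    apply/eqP => /ffunP/(_ k); rewrite !(scaleE, ffunE) eqxx [k == i]eq_sym [k == j]eq_sym.
    rewrite (negbTE ik) (negbTE jk) !mulr0 !add0r mulr1 => /eqP.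
    by rewrite fmorph_eq0 (negbTE b'0).
  have cr : Num.conj (Num.conj b) = b by rewrite conjCK.
  have cr' : Num.conj (Num.conj b') = b' by rewrite conjCK.
  have := @qf_orth_parallelogram (w 1 b s) (w 0 b' (- (s * e))) z z0.
  rewrite wD wB !addr0 subr0 opprK; apply.
  - rewrite /z /e wdot !(rmorphN, rmorphM, rmorph0) /= cs ?cr.
    transitivity (b * Num.conj b' - (s * s) * (b * Num.conj b')); first ring.
    by rewrite ss; ring.
  - rewrite /z /e wdot !(rmorphN, rmorphD, rmorphM, rmorph1) /= cs ?cr ?cr'.
    ring.
  - rewrite /z /e wdot !(rmorphN, rmorphM, rmorph0) /= cs ?cr ?cr'.
    rewrite /e; ring.
have odd (a c : I) (d : C) : a != c -> bet a c (- d) = - bet a c d.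
  move=> ac; have := bet_real (-1) d ac.
  have -> : rc (-1) = -1 by rewrite rmorphN rmorph1.
  by rewrite !mulN1r.
have b0 : bet i j 0 = 0 by have := bet_real 0 0 ij; rewrite mulr0 mul0r.
apply: (midpoint_cancel (fun p q r => qf_three p q r ij ik jk) b0
  (fun d => odd i k d ik) (fun d => odd j k d jk) par).
Qed.

Lemma real_linear_expand (B : C -> R) : (forall (t : R) c, B (rc t * c) = t * B c) ->
  (forall c d, B (c + d) = B c + B d) ->
  forall c, B c = complex.Re c * B 1 + complex.Im c * B (Complex 0 1).
Proof.
move=> BZ BD c; have {1}-> : c = rc (complex.Re c) * 1 + rc (complex.Im c) * Complex 0 1.
  by case: c => a b; apply/eqP; rewrite eq_complex /=; apply/andP; split; apply/eqP; ring.
by rewrite BD !BZ.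
Qed.

(** Taking half sum and half difference of [c] and [d] turns the midpoint identity into B c + B d =
    2 B ((c + d) / 2), and real homogeneity absorbs the 2. *)
Lemma midpoint_additive (B : C -> R) : (forall (t : R) c, B (rc t * c) = t * B c) ->
  (forall b b', B (Num.conj (b + b')) + B (Num.conj (b - b')) = 2 * B (Num.conj b)) ->
  forall c d, B (c + d) = B c + B d.
Proof.
move=> BZ BM c d; have := BM (Num.conj ((c + d) / 2)) (Num.conj ((c - d) / 2)).
rewrite -rmorphD -rmorphB !conjCK.
have -> : (c + d) / 2 + (c - d) / 2 = c by field.
have -> : (c + d) / 2 - (c - d) / 2 = d by field.
move=> ->; rewrite -BZ; congr B.
by rewrite rmorph_nat mulrC divfK // pnatr_eq0.
Qed.

Lemma hermitian_pair (B B' : C -> R) : (forall (t : R) c, B (rc t * c) = t * B c) ->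
  (forall c d, B (c + d) = B c + B d) -> (forall c, B' (Num.conj c) = B c) ->
  forall c, c * Complex (B 1 / 2) (- B (Complex 0 1) / 2)
    + Num.conj c * Complex (B' 1 / 2) (- B' (Complex 0 1) / 2) = rc (B c).
Proof.
move=> BZ BD BC c; have b1 : B' 1 = B 1 by rewrite -BC rmorph1.
have b2 : B' (Complex 0 1) = - B (Complex 0 1).
  have E : Complex 0 1 = Num.conj (Complex 0 (- 1)) :> C.
    by rewrite -[RHS]/(Complex 0 (- (- 1))) opprK.
  rewrite [in LHS]E BC -[RHS]mulN1r -BZ; congr B.
  by apply/eqP; rewrite eq_complex /=; apply/andP; split; apply/eqP; ring.
rewrite b1 b2 (real_linear_expand BZ BD c).
move: (B 1) (B _) => p q; case: c => a b.
rewrite -[Num.conj _]/(Complex a (- b)).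
by apply/eqP; rewrite eq_complex /=; apply/andP; split; apply/eqP; field.
Qed.

(** Off the diagonal, the coefficient of the complex-linear part of the real-linear map [bet i j];
    its antilinear part is supplied by [tau j i]. *)
Definition tau i j : C :=
  if i == j then rc (F (delta i)) else Complex (bet i j 1 / 2) (- bet i j (Complex 0 1) / 2).

Lemma tau_pair i j c : i != j -> c * tau i j + Num.conj c * tau j i = rc (bet i j c).
Proof.
move=> ij; have ji : j != i by rewrite eq_sym.
have BZ t d := bet_real t d ij.
have BD := midpoint_additive BZ (fun b b' => bet_midpoint b b' ij).
rewrite /tau (negbTE ij) (negbTE ji).
exact: (hermitian_pair BZ BD (fun d => bet_conj d ij)).
Qed.

Lemma qf_sesquilinear x : rc (F x) = \sum_i \sum_j x i * Num.conj (x j) * tau i j.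
Proof.
have two0 : (2 : C) != 0 by rewrite pnatr_eq0.
apply: (mulfI two0); rewrite -[2 in LHS](rmorph_nat (real_complex R)) -rmorphM /=.
have orth i j : i \in enum I -> j \in enum I -> i != j ->
    hdot (x i *: delta i) (x j *: delta j) = 0.
  by move=> _ _ ij; rewrite hdotZl hdotZr hdot_delta (negbTE ij) !mulr0.
have := qf_sum2 (enum_uniq I) orth.
have e1 : \sum_(i <- enum I) x i *: delta i = x by rewrite big_enum /= -sum_delta.
rewrite e1 => ->.
have -> : \sum_(i <- enum I) F (x i *: delta i) = \sum_i nsq (x i) * F (delta i).
  by rewrite big_enum /=; apply: eq_bigr => i _; rewrite FZ.
have -> : \sum_(i <- enum I) \sum_(j <- enum I | j != i) qpol (x i *: delta i) (x j *: delta j)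
    = \sum_i \sum_(j | j != i) bet i j (x i * Num.conj (x j)).
  rewrite big_enum /=; apply: eq_bigr => i _; rewrite big_enum_cond /=.
  by apply: eq_bigr => j ji; rewrite qpol_bet // eq_sym.
pose S := \sum_i \sum_(j | j != i) x i * Num.conj (x j) * tau i j.
have -> : \sum_i \sum_j x i * Num.conj (x j) * tau i j = rc (\sum_i nsq (x i) * F (delta i)) + S.
  rewrite rmorph_sum -big_split /=; apply: eq_bigr => i _.
  by rewrite (bigD1 i) //= rmorphM /= nsqE /tau eqxx.
rewrite rmorphD rmorphM /= rmorph_nat mulrDr; congr (_ + _).
rewrite mulr_natl mulr2n rmorph_sum /=.
have {2}-> : S = \sum_i \sum_(j | j != i) x j * Num.conj (x i) * tau j i.
  rewrite /S (exchange_big_dep predT) //=; apply: eq_bigr => i _.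
  by apply: eq_bigl => j; rewrite eq_sym.
rewrite -big_split /=; apply: eq_bigr => i _; rewrite rmorph_sum -big_split /=.
apply: eq_bigr => j ji; rewrite -tau_pair; last by rewrite eq_sym.
by rewrite rmorphM /= conjCK [Num.conj _ * _]mulrC.
Qed.

End Polarization.

(** * Gleason's theorem on C^n for n different from 2 *)

Section ComplexGleasonMain.
Variables (R : realType) (I : finType).
Local Notation C := (R[i]).
Local Notation V := {ffun I -> C}.

(** The numbers [x i * Num.conj (x j)] are the entries of the projection onto the line of [x], so
    the last two hypotheses on [P] say that it comes from an additive function of projections. *)
Theorem complex_gleason (P : V -> R) (M : R) :
  (forall x, hdot x x = 1 -> `|P x| <= M) ->
  (forall x y, hdot x x = 1 -> hdot y y = 1 ->
    (forall i j, x i * Num.conj (x j) = y i * Num.conj (y j)) -> P x = P y) ->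
  (forall x y z x' y' z', hunit3 x y z -> hunit3 x' y' z' ->
    (forall i j, x i * Num.conj (x j) + y i * Num.conj (y j) + z i * Num.conj (z j)
       = x' i * Num.conj (x' j) + y' i * Num.conj (y' j) + z' i * Num.conj (z' j)) ->
    P x + P y + P z = P x' + P y' + P z') ->
  #|I| != 2 ->
  exists t : I -> I -> C, forall x, hdot x x = 1 ->
    ((P x)%:C)%C = \sum_i \sum_j x i * Num.conj (x j) * t i j.
Proof.
move=> PM Pph Pfr.
have [lt3 ne2|ge3 _] := ltnP #|I| 3.
  (* In dimension 1 all unit vectors span the same line, and in dimension 0 there are none. *)
  have [/eqP/cards1P|ne1] := eqVneq #|[set: I]| 1%N.
    move=> [i0 hI]; have all0 i : i = i0 by apply/set1P; rewrite -hI inE.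
    exists (fun _ _ => ((P (delta R i0))%:C)%C) => x hx.
    have big0 (f : I -> C) : \sum_i f i = f i0.
      by rewrite (bigD1 i0) //= big1 ?addr0 // => i; rewrite (all0 i) eqxx.
    have xx : x i0 * Num.conj (x i0) = 1 by rewrite -hx /hdot big0.
    rewrite !big0 xx mul1r; congr (_%:C)%C; apply: Pph => //; first by rewrite hdot_delta eqxx.
    by move=> i j; rewrite (all0 i) (all0 j) xx ffunE eqxx mul1r rmorph1.
  have I0 : #|I| = 0%N by move: lt3 ne2 ne1; rewrite cardsT; case: #|I| => [|[|[|]]].
  exists (fun _ _ => 0) => x; rewrite /hdot big1 => [/esym/eqP|i]; first by rewrite oner_eq0.
  by have /card0_eq/(_ i) := I0; rewrite !inE.
pose F := qext P.
exists (tau F) => x hx; have x1 : vnsq x = 1 by apply: rc_inj; rewrite /= -hdotxx hx.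
have <- : F x = P x.
  by rewrite /F /qext /normalize x1 sqrtr1 invr1 mul1r rmorph1 scale1r.
apply: qf_sesquilinear => //.
- exact: qext0.
- by move=> c y; apply: qextZ.
- by move=> u v w u0 v0 w0 uv uw vw; apply: (qext_orth_form PM Pfr).
Qed.

End ComplexGleasonMain.

(** * Finite-dimensional star-algebras *)

Section StarAlgebra.
Variables (R : realType) (A : algType R[i]) (star : A -> A).
Local Notation C := (R[i]).
Local Notation rc := (@real_complex R).
Implicit Types (a b p q e x y T S : A) (c d : C).

(** The last two fields are what positivity of the inner product gives algebraically: [star_proper]
    yields nonzero squares, and [star_pos] allows a square root when a partial isometry is
    normalized. *)
Record proper_star : Prop := ProperStar {
  starD : forall a b, star (a + b) = star a + star b;
  starZ : forall c a, star (c *: a) = Num.conj c *: star a;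
  starM : forall a b, star (a * b) = star b * star a;
  starK : forall a, star (star a) = a;
  star_proper : forall a, star a * a = 0 -> a = 0;
  star_pos : forall a p c, star a * a = c *: p -> p != 0 -> p * p = p -> star p = p -> 0 <= c
}.

Record fd_star_subalg (B : A -> Prop) : Prop := FdStarSubalg {
  fd0 : B 0;
  fdD : forall a b, B a -> B b -> B (a + b);
  fdZ : forall c a, B a -> B (c *: a);
  fdM : forall a b, B a -> B b -> B (a * b);
  fdS : forall a, B a -> B (star a);
  fd_span : exists n (f : 'I_n -> A), forall a, B a -> exists c : 'I_n -> C,
    a = \sum_i c i *: f i
}.

Hypothesis Hs : proper_star.
Variable B : A -> Prop.
Hypothesis HB : fd_star_subalg B.

Let sD := starD Hs.
Let sZ := starZ Hs.
Let sM := starM Hs.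
Let sK := starK Hs.

Lemma star0 : star 0 = 0.
Proof. by have := sZ 0 0; rewrite rmorph0 !scale0r. Qed.

Lemma starN a : star (- a) = - star a.
Proof. by have := sZ (-1) a; rewrite rmorphN rmorph1 !scaleN1r. Qed.

Lemma starB a b : star (a - b) = star a - star b.
Proof. by rewrite sD starN. Qed.

Lemma star1 : star 1 = 1.
Proof. by have := sM (star 1) 1; rewrite mulr1 sK mulr1 => <-. Qed.

Lemma star_sum (J : Type) (s : seq J) (P : pred J) (G : J -> A) :
  star (\sum_(j <- s | P j) G j) = \sum_(j <- s | P j) star (G j).
Proof. exact: (big_morph star sD star0). Qed.

Lemma fdN a : B a -> B (- a).
Proof. by move=> h; rewrite -scaleN1r; apply: fdZ. Qed.

Lemma fdB a b : B a -> B b -> B (a - b).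
Proof. by move=> ha hb; apply: fdD => //; apply: fdN. Qed.

Lemma fd_sum (J : Type) (s : seq J) (P : pred J) (G : J -> A) :
  (forall j, P j -> B (G j)) -> B (\sum_(j <- s | P j) G j).
Proof. by move=> h; apply: big_ind => //; [apply: fd0 | apply: fdD]. Qed.

Lemma fd_sum_seq (s : seq A) : (forall a, a \in s -> B a) -> B (\sum_(a <- s) a).
Proof. by move=> h; rewrite big_seq; apply: fd_sum. Qed.

Lemma fd_dependent : exists n, forall m (g : 'I_m -> A), (forall i, B (g i)) -> (n < m)%N ->
  exists c : 'I_m -> C, (exists i, c i != 0) /\ \sum_i c i *: g i = 0.
Proof.
have [n [f hf]] := fd_span HB; exists n => m g hg nm.
have /boolp.choice[M hM] : forall i, exists c : 'I_n -> C, g i = \sum_j c j *: f j.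
  by move=> i; apply: hf.
pose X : 'M[C]_(m, n) := \matrix_(i, j) M i j.
have : kermx X != 0.
  by rewrite -mxrank_eq0 mxrank_ker -lt0n subn_gt0 (leq_ltn_trans (rank_leq_col _)).
case/rowV0Pn => v /sub_kermxP vX v0; exists (fun i => v 0 i); split.
  by apply/existsP; apply: contraNT v0; rewrite negb_exists => /forallP h;
    apply/eqP/rowP => i; rewrite !mxE; apply/eqP; have := h i; rewrite negbK.
transitivity (\sum_j (v *m X) 0 j *: f j); last first.
  by rewrite vX big1 // => j _; rewrite mxE scale0r.
rewrite (eq_bigr (fun i => \sum_j (v 0 i * M i j) *: f j)); last first.
  by move=> i _; rewrite hM scaler_sumr; apply: eq_bigr => j _; rewrite scalerA.
rewrite exchange_big /=; apply: eq_bigr => j _; rewrite !mxE scaler_suml.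
by apply: eq_bigr => i _; rewrite mxE.
Qed.

Definition proj p := [/\ B p, p * p = p & star p = p].

Section Eigenprojection.
Variable T : A.
Hypotheses (BT : B T) (sT : star T = T).

(** The initial factor [T] keeps these polynomials inside [B], which need not contain 1, and later
    makes the eigenprojection a multiple of [T]. *)
Inductive powers : A -> Prop :=
  | powers_base : powers T
  | powers_step y (z : C) : powers y -> powers (y * (T - z%:A)).

Lemma powers_prop y : powers y -> [/\ B y, y * T = T * y & exists u, y = T * u /\ T * u = u * T].
Proof.
elim=> [|{}y z _ [By yT [u [yu uT]]]]; first by split=> //; exists 1; rewrite mulr1 mul1r.
have zT a : a * z%:A = z *: a by rewrite -scalerAr mulr1.
have Tz a : z%:A * a = z *: a by rewrite -scalerAl mul1r.
have comm : (T - z%:A) * T = T * (T - z%:A) by rewrite mulrBl mulrBr zT Tz.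
split.
- by rewrite mulrBr zT; apply: fdB; [apply: fdM | apply: fdZ].
- by rewrite -mulrA comm !mulrA yT.
exists (u * (T - z%:A)); rewrite yu mulrA; split=> //.
by rewrite -[RHS]mulrA comm !mulrA uT.
Qed.

Lemma powers_eigen y S r : powers y -> T * S = r *: S ->
  (exists c, y * S = c *: S) /\ (exists c, star y * S = c *: S).
Proof.
move=> py TS; elim: py => [|{}y z _ [[c yS] [d yS']]].
  by split; exists r; rewrite ?sT.
have h w : (T - w%:A) * S = (r - w) *: S by rewrite mulrBl TS -scalerAl mul1r scalerBl.
split; first by exists (c * (r - z)); rewrite -mulrA h -scalerAr yS scalerA mulrC.
exists (d * (r - Num.conj z)).
rewrite sM starB sT sZ star1 -mulrA yS' -scalerAr h scalerA //.
Qed.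

(** The last product that is still nonzero is killed by the next factor [T - z], so it is an
    eigenvector for [z]. *)
Lemma powers_descend (rs : seq C) y : powers y -> y != 0 ->
  y * \prod_(z <- rs) (T - z%:A) = 0 ->
  exists w r, [/\ powers w, w != 0 & T * w = r *: w].
Proof.
elim: rs y => [|z rs IH] y py y0; first by rewrite big_nil mulr1 => h; rewrite h eqxx in y0.
rewrite big_cons mulrA; have [h _|h] := eqVneq (y * (T - z%:A)) 0.
  exists y, z; split=> //; have [_ yT _] := powers_prop py.
  by move/eqP: h; rewrite mulrBr -scalerAr mulr1 subr_eq0 yT => /eqP.
by apply: IH => //; apply: powers_step.
Qed.

Lemma powers_annihilated : exists rs : seq C, T * \prod_(z <- rs) (T - z%:A) = 0.
Proof.
have BX i : B (T ^+ i.+1).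
  by elim: i => [|i IH]; rewrite ?expr1 // exprS; apply: fdM.
have [n dep] := fd_dependent.
have [c [[i0 ci0] hc]] := dep n.+1 (fun i : 'I_n.+1 => T ^+ i.+1) (fun i => BX i) (ltnSn n).
(* A linear relation among T, ..., T^(n+1) reads T Q(T) = 0 with [Q] nonzero, and [Q] splits over
   the complex numbers. *)
pose Q : {poly C} := \poly_(i < n.+1) c (inord i).
have Q0 : Q != 0.
  apply/eqP => h; move: ci0; have : Q`_i0 = 0 by rewrite h coef0.
  by rewrite coef_poly ltn_ord inord_val => ->; rewrite eqxx.
have [rs hrs] := closed_field_poly_normal Q.
exists rs.
have hQ : T * horner_alg T Q = 0.
  rewrite -hc /Q poly_def !rmorph_sum mulr_sumr; apply: eq_bigr => i _ /=.
  rewrite linearZ /= rmorphXn /= horner_algX inord_val exprS.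
  by rewrite mulr_algl -scalerAr.
have lc0 : lead_coef Q != 0 by rewrite lead_coef_eq0.
apply: (scalerI lc0); rewrite scaler0 -[RHS]hQ [in RHS]hrs linearZ /= mulr_algl -scalerAr.
congr (_ *: (_ * _)); rewrite rmorph_prod; apply: eq_bigr => z _.
by rewrite rmorphB /= horner_algX horner_algC.
Qed.

(** For an eigenvector [w] that is a polynomial in [T], the element [S = star w * w] is an
    eigenvector too, and both factors act on it by scalars, so S^2 is a multiple of S and rescaling
    gives a projection. The factorizations through [T] transfer to [p] whatever annihilates [T]. *)
Lemma eigenprojection : T != 0 -> exists p S (r : R),
  [/\ proj p, p != 0, T * p = rc r *: p, p = T * S & p = S * T].
Proof.
move=> T0; have [rs hrs] := powers_annihilated.
have [w [r [pw w0 Tw]]] := powers_descend powers_base T0 hrs.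
have [Bw wT [u [wu uT]]] := powers_prop pw.
pose S := star w * w.
have S0 : S != 0 by apply/eqP => /(star_proper Hs) h; rewrite h eqxx in w0.
have sS : star S = S by rewrite /S sM sK.
have swT : star w * T = T * star w by rewrite -{1}sT -sM -wT sM sT.
have TS : T * S = r *: S by rewrite /S mulrA -swT -mulrA Tw -scalerAr.
have ST : S * T = T * S by rewrite /S -mulrA wT mulrA swT mulrA.
have [[k1 h1] [k2 h2]] := powers_eigen pw TS.
have SS : S * S = (k1 * k2) *: S by rewrite {1}/S -mulrA h1 -scalerAr h2 scalerA.
set k := k1 * k2 in SS.
have k0 : k != 0.
  apply/eqP => k0; move: SS; rewrite k0 scale0r -{1}sS => /(star_proper Hs) h.
  by rewrite h eqxx in S0.
have kr : Num.conj k = k.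
  have := congr1 star SS; rewrite sM sZ sS SS => /eqP.
  rewrite -subr_eq0 -scalerBl scaler_eq0 (negbTE S0) orbF subr_eq0.
  by move/eqP.
pose p := k^-1 *: S.
have p0 : p != 0 by rewrite scaler_eq0 invr_eq0 negb_or k0.
have Tp : T * p = r *: p by rewrite /p -scalerAr TS scalerA mulrC -scalerA.
have pT : p * T = T * p by rewrite /p -scalerAl -scalerAr ST.
have sp : star p = p by rewrite /p sZ sS fmorphV /= kr.
have rr : Num.conj r = r.
  have := congr1 star Tp; rewrite (sM T p) (sZ r p) sp sT pT Tp => /eqP.
  rewrite -subr_eq0 -scalerBl scaler_eq0 (negbTE p0) orbF subr_eq0.
  by move/eqP.
have rE : r = rc (complex.Re r).
  move: rr; case: (r) => a b; rewrite -[Num.conj _]/(Complex a (- b)) => -[] hb.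
  by congr Complex; lra.
exists p, (k^-1 *: (star w * u)), (complex.Re r); split=> //.
- split=> //; first by apply: fdZ => //; apply: fdM => //; apply: fdS.
  by rewrite /p -scalerAl -scalerAr SS [k^-1 *: (k *: S)]scalerA mulVf // scale1r.
- by rewrite -rE.
- by rewrite -scalerAr mulrA -swT -mulrA -wu.
- by rewrite -scalerAl -mulrA -uT -wu.
Qed.

End Eigenprojection.

End StarAlgebra.

(** * Orthogonal families of projections and spectral decomposition *)

Section ProjectionFamilies.
Variables (R : realType) (A : algType R[i]) (star : A -> A) (B : A -> Prop).
Local Notation C := (R[i]).
Local Notation rc := (@real_complex R).
Implicit Types (a b p q e x y T S : A) (c d : C) (D : A -> Prop) (s : seq A).
Hypotheses (Hs : proper_star star) (HB : fd_star_subalg star B).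
Local Notation proj := (proj star B).

Lemma projC p q : proj p -> proj q -> p * q = 0 -> q * p = 0.
Proof.
move=> [_ _ sp] [_ _ sq] pq.
by rewrite -[q * p](starK Hs) (starM Hs) sp sq pq (star0 Hs).
Qed.

Lemma proj_addE p q : proj p -> proj q -> p * q = 0 -> proj (p + q).
Proof.
move=> hp hq pq; have qp := projC hp hq pq; have [Bp pp sp] := hp; have [Bq qq sq] := hq.
split; [exact: (fdD HB) | | by rewrite (starD Hs) sp sq].
by rewrite mulrDl !mulrDr pp qq pq qp addr0 add0r.
Qed.

Lemma proj_sub p q : proj p -> proj q -> q * p = q -> proj (p - q).
Proof.
move=> [Bp pp sp] [Bq qq sq] qp.
have pq : p * q = q by rewrite -{1}sq -sp -(starM Hs) qp sq.
split; [exact: (fdB HB) | | by rewrite (starB Hs) sp sq].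
by rewrite mulrBl !mulrBr pp qq pq qp subrr subr0.
Qed.

Definition orth_family D s :=
  [/\ uniq s, (forall p, p \in s -> [/\ proj p, p != 0 & D p])
    & (forall p q, p \in s -> q \in s -> p != q -> p * q = 0)].

Lemma orth_family_nil D : orth_family D [::].
Proof. by split=> // [p|p q]; rewrite in_nil. Qed.

Lemma orth_family_cons D s p : orth_family D s -> proj p -> p != 0 -> D p ->
  (forall q, q \in s -> p * q = 0) -> orth_family D (p :: s).
Proof.
move=> [us ps os] hp p0 Dp pq; have [Bp pp _] := hp.
have pns : p \notin s by apply/negP => /pq; rewrite pp => /eqP; rewrite (negbTE p0).
split; first by rewrite /= pns.
  by move=> q; rewrite inE => /orP[/eqP ->|/ps].
move=> a b; rewrite !inE => /orP[/eqP ->|ha] /orP[/eqP ->|hb]; first by rewrite eqxx.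
- by move=> _; apply: pq.
- by move=> _; apply: projC => //; [case: (ps a ha) | apply: pq].
- exact: os.
Qed.

Lemma orth_family_size : exists n, forall D s, orth_family D s -> (size s <= n)%N.
Proof.
have [n dep] := fd_dependent HB; exists n => D s [us ps os]; rewrite leqNgt; apply/negP => hn.
have hB (i : 'I_(size s)) : B (tnth (in_tuple s) i).
  by have [[]] := ps _ (mem_tnth i (in_tuple s)).
have [c [[i ci] hc]] := dep _ _ hB hn.
have := congr1 (fun z => tnth (in_tuple s) i * z) hc; rewrite mulr0 mulr_sumr (bigD1 i) //=.
have [[_ pp _] p0 _] := ps _ (mem_tnth i (in_tuple s)).
rewrite big1 => [|j ji].
  by rewrite addr0 -scalerAr pp => /eqP; rewrite scaler_eq0 (negbTE ci) (negbTE p0).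
rewrite -scalerAr os ?mem_tnth ?scaler0 //.
apply: contraNneq ji => /eqP; rewrite !(tnth_nth 0) /= nth_uniq // => /eqP h.
by apply/eqP/val_inj.
Qed.

Lemma orth_family_max D : exists s, orth_family D s /\
  forall t, orth_family D t -> (size t <= size s)%N.
Proof.
have [n hn] := orth_family_size.
pose P k := `[< exists s, orth_family D s /\ size s = k >].
have ex : exists k, P k by exists 0%N; apply/asboolP; exists [::]; split=> //; apply: orth_family_nil.
have ub k : P k -> (k <= n)%N by move/asboolP => [s [hs <-]]; apply: hn hs.
case: (ex_maxnP ex ub) => k /asboolP[s [hs sk]] hmax.
by exists s; split=> // t ht; rewrite sk; apply: hmax; apply/asboolP; exists t.
Qed.

Definition minimal e := [/\ proj e, e != 0 & forall q, proj q -> q != 0 -> q * e = q -> q = e].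

(** Maximal cardinality serves twice: a member [e] with a proper nonzero subprojection [q] could be
    replaced by [q] and [e - q], and a projection orthogonal to the whole family could be added. *)
Lemma max_family D : (forall e q, D e -> proj q -> q * e = q -> D q) ->
  exists s, [/\ orth_family D s, (forall e, e \in s -> minimal e) &
    forall p, proj p -> D p -> (forall q, q \in s -> p * q = 0) -> p = 0].
Proof.
move=> Dher; have [s [hs smax]] := orth_family_max D.
exists s; split => //.
  have [us ps os] := hs; move=> e es; have [he e0 De] := ps _ es.
  split=> // q hq q0 qe; apply/eqP; rewrite eq_sym -subr_eq0; apply/negPn/negP => ne.
  have heq := proj_sub he hq qe.
  have hr : orth_family D (rem e s).
    split; first exact: rem_uniq.
      by move=> p /mem_rem /ps.
    by move=> a b /mem_rem ha /mem_rem hb; apply: os.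
  have ex x : x \in rem e s -> e * x = 0.
    by rewrite mem_rem_uniq // inE => /andP[xe xs]; apply: os; rewrite // eq_sym.
  have qx x : x \in rem e s -> q * x = 0 by move=> hx; rewrite -qe -mulrA ex // mulr0.
  have [_ qq sq] := hq; have [_ ee _] := he.
  have h1 : orth_family D (q :: rem e s) by apply: orth_family_cons => //; apply: Dher De _ qe.
  have eqe : (e - q) * e = e - q by rewrite mulrBl ee qe.
  have h2 : orth_family D (e - q :: q :: rem e s).
    apply: orth_family_cons => //; first exact: Dher De _ eqe.
    have eq_ : e * q = q by have [_ _ se] := he; rewrite -{1}sq -se -(starM Hs) qe.
    move=> x; rewrite inE => /orP[/eqP ->|hx]; first by rewrite mulrBl qq eq_ subrr.
    by rewrite mulrBl ex // qx // subrr.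
  have := smax _ h2; rewrite /= size_rem //; case: (s) es => //= y t _.
  by rewrite ltnn.
move=> p hp Dp ps; apply/eqP/negPn/negP => p0.
by have := smax _ (orth_family_cons hs hp p0 Dp ps); rewrite /= ltnn.
Qed.

Lemma family_proj D s : orth_family D s -> proj (\sum_(p <- s) p) /\
  forall q, q \in s -> (\sum_(p <- s) p) * q = q /\ q * (\sum_(p <- s) p) = q.
Proof.
move=> [us ps os].
have h q : q \in s -> q * (\sum_(p <- s) p) = q.
  move=> qs; rewrite mulr_sumr (bigD1_seq q) //= big_seq_cond big1 ?addr0.
    by have [[_ ->]] := ps _ qs.
  by move=> p /andP[hp pq]; apply: os => //; rewrite eq_sym.
have BE : B (\sum_(p <- s) p) by apply: (fd_sum_seq HB) => p /ps[[]].
have sE : star (\sum_(p <- s) p) = \sum_(p <- s) p.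
  by rewrite (star_sum Hs) big_seq [RHS]big_seq; apply: eq_bigr => p /ps[[]].
have EE : (\sum_(p <- s) p) * (\sum_(p <- s) p) = \sum_(p <- s) p.
  by rewrite {1}big_seq mulr_suml [RHS]big_seq; apply: eq_bigr => p; apply: h.
split => // q qs; split; last exact: h.
by have [[_ _ sq] _ _] := ps _ qs; rewrite -{1}sq -sE -(starM Hs) h.
Qed.

Lemma proj_decomposition p : proj p ->
  exists s, [/\ orth_family (fun q => q * p = q) s, (forall e, e \in s -> minimal e)
    & p = \sum_(q <- s) q].
Proof.
move=> hp; have Dher e q : e * p = e -> proj q -> q * e = q -> q * p = q.
  by move=> ep _ <-; rewrite -mulrA ep.
have [s [hs mins smax]] := max_family Dher; exists s; split => //.
have [hE sE] := family_proj hs; set E := \sum_(q <- s) q in hE sE *.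
have [_ ps _] := hs; have Ep : E * p = E.
  by rewrite /E mulr_suml big_seq [RHS]big_seq; apply: eq_bigr => q /ps[].
apply/eqP; rewrite -subr_eq0; apply/eqP; apply: smax.
- exact: proj_sub.
- by have [_ pp _] := hp; rewrite mulrBl pp Ep.
move=> q qs; have [Eq _] := sE _ qs; rewrite mulrBl Eq.
have [[_ _ sq] _ qp] := ps _ qs; have [_ _ sp] := hp.
by rewrite -{1}sq -sp -(starM Hs) qp sq subrr.
Qed.

(** If [X = T - E * T] were nonzero, an eigenprojection of [X * star X] would be a multiple of it,
    hence orthogonal to the whole family, against maximality. *)
Lemma unit_decomposition :
  exists s, [/\ orth_family (fun=> True) s, (forall e, e \in s -> minimal e)
    & forall T, B T -> (\sum_(q <- s) q) * T = T].
Proof.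
have [s [hs mins smax]] := max_family (D := fun=> True) (fun _ _ _ _ _ => I).
exists s; split=> // T BT; have [hE sE] := family_proj hs.
set E := \sum_(q <- s) q in hE sE *; have [BE EE sEE] := hE.
apply/eqP; rewrite eq_sym -subr_eq0; apply/negPn/negP => X0.
pose X := T - E * T; have BX : B X by apply: (fdB HB) => //; apply: (fdM HB).
have EX : E * X = 0 by rewrite mulrBr mulrA EE subrr.
have BXX : B (X * star X) by apply: (fdM HB) => //; apply: (fdS HB).
have sXX : star (X * star X) = X * star X by rewrite (starM Hs) (starK Hs).
have XX0 : X * star X != 0.
  apply/eqP; rewrite -{1}[X](starK Hs) => /(star_proper Hs) h.
  by move: X0; rewrite -/X -[X](starK Hs) h (star0 Hs) ?eqxx.
have [p [S [r [hp p0 _ pS _]]]] := eigenprojection Hs HB BXX sXX XX0.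
have Ep : E * p = 0 by rewrite pS !mulrA EX !mul0r.
have := smax p hp Logic.I; move=> H; move/eqP: p0; apply; apply: H => q qs.
have [_ qE] := sE _ qs; have [_ ps _] := hs; have [hq _ _] := ps _ qs.
by apply: (projC hq hp); rewrite -qE -mulrA Ep mulr0.
Qed.

(** A maximal family of eigenprojections of [T] exhausts it: an eigenprojection of the remainder
    would be orthogonal to the family and again one for [T]. Eigenvalues may repeat. *)
Lemma spectral_decomposition T : B T -> star T = T ->
  exists s (l : A -> R), [/\ orth_family (fun=> True) s,
     (forall p, p \in s -> T * p = rc (l p) *: p)
    & T = \sum_(p <- s) rc (l p) *: p].
Proof.
move=> BT sT; pose D q := exists r : R, T * q = rc r *: q.
have [s [hs smax]] := orth_family_max D; have [us ps os] := hs.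
have /boolp.choice[l hl] : forall q, exists r : R, q \in s -> T * q = rc r *: q.
  move=> q; have [qs|qs] := boolP (q \in s); last by exists 0.
  by have [_ _ [r hr]] := ps _ qs; exists r.
exists s, l; split=> //.
  by split=> // p /ps[].
set X := \sum_(p <- s) _; apply/eqP; rewrite -subr_eq0; apply/negPn/negP => TX0.
have BX : B X.
  by rewrite /X big_seq; apply: (fd_sum HB) => p /ps[[Bp _ _] _ _]; apply: (fdZ HB).
have sX : star X = X.
  rewrite /X (star_sum Hs) big_seq [RHS]big_seq; apply: eq_bigr => p /ps[[_ _ sp] _ _].
  by rewrite (starZ Hs) sp conj_rc.
have TXq q : q \in s -> (T - X) * q = 0.
  move=> qs; rewrite mulrBl hl // /X mulr_suml (bigD1_seq q) //= big_seq_cond big1 ?addr0.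
    by have [[_ qq _] _ _] := ps _ qs; rewrite -scalerAl qq subrr.
  by move=> p /andP[hp pq]; rewrite -scalerAl os ?scaler0.
have BTX : B (T - X) by apply: (fdB HB).
have sTX : star (T - X) = T - X by rewrite (starB Hs) sT sX.
have [p [S [r [hp p0 Tp _ pS]]]] := eigenprojection Hs HB BTX sTX TX0.
have pq q : q \in s -> p * q = 0 by move=> qs; rewrite pS -mulrA TXq // mulr0.
have Dp : D p.
  exists r; rewrite -Tp mulrBl (_ : X * p = 0) ?subr0 // /X mulr_suml big_seq big1 // => q qs.
  have [hq _ _] := ps _ qs.
  by rewrite -scalerAl (projC hp hq) ?pq // scaler0.
by have := smax _ (orth_family_cons hs hp p0 Dp pq); rewrite /= ltnn.
Qed.

Lemma real_imag T : exists T1 T2, [/\ T = T1 + Complex 0 1 *: T2, star T1 = T1, star T2 = T2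
  & B T -> B T1 /\ B T2].
Proof.
have two : (2 : C) != 0 by rewrite pnatr_eq0.
have i2 : Complex 0 1 * Complex 0 1 = -1 :> C.
  by apply/eqP; rewrite eq_complex /=; apply/andP; split; apply/eqP; ring.
have ci : Num.conj (Complex 0 1) = - Complex 0 1 :> C.
  by rewrite -[LHS]/(Complex 0 (- 1)); apply/eqP; rewrite eq_complex /= oppr0 !eqxx.
have ch : Num.conj (2^-1) = 2^-1 :> C by rewrite fmorphV rmorph_nat.
exists (2^-1 *: (T + star T)), (- Complex 0 1 * 2^-1 *: (T - star T)); split.
- rewrite scalerA mulrA mulrN i2 opprK mul1r -scalerDr addrACA subrr addr0.
  by rewrite -[T + T]mulr2n -[T *+ 2]scaler_nat scalerA mulVf // scale1r.
- by rewrite (starZ Hs) (starD Hs) (starK Hs) ch addrC.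
- rewrite (starZ Hs) (starB Hs) (starK Hs) rmorphM rmorphN /= ci ch opprK.
  by rewrite -[T - star T]opprB scalerN mulNr scaleNr opprK.
move=> BT; split; apply: (fdZ HB); first by apply: (fdD HB) => //; apply: (fdS HB).
by apply: (fdB HB) => //; apply: (fdS HB).
Qed.

(** An eigenprojection of a nonzero self-adjoint [e * T * e] lies under [e], so it equals [e] by
    minimality, and the corner is a multiple of [e]. *)
Lemma minimal_corner e T : minimal e -> B T -> exists c, e * T * e = c *: e.
Proof.
move=> [he e0 emin] BT; have [Be ee se] := he.
have sa U : B U -> star U = U -> exists c, e * U * e = c *: e.
  move=> BU sU; have [->|X0] := eqVneq (e * U * e) 0; first by exists 0; rewrite scale0r.
  have BX : B (e * U * e) by do 2 ?apply: (fdM HB).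
  have sX : star (e * U * e) = e * U * e by rewrite !(starM Hs) se sU mulrA.
  have [p [S [r [hp p0 Xp _ pS]]]] := eigenprojection Hs HB BX sX X0.
  have pe : p = e by apply: emin => //; rewrite {1}pS [RHS]pS -!mulrA ee.
  by exists (rc r); rewrite pe in Xp; rewrite -Xp -!mulrA ee.
have [T1 [T2 [TE s1 s2 hB]]] := real_imag T; have [B1 B2] := hB BT; rewrite TE.
have [c1 h1] := sa _ B1 s1; have [c2 h2] := sa _ B2 s2.
exists (c1 + Complex 0 1 * c2).
by rewrite mulrDr mulrDl h1 -scalerAr -scalerAl h2 scalerA -scalerDl.
Qed.

End ProjectionFamilies.

(** * Matrix blocks and the extension on a finite-dimensional algebra *)

Section LocalGleason.
Variables (R : realType) (A : algType R[i]) (star : A -> A) (B : A -> Prop).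
Local Notation C := (R[i]).
Local Notation rc := (@real_complex R).
Implicit Types (a b p q e T S : A) (c d : C) (s : seq A).
Hypotheses (Hs : proper_star star) (HB : fd_star_subalg star B).
Local Notation proj := (proj star B).
Local Notation minimal := (minimal star B).

Lemma ge0_rc c : 0 <= c -> exists2 r : R, 0 <= r & c = rc r.
Proof.
case: c => a b; rewrite lecE /= => /andP[/eqP -> a0]; exists a => //.
Qed.

(** By [minimal_corner], [x = e * T * e'] satisfies [star x * x = c *: e'] and
    [x * star x = c' *: e]. Associativity of [x * star x * x] gives c' = c, positivity gives c > 0,
    and dividing by its square root normalizes [x]. *)
Lemma partial_isometry e e' T : minimal e -> minimal e' -> B T -> e * T * e' != 0 ->
  exists v, [/\ B v, v * star v = e, star v * v = e', e * v = v & v * e' = v].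
Proof.
move=> me me' BT; have [[Be ee se] e0 _] := me; have [[Be' ee' se'] e0' _] := me'.
set x := e * T * e' => x0.
have Bx : B x by do 2 ?apply: (fdM HB).
have ex : e * x = x by rewrite /x !mulrA ee.
have xe' : x * e' = x by rewrite /x -mulrA ee'.
have sx : star x = e' * star T * e by rewrite /x !(starM Hs) se se' mulrA.
have [c hc] : exists c, star x * x = c *: e'.
  have [c hc] := minimal_corner Hs HB me' (fdM HB (fdM HB (fdS HB BT) Be) BT).
  exists c; rewrite -hc sx /x; rewrite !mulrA; congr (_ * _ * _).
  by rewrite -[_ * e * e]mulrA ee.
have [c' hc'] : exists c, x * star x = c *: e.
  have [d hd] := minimal_corner Hs HB me (fdM HB (fdM HB BT Be') (fdS HB BT)).
  exists d; rewrite -hd sx /x; rewrite !mulrA; congr (_ * _ * _).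
  by rewrite -[_ * e' * e']mulrA ee'.
have cc : c' = c.
  apply/eqP; rewrite -subr_eq0; have := mulrA x (star x) x.
  rewrite hc hc' -scalerAr -scalerAl xe' ex => /esym/eqP.
  by rewrite -subr_eq0 -scalerBl scaler_eq0 (negbTE x0) orbF.
have c0 : c != 0.
  by apply/eqP => c0; move: hc; rewrite c0 scale0r => /(star_proper Hs) h; rewrite h eqxx in x0.
have [r r0 cr] := ge0_rc (star_pos Hs hc e0' ee' se').
have rpos : 0 < r by rewrite lt_def r0 andbT; apply/eqP => h; rewrite cr h eqxx in c0.
pose k := rc (Num.sqrt r)^-1.
have ck : Num.conj k = k by apply: conj_rc.
have kk : k * k * c = 1.
  by rewrite cr -!rmorphM /= -expr2 exprVn sqr_sqrtr // mulVf ?gt_eqF.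
exists (k *: x); split.
- exact: (fdZ HB).
- by rewrite (starZ Hs) ck -scalerAl -scalerAr hc' cc !scalerA kk scale1r.
- by rewrite (starZ Hs) ck -scalerAl -scalerAr hc !scalerA kk scale1r.
- by rewrite -scalerAr ex.
- by rewrite -scalerAl xe'.
Qed.

(** On minimal projections this is Murray-von Neumann equivalence; its classes are the matrix
    blocks. *)
Definition linked e e' := exists T, B T /\ e * T * e' != 0.

Lemma linked_sym e e' : proj e -> proj e' -> linked e e' -> linked e' e.
Proof.
move=> [_ _ se] [_ _ se'] [T [BT h]]; exists (star T); split; first exact: (fdS HB).
apply: contra h => /eqP h; apply/eqP.
by have := congr1 star h; rewrite !(starM Hs) (starK Hs) se se' (star0 Hs) mulrA.
Qed.

Lemma linked_trans e f g : minimal e -> minimal f -> minimal g ->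
  linked e f -> linked f g -> linked e g.
Proof.
move=> me mf mg [T [BT hT]] [S [BS hS]].
have [v [Bv vv _ ev vf]] := partial_isometry me mf BT hT.
have [w [Bw ww _ fw wg]] := partial_isometry mf mg BS hS.
exists (v * w); split; first exact: (fdM HB).
rewrite mulrA ev -mulrA wg; apply/eqP => h; have [_ e0 _] := me.
have : v * w * star (v * w) = e by rewrite (starM Hs) mulrA -(mulrA v) ww vf vv.
by rewrite h mul0r => e00; rewrite -e00 eqxx in e0.
Qed.

(** [v] is one column of a system of matrix units, the full system being [v i * star (v j)]. The
    last clause says that left multiplication by [B] maps the column into its own span. *)
Definition matrix_block (I : finType) (v : I -> A) e :=
  [/\ e != 0, forall i, B (v i) /\ v i * e = v i,
      forall i j, star (v i) * v j = (i == j)%:R *: e,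
      forall T i j, B T -> exists c, star (v i) * T * v j = c *: e &
      forall T j, B T -> T * v j = \sum_k v k * star (v k) * T * v j].

Variables (mu : A -> R) (M : R).
Hypothesis mu_add : forall p q, proj p -> proj q -> p * q = 0 -> mu (p + q) = mu p + mu q.
Hypothesis mu_bound : forall p, proj p -> `|mu p| <= M.

Section Block.
Variables (I : finType) (v : I -> A) (e : A).
Hypothesis Hb : matrix_block v e.
Hypothesis He : proj e.
Implicit Types (x y : {ffun I -> C}).

Definition vect x : A := \sum_i x i *: v i.

Lemma star_vect_mul x y : star (vect x) * vect y = hdot y x *: e.
Proof.
have [_ _ vv _ _] := Hb.
rewrite /vect (star_sum Hs) mulr_suml scaler_suml; apply: eq_bigr => i _.
rewrite (starZ Hs) -scalerAl mulr_sumr (bigD1 i) //= big1 => [|j ji].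
  by rewrite -scalerAr vv eqxx scale1r addr0 scalerA mulrC.
by rewrite -scalerAr vv eq_sym (negbTE ji) scale0r scaler0.
Qed.

Lemma vect_e x : vect x * e = vect x.
Proof.
have [_ hv _ _ _] := Hb; rewrite /vect mulr_suml; apply: eq_bigr => i _.
by rewrite -scalerAl; have [_ ->] := hv i.
Qed.

Definition ray x : A := vect x * star (vect x).

Lemma rayE x : ray x = \sum_i \sum_j (x i * Num.conj (x j)) *: (v i * star (v j)).
Proof.
rewrite /ray /vect (star_sum Hs) mulr_suml; apply: eq_bigr => i _.
rewrite mulr_sumr; apply: eq_bigr => j _.
by rewrite (starZ Hs) -scalerAl -scalerAr scalerA.
Qed.

Lemma ray_proj x : hdot x x = 1 -> proj (ray x).
Proof.
move=> hx; have [_ hv _ _ _] := Hb.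
have Bv : B (vect x) by apply: (fd_sum HB) => i _; apply: (fdZ HB); have [] := hv i.
split; first by apply: (fdM HB) => //; apply: (fdS HB).
  by rewrite /ray mulrA -(mulrA (vect x)) star_vect_mul hx scale1r vect_e.
by rewrite /ray (starM Hs) (starK Hs).
Qed.

Lemma ray_orth x y : hdot x y = 0 -> ray x * ray y = 0.
Proof.
move=> xy; have yx : hdot y x = 0 by apply: hdot_sym0.
by rewrite /ray mulrA -(mulrA (vect x)) star_vect_mul yx scale0r mulr0 mul0r.
Qed.

Lemma block_frame : #|I| != 2 -> exists t : I -> I -> C, forall x, hdot x x = 1 ->
  rc (mu (ray x)) = \sum_i \sum_j x i * Num.conj (x j) * t i j.
Proof.
move=> I2; apply: (complex_gleason (P := fun x => mu (ray x)) (M := M)) => //.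
- by move=> x hx; apply/mu_bound/ray_proj.
- move=> x y _ _ h; congr mu; rewrite !rayE; apply: eq_bigr => i _; apply: eq_bigr => j _.
  by rewrite h.
have sum3 x y z : hunit3 x y z -> mu (ray x) + mu (ray y) + mu (ray z)
    = mu (ray x + ray y + ray z).
  move=> [[xx yy zz] [xy xz yz]].
  have [px py pz] : [/\ proj (ray x), proj (ray y) & proj (ray z)] by split; apply: ray_proj.
  have xyo := ray_orth xy.
  rewrite mu_add //; first by rewrite mu_add.
    exact: (proj_addE Hs HB).
  by rewrite mulrDl !ray_orth // addr0.
move=> x y z x' y' z' h h' hE; rewrite !sum3 //; congr mu.
rewrite !rayE -!big_split /=; apply: eq_bigr => i _; rewrite -!big_split /=.
by apply: eq_bigr => j _; rewrite -!scalerDl hE.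
Qed.

Lemma block_functional : #|I| != 2 -> exists psi : A -> C,
  [/\ forall c S T, B S -> B T -> psi (c *: S + T) = c * psi S + psi T,
      forall u, B u -> u * e = u -> star u * u = e ->
        (\sum_i v i * star (v i)) * u = u -> psi (u * star u) = rc (mu (u * star u)) &
      forall T, B T -> (forall j, T * v j = 0) -> psi T = 0].
Proof.
move=> I2; have [t ht] := block_frame I2; have [e0 hv vv cor _] := Hb.
have [_ ee se] := He.
(* [cf] reads off the matrix entries of an element of [B] in the block; it is unspecified outside
   [B]. *)
have /boolp.choice[cf hcf] : forall z : A * (I * I), exists c,
    B z.1 -> star (v z.2.1) * z.1 * v z.2.2 = c *: e.
  move=> [T [i j]] /=; have [BT|nBT] := boolp.pselect (B T); last by exists 0.
  by have [c hc] := cor T i j BT; exists c.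
have cfE T i j c : B T -> star (v i) * T * v j = c *: e -> cf (T, (i, j)) = c.
  move=> BT h; have := hcf (T, (i, j)) BT; rewrite /= h => /esym/eqP.
  by rewrite -subr_eq0 -scalerBl scaler_eq0 (negbTE e0) orbF subr_eq0 => /eqP.
exists (fun T => \sum_i \sum_j cf (T, (i, j)) * t i j); split.
- move=> c S T BS BT; rewrite mulr_sumr -big_split /=; apply: eq_bigr => i _.
  rewrite mulr_sumr -big_split /=; apply: eq_bigr => j _.
  have -> : cf (c *: S + T, (i, j)) = c * cf (S, (i, j)) + cf (T, (i, j)).
    apply: cfE; first by apply: (fdD HB) => //; apply: (fdZ HB).
    rewrite mulrDr mulrDl -scalerAr -scalerAl (hcf (S, (i, j)) BS) (hcf (T, (i, j)) BT) /=.
    by rewrite scalerA -scalerDl.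
  by rewrite mulrDl mulrA.
- move=> u Bu ue uu Eu.
  have Bsv i : B (star (v i)) by apply: (fdS HB); have [] := hv i.
  have sv i : e * star (v i) = star (v i).
    by have [_ h] := hv i; rewrite -{1}se -(starM Hs) h.
  have /boolp.choice[xf hxf] : forall i, exists c, star (v i) * u = c *: e.
    move=> i; have Buv : B (u * star (v i)) by apply: (fdM HB).
    have [c hc] := cor _ i i Buv; exists c; rewrite -hc.
    by rewrite !mulrA -(mulrA _ (star (v i)) (v i)) vv eqxx scale1r -mulrA ue.
  (* The coordinates of [u] in the column [v]; they form a unit vector whose ray is [u * star u]. *)
  pose x : {ffun I -> C} := [ffun i => xf i].
  have uE : u = vect x.
    rewrite -[LHS]Eu mulr_suml; apply: eq_bigr => i _.
    by rewrite -mulrA hxf -scalerAr ffunE; have [_ ->] := hv i.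
  have xx : hdot x x = 1.
    have := star_vect_mul x x; rewrite -uE uu => /eqP.
    rewrite -{1}[e]scale1r -subr_eq0 -scalerBl scaler_eq0 (negbTE e0) orbF subr_eq0.
    by move=> /eqP.
  have -> : u * star u = ray x by rewrite uE.
  rewrite ht //; apply: eq_bigr => i _; apply: eq_bigr => j _; congr (_ * _).
  apply: cfE; first by have [] := ray_proj xx.
  rewrite /ray -uE !mulrA hxf -mulrA.
  have -> : star u * v j = Num.conj (xf j) *: e.
    by rewrite -[star u * v j](starK Hs) (starM Hs) (starK Hs) hxf (starZ Hs) se.
  by rewrite -scalerAl -scalerAr ee scalerA !ffunE.
move=> T BT hT; rewrite big1 // => i _; rewrite big1 // => j _.
by rewrite (cfE _ _ _ 0) ?mul0r // -mulrA hT mulr0 scale0r.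
Qed.

End Block.

Lemma mu0 : mu 0 = 0.
Proof.
have p0 : proj 0 by split; [apply: (fd0 HB) | rewrite mulr0 | apply: (star0 Hs)].
by have := mu_add p0 p0 (mulr0 _); rewrite addr0; lra.
Qed.

Lemma mu_family D s : orth_family star B D s -> mu (\sum_(p <- s) p) = \sum_(p <- s) mu p.
Proof.
elim: s => [|a s IH]; first by rewrite !big_nil mu0.
move=> [/= /andP[as_ us] ps os].
have hs : orth_family star B D s.
  split=> // [p hp|p q hp hq]; first by apply: ps; rewrite inE hp orbT.
  by apply: os; rewrite inE ?hp ?hq orbT.
rewrite !big_cons mu_add ?IH //.
- by have [] := ps a (mem_head _ _).
- by have [] := family_proj Hs HB hs.
rewrite mulr_sumr big_seq big1 // => q hq; apply: os; rewrite ?mem_head ?inE ?hq ?orbT //.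
by apply: contraNneq as_ => ->.
Qed.

Lemma functional_family (phi : A -> C) s :
  (forall c S T, B S -> B T -> phi (c *: S + T) = c * phi S + phi T) ->
  (forall p, p \in s -> B p) -> phi (\sum_(p <- s) p) = \sum_(p <- s) phi p.
Proof.
move=> lin; have phi0 : phi 0 = 0.
  have := lin 1 0 0 (fd0 HB) (fd0 HB); rewrite scaler0 addr0 mul1r => /eqP.
  by rewrite -subr_eq0 opprD addrA subrr sub0r oppr_eq0 => /eqP.
elim: s => [|a s IH] hs; first by rewrite !big_nil.
have hs' p : p \in s -> B p by move=> h; apply: hs; rewrite inE h orbT.
rewrite !big_cons -{1}[a]scale1r lin ?mul1r ?IH //; first by apply: hs; rewrite mem_head.
exact: (fd_sum_seq HB).
Qed.

Lemma orth_family_filter D s (P : pred A) :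
  orth_family star B D s -> orth_family star B D (filter P s).
Proof.
move=> [us ps os]; split; first exact: filter_uniq.
  by move=> p; rewrite mem_filter => /andP[_ /ps].
by move=> p q; rewrite !mem_filter => /andP[_ hp] /andP[_ hq]; apply: os.
Qed.

(** The members with nonnegative measure add up to a projection, and so do those with negative
    measure; each contributes at most [M]. *)
Lemma family_variation D s : orth_family star B D s -> \sum_(p <- s) `|mu p| <= 2 * M.
Proof.
move=> hs; pose P p := 0 <= mu p.
have h Q : `|\sum_(p <- s | Q p) mu p| <= M.
  have hQ := orth_family_filter Q hs.
  by rewrite -big_filter -(mu_family hQ) mu_bound //; have [] := family_proj Hs HB hQ.
rewrite (bigID P) /=.
have -> : \sum_(p <- s | P p) `|mu p| = \sum_(p <- s | P p) mu p.
  by apply: eq_bigr => p; apply: ger0_norm.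
have -> : \sum_(p <- s | ~~ P p) `|mu p| = - (\sum_(p <- s | ~~ P p) mu p).
  by rewrite -sumrN; apply: eq_bigr => p; rewrite -ltNge; apply: ltr0_norm.
have := h P; have := h (fun p => ~~ P p); rewrite !ler_norml => /andP[a1 a2] /andP[b1 b2].
by lra.
Qed.

Lemma functional_combination (phi : A -> C) s (l : A -> C) :
  (forall c S T, B S -> B T -> phi (c *: S + T) = c * phi S + phi T) ->
  (forall p, p \in s -> B p) ->
  phi (\sum_(p <- s) l p *: p) = \sum_(p <- s) l p * phi p.
Proof.
move=> lin; have phi0 := functional_family lin (s := [::]) (fun _ => ltac:(by [])).
elim: s => [|a s IH] hs; first by move: phi0; rewrite !big_nil.
have hs' p : p \in s -> B p by move=> h; apply: hs; rewrite inE h orbT.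
rewrite !big_cons lin ?IH //; first by apply: hs; rewrite mem_head.
by rewrite big_seq; apply: (fd_sum HB) => p hp; apply: (fdZ HB); apply: hs'.
Qed.

Lemma functional_unique (phi psi : A -> C) :
  (forall c S T, B S -> B T -> phi (c *: S + T) = c * phi S + phi T) ->
  (forall c S T, B S -> B T -> psi (c *: S + T) = c * psi S + psi T) ->
  (forall p, proj p -> phi p = psi p) -> forall T, B T -> phi T = psi T.
Proof.
move=> l1 l2 hp.
have sa T : B T -> star T = T -> phi T = psi T.
  move=> BT sT; have [s [l [[us ps os] _ ->]]] := spectral_decomposition Hs HB BT sT.
  have Bs p : p \in s -> B p by move=> /ps[[]].
  rewrite !functional_combination // big_seq [RHS]big_seq; apply: eq_bigr => p /ps[h _ _].
  by rewrite hp.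
move=> T BT; have [T1 [T2 [TE s1 s2 hB]]] := real_imag Hs HB T; have [B1 B2] := hB BT.
by rewrite TE addrC l1 // l2 // !sa.
Qed.

Lemma functional_bound (phi : A -> C) T (L : R) :
  (forall c S T, B S -> B T -> phi (c *: S + T) = c * phi S + phi T) ->
  (forall p, proj p -> phi p = rc (mu p)) -> B T -> star T = T ->
  (forall p (l : R), proj p -> p != 0 -> T * p = rc l *: p -> `|l| <= L) -> 0 <= L ->
  exists2 r : R, phi T = rc r & `|r| <= 2 * M * L.
Proof.
move=> lin hphi BT sT hL L0.
have [s [l [hs Tl ->]]] := spectral_decomposition Hs HB BT sT; have [us ps os] := hs.
have Bs p : p \in s -> B p by move=> /ps[[]].
exists (\sum_(p <- s) l p * mu p).
  rewrite (functional_combination _ lin) // rmorph_sum big_seq [RHS]big_seq.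
  by apply: eq_bigr => p /ps[h _ _]; rewrite /= rmorphM /= hphi.
apply: le_trans (ler_norm_sum _ _ _) _.
apply: (@le_trans _ _ (\sum_(p <- s) `|mu p| * L)).
  rewrite big_seq [leRHS]big_seq; apply: ler_sum => p hp; have [h p0 _] := ps _ hp.
  by rewrite normrM mulrC ler_wpM2l // (hL p) // Tl.
by rewrite -mulr_suml ler_wpM2r // (family_variation hs).
Qed.

Theorem local_gleason : (forall (v : 'I_2 -> A) e, ~ matrix_block v e) ->
  exists phi : A -> C,
    (forall c S T, B S -> B T -> phi (c *: S + T) = c * phi S + phi T) /\
    (forall p, proj p -> phi p = rc (mu p)).
Proof.
move=> noM2; have [s [hs mins hE]] := unit_decomposition Hs HB.
set E := \sum_(q <- s) q in hE.
pose e (i : 'I_(size s)) := tnth (in_tuple s) i.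
have es i : e i \in s by apply: mem_tnth.
have me i : minimal (e i) by apply: mins.
have pe i : proj (e i) by have [] := me i.
have [us _ os] := hs.
have sumE T : B T -> \sum_i e i * T = T.
  by move=> BT; rewrite -[RHS](hE T BT) /E mulr_suml [RHS]big_tnth.
pose lk i r := `[< linked (e i) (e r) >].
have lkP i r T : B T -> ~~ lk i r -> e i * T * e r = 0.
  move=> BT /asboolP h; apply/eqP/negPn/negP => h0; apply: h; by exists T.
have lkrefl i : lk i i.
  apply/asboolP; have [Be ee _] := pe i; exists (e i); split=> //.
  by rewrite !ee; case: (me i).
have blk r : exists psi : A -> C,
  [/\ forall c S T, B S -> B T -> psi (c *: S + T) = c * psi S + psi T,
      forall u, B u -> u * e r = u -> star u * u = e r -> psi (u * star u) = rc (mu (u * star u)) &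
      forall T, B T -> (forall S, B S -> T * S * e r = 0) -> psi T = 0].
  (* The class of [r] indexes its block; partial isometries onto [e r] from its members form the
     column. *)
  pose K := [set i | lk i r].
  have /boolp.choice[v hv] : forall k : 'I_#|K|, exists v,
      [/\ B v, v * star v = e (enum_val k), star v * v = e r, e (enum_val k) * v = v & v * e r = v].
    move=> k; have := enum_valP k; rewrite inE => /asboolP[T [BT hT]].
    exact: (partial_isometry (me _) (me r) BT hT).
  have sumK T : B T -> (\sum_k v k * star (v k)) * (T * e r) = T * e r.
    move=> BT; have BTe : B (T * e r) by apply: (fdM HB) => //; have [] := pe r.
    rewrite -[RHS](sumE _ BTe) (bigID (fun i => i \in K)) /= [X in _ + X]big1 ?addr0.
      rewrite [RHS]big_enum_val mulr_suml; apply: eq_bigr => k _.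
      by have [_ -> _ _ _] := hv k.
    by move=> i; rewrite inE mulrA => /(lkP _ _ _ BT).
  have hb : matrix_block v (e r).
    split; first by have [] := me r.
    - by move=> k; have [? _ _ _ ?] := hv k.
    - move=> i j; have [Bi vi svi evi vie] := hv i; have [Bj vj svj evj vje] := hv j.
      have [->|ij] := eqVneq i j; first by rewrite svj scale1r.
      have [_ _ sei] := pe (enum_val i).
      have oo : e (enum_val i) * e (enum_val j) = 0.
        apply: os => //; rewrite /e !(tnth_nth 0) /= nth_uniq //.
        by apply: contra ij => /eqP h; apply/eqP/enum_val_inj/val_inj.
      by rewrite scale0r -evi -evj (starM Hs) sei mulrA -(mulrA (star (v i))) oo mulr0 mul0r.
    - move=> T i j BT; have [Bi _ _ _ vie] := hv i; have [Bj _ _ _ vje] := hv j.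
      have BX : B (star (v i) * T * v j) by do 2 ?apply: (fdM HB) => //; apply: (fdS HB).
      have [c hc] := minimal_corner Hs HB (me r) BX; exists c; rewrite -hc.
      have [_ _ ser] := pe r.
      by rewrite -{1}vie (starM Hs) ser -{1}vje !mulrA.
    move=> T j BT; have [Bj _ _ _ vje] := hv j.
    have BTv : B (T * v j) by apply: (fdM HB).
    rewrite -{1}vje mulrA -(sumK _ BTv) mulr_suml; apply: eq_bigr => k _.
    by rewrite -(mulrA T) vje !mulrA.
  have K2 : #|'I_#|K| | != 2.
    (* A class of two elements would be a block indexed by ['I_2], which the hypothesis excludes. *)
    rewrite card_ord; apply/eqP => K2; move: (v) hb; rewrite K2 => w; exact: noM2.
  have [psi [lin hpsi psi0]] := block_functional hb (pe r) K2.
  exists psi; split=> //.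
    move=> u Bu ue uu; apply: hpsi => //; rewrite -{1}ue; by rewrite sumK // ue.
  move=> T BT hT; apply: psi0 => // j; have [Bj _ _ _ <-] := hv j.
  by rewrite mulrA; apply: hT.
have {blk}/boolp.choice[psi hpsi] := blk.
(* The least index of each class, so that every block is counted once in [phi]. *)
pose canon (r : 'I_(size s)) := [forall j, lk j r ==> (r <= j)%N].
pose phi T := \sum_(r | canon r) psi r T.
have lin c S T : B S -> B T -> phi (c *: S + T) = c * phi S + phi T.
  move=> BS BT; rewrite /phi mulr_sumr -big_split /=; apply: eq_bigr => r _.
  by have [h _ _] := hpsi r; apply: h.
exists phi; split=> // p hp.
have [t [ht mint ->]] := proj_decomposition Hs HB hp.
have [ut pt _] := ht.
rewrite (mu_family ht) (functional_family lin); last by move=> q /pt[[]].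
rewrite rmorph_sum big_seq [RHS]big_seq; apply: eq_bigr => q qt /=.
have mq := mint _ qt; have [[Bq qq sq] q0 _] := mq; have pq : proj q by [].
(* The family acts as a unit, so some member meets the minimal projection [q]; the least index [r0]
   of its class names the block of [q]. *)
have [i0 hi0] : exists i, e i * q != 0.
  apply/existsP; apply: contraNT q0; rewrite negb_exists => /forallP h.
  rewrite -(sumE q Bq) big1 // => i _; apply/eqP; have := h i; by rewrite negbK.
have li0 : linked (e i0) q by exists q; split=> //; rewrite -mulrA qq.
have [r0 lr0 rmin] := @arg_minnP _ i0 (fun j => lk j i0) (fun j => val j) (lkrefl i0).
have lr0q : linked (e r0) q by apply: linked_trans li0 => //; apply/asboolP.
have cr0 : canon r0.
  apply/forallP => j; apply/implyP => /asboolP h; apply: rmin; apply/asboolP.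
  by apply: linked_trans h _ => //; apply/asboolP.
have [T [BT hT]] := linked_sym (pe r0) pq lr0q.
have [u [Bu uu suu qu ue]] := partial_isometry mq (me r0) BT hT.
rewrite /phi (bigD1 r0) //= big1 => [|r /andP[cr rr0]].
  by have [_ h _] := hpsi r0; rewrite -uu h // addr0.
(* The functional of another canonical [r] vanishes at [q]: otherwise [q] would link [r] to [r0],
   and the two least indices would coincide. *)
have [_ _ h] := hpsi r; apply: h => // S BS; apply/eqP/negPn/negP => h.
have lqr : linked q (e r) by exists S.
have lr0r : linked (e r0) (e r) by apply: linked_trans lr0q lqr.
move/forallP: cr => /(_ r0)/implyP; move/forallP: cr0 => /(_ r)/implyP.
have -> : lk r0 r by apply/asboolP.
have -> : lk r r0 by apply/asboolP; apply: linked_sym.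
move=> /(_ isT) h1 /(_ isT) h2; move/negP: rr0; apply; apply/eqP/val_inj/eqP.
by rewrite eqn_leq h1 h2.
Qed.

End LocalGleason.

(** * Operators on a Hilbert space *)

Section AdjointableOperators.
Variables (R : realType) (H : lmodType R[i]) (ip : H -> H -> R[i]).
Local Notation C := (R[i]).
Local Notation rc := (@real_complex R).
Hypothesis Hip : is_hilbert ip.
Hypothesis Hnt : exists x : H, x <> 0.
Implicit Types (x y z : H).

Lemma ip_lin (a : C) x y z : ip (a *: x + y) z = a * ip x z + ip y z.
Proof. by have [h _ _ _ _] := Hip; apply: h. Qed.

Lemma ip_conj x y : ip y x = Num.conj (ip x y).
Proof. by have [_ h _ _ _] := Hip; apply: h. Qed.

Lemma ip_ge0 x : 0 <= ip x x.
Proof. by have [_ _ h _ _] := Hip; apply: h. Qed.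

Lemma ip_def x : ip x x = 0 -> x = 0.
Proof. by have [_ _ _ h _] := Hip; apply: h. Qed.

Lemma ip0l y : ip 0 y = 0.
Proof.
have := ip_lin 1 0 0 y; rewrite scale1r addr0 mul1r => /eqP.
by rewrite -subr_eq0 opprD addrA subrr sub0r oppr_eq0 => /eqP.
Qed.

Lemma ipD x y z : ip (x + y) z = ip x z + ip y z.
Proof. by have := ip_lin 1 x y z; rewrite scale1r mul1r. Qed.

Lemma ipZ a x z : ip (a *: x) z = a * ip x z.
Proof. by have := ip_lin a x 0 z; rewrite addr0 ip0l addr0. Qed.

Lemma ipN x z : ip (- x) z = - ip x z.
Proof. by rewrite -scaleN1r ipZ mulN1r. Qed.

Lemma ipDr x y z : ip z (x + y) = ip z x + ip z y.
Proof. by rewrite ip_conj ipD rmorphD /= -!ip_conj. Qed.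

Lemma ipZr a x z : ip z (a *: x) = Num.conj a * ip z x.
Proof. by rewrite ip_conj ipZ rmorphM /= -ip_conj. Qed.

Lemma ipNr x z : ip z (- x) = - ip z x.
Proof. by rewrite -scaleN1r ipZr rmorphN rmorph1 mulN1r. Qed.

Lemma ip_inj x y : (forall z, ip x z = ip y z) -> x = y.
Proof.
move=> h; apply/eqP; rewrite -subr_eq0; apply/eqP/ip_def.
by rewrite ipD ipN h subrr.
Qed.

Lemma ip_injr x y : (forall z, ip z x = ip z y) -> x = y.
Proof. by move=> h; apply: ip_inj => z; rewrite ip_conj h -ip_conj. Qed.

(* The two proof parameters let the instances below be inferred from the type;
   the second one is there because an [algType] is nontrivial. *)
Record adjop_of (P1 : is_hilbert ip) (P2 : exists x : H, x <> 0) := Adjop {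
  afun : H -> H;
  aadj : H -> H;
  aadjP : is_adjoint ip afun aadj }.
Local Notation adjop := (adjop_of Hip Hnt).
Implicit Types (S T : adjop).

(** Definiteness of the inner product makes the adjoint unique, so the underlying function
    determines the record. *)
Lemma adjop_inj S T : afun S = afun T -> S = T.
Proof.
case: S => f f' hf; case: T => g g' hg /= e; subst g.
have e' : f' = g'.
  by apply/funext => y; apply: ip_injr => x; rewrite -hf -hg.
by subst g'; congr Adjop; apply: Prop_irrelevance.
Qed.

HB.instance Definition _ := gen_eqMixin adjop.
HB.instance Definition _ := gen_choiceMixin adjop.

(** Having an adjoint forces linearity, which is why the record does not store it. *)
Lemma afun_lin T a x y : afun T (a *: x + y) = a *: afun T x + afun T y.
Proof. by apply: ip_inj => z; rewrite aadjP !ip_lin !aadjP. Qed.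

Lemma afunD T x y : afun T (x + y) = afun T x + afun T y.
Proof. by have := afun_lin T 1 x y; rewrite !scale1r. Qed.

Lemma afunZ T a x : afun T (a *: x) = a *: afun T x.
Proof. by apply: ip_inj => z; rewrite aadjP !ipZ aadjP. Qed.

Lemma adjointC f g : is_adjoint ip f g -> is_adjoint ip g f.
Proof. by move=> h x y; rewrite ip_conj -h -ip_conj. Qed.

Definition astar T : adjop := Adjop Hip Hnt (adjointC (aadjP T)).

Lemma azeroP : is_adjoint ip (fun=> 0) (fun=> 0).
Proof. by move=> x y; rewrite ip0l ip_conj ip0l rmorph0. Qed.
Definition azero : adjop := Adjop Hip Hnt azeroP.

Lemma aoppP T : is_adjoint ip (fun x => - afun T x) (fun x => - aadj T x).
Proof. by move=> x y; rewrite ipN ipNr aadjP. Qed.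
Definition aopp T : adjop := Adjop Hip Hnt (aoppP T).

Lemma aaddP S T : is_adjoint ip (fun x => afun S x + afun T x) (fun x => aadj S x + aadj T x).
Proof. by move=> x y; rewrite ipD ipDr !aadjP. Qed.
Definition aadd S T : adjop := Adjop Hip Hnt (aaddP S T).

Lemma aoneP : is_adjoint ip id id. Proof. by []. Qed.
Definition aone : adjop := Adjop Hip Hnt aoneP.

Lemma amulP S T : is_adjoint ip (afun S \o afun T) (aadj T \o aadj S).
Proof. by move=> x y; rewrite /= !aadjP. Qed.
Definition amul S T : adjop := Adjop Hip Hnt (amulP S T).

Lemma ascaleP a T : is_adjoint ip (fun x => a *: afun T x) (fun x => Num.conj a *: aadj T x).
Proof. by move=> x y; rewrite ipZ ipZr conjCK aadjP. Qed.
Definition ascale a T : adjop := Adjop Hip Hnt (ascaleP a T).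

Ltac op_eq := move=> *; apply: adjop_inj; apply/funext => x /=.

Lemma aaddA : associative aadd. Proof. by op_eq; rewrite addrA. Qed.
Lemma aaddC : commutative aadd. Proof. by op_eq; rewrite addrC. Qed.
Lemma aadd0 : left_id azero aadd. Proof. by op_eq; rewrite add0r. Qed.
Lemma aaddN : left_inverse azero aopp aadd. Proof. by op_eq; rewrite addNr. Qed.
HB.instance Definition _ := GRing.isZmodule.Build adjop aaddA aaddC aadd0 aaddN.

Lemma amulA : associative amul. Proof. by op_eq. Qed.
Lemma amul1 : left_id aone amul. Proof. by op_eq. Qed.
Lemma amulr1 : right_id aone amul. Proof. by op_eq. Qed.
Lemma amulDl : left_distributive amul +%R. Proof. by op_eq. Qed.
Lemma amulDr : right_distributive amul +%R. Proof. by op_eq; rewrite afunD. Qed.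
Lemma aone_neq0 : aone != 0.
Proof. by apply/eqP => h; have [x] := Hnt; apply; apply: (congr1 (fun T => afun T x) h). Qed.
HB.instance Definition _ :=
  GRing.Zmodule_isNzRing.Build adjop amulA amul1 amulr1 amulDl amulDr aone_neq0.

Lemma ascaleA a b T : ascale a (ascale b T) = ascale (a * b) T.
Proof. by op_eq; rewrite scalerA. Qed.
Lemma ascale1 : left_id 1 ascale. Proof. by op_eq; rewrite scale1r. Qed.
Lemma ascaleDr : right_distributive ascale +%R. Proof. by op_eq; rewrite scalerDr. Qed.
Lemma ascaleDl T : {morph ascale^~ T : a b / a + b}. Proof. by op_eq; rewrite scalerDl. Qed.
HB.instance Definition _ :=
  GRing.Zmodule_isLmodule.Build C adjop ascaleA ascale1 ascaleDr ascaleDl.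

Lemma ascaleAl (a : C) S T : a *: (S * T) = (a *: S) * T. Proof. by op_eq. Qed.
HB.instance Definition _ := GRing.Lmodule_isLalgebra.Build C adjop ascaleAl.

Lemma ascaleAr (a : C) S T : a *: (S * T) = S * (a *: T). Proof. by op_eq; rewrite afunZ. Qed.
HB.instance Definition _ := GRing.Lalgebra_isAlgebra.Build C adjop ascaleAr.

Lemma afun_sum (n : nat) (G : 'I_n -> adjop) x : afun (\sum_i G i) x = \sum_i afun (G i) x.
Proof. by apply: (big_morph (fun T : adjop => afun T x)). Qed.

Lemma astar_proper : proper_star astar.
Proof.
split.
- by move=> S T; apply: adjop_inj.
- by move=> a T; apply: adjop_inj.
- by move=> S T; apply: adjop_inj.
- by case=> f g h; apply: adjop_inj.
- move=> T h; apply: adjop_inj; apply/funext => x.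
  have hx : aadj T (afun T x) = 0 := congr1 (fun U : adjop => afun U x) h.
  have ip0r y : ip y 0 = 0 by rewrite ip_conj ip0l rmorph0.
  by apply: ip_def; rewrite aadjP hx ip0r.
move=> T p c h p0 pp sp.
have [x hx] : exists x, afun p x <> 0.
  apply: contrapT => hn; move/eqP: p0; apply; apply: adjop_inj; apply/funext => x.
  by apply: contrapT => hx; apply: hn; exists x.
have hT : aadj T (afun T x) = c *: afun p x := congr1 (fun U : adjop => afun U x) h.
have hp : afun p (afun p x) = afun p x := congr1 (fun U : adjop => afun U x) pp.
have hs y : aadj p y = afun p y := congr1 (fun U : adjop => afun U y) sp.
(* Moving [T] across the inner product compares two squared lengths through the factor [c]; the one
   on the right is positive by the choice of [x]. *)
have e1 : ip (afun T x) (afun T x) = Num.conj c * ip (afun p x) (afun p x).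
  by rewrite aadjP hT ipZr [in RHS]aadjP hs hp.
have : 0 <= Num.conj c.
  have := ip_ge0 (afun T x); rewrite e1 pmulr_lge0 // lt_def ip_ge0 andbT.
  by apply/eqP => /ip_def.
by rewrite conjC_ge0.
Qed.

End AdjointableOperators.

(** * The Cauchy-Schwarz inequality and the operator norm *)

Section HilbertNorm.
Variables (R : realType) (H : lmodType R[i]) (ip : H -> H -> R[i]).
Local Notation C := (R[i]).
Local Notation rc := (@real_complex R).
Hypothesis Hip : is_hilbert ip.
Local Notation nrm := (hnorm ip).
Implicit Types (x y u v : H).

Lemma ip_real x : ip x x = rc (complex.Re (ip x x)) /\ 0 <= complex.Re (ip x x).
Proof. by have [r r0 ->] := ge0_rc (ip_ge0 Hip x). Qed.

Lemma hnorm_sqr x : nrm x ^+ 2 = complex.Re (ip x x).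
Proof. by rewrite sqr_sqrtr //; have [] := ip_real x. Qed.

Lemma hnorm_ge0 x : 0 <= nrm x.
Proof. exact: sqrtr_ge0. Qed.

Lemma hnorm_gt0 x : x != 0 -> 0 < nrm x.
Proof.
move=> x0; rewrite lt_def hnorm_ge0 andbT; apply/eqP => h.
have := hnorm_sqr x; rewrite h expr0n => /esym h'.
by move/eqP: x0; apply; apply: (ip_def Hip); have [-> _] := ip_real x; rewrite h'.
Qed.

Lemma hnormZ (a : C) x : nsq a = 1 -> nrm (a *: x) = nrm x.
Proof.
move=> a1; rewrite /hnorm (ipZ Hip) (ipZr Hip) mulrA -nsqE a1.
by rewrite (_ : rc 1 = 1) // mul1r.
Qed.

Lemma hnormZr (r : R) x : 0 <= r -> nrm (rc r *: x) = r * nrm x.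
Proof.
move=> r0; rewrite /hnorm (ipZ Hip) (ipZr Hip) conj_rc mulrA -rmorphM /=.
have [-> h] := ip_real x; rewrite -rmorphM /= sqrtrM ?mulr_ge0 // -expr2 sqrtr_sqr.
by rewrite ger0_norm.
Qed.

Lemma cauchy_schwarz_re u v : complex.Re (ip u v) <= nrm u * nrm v.
Proof.
have [->|v0] := eqVneq v 0.
  by rewrite (ip_conj Hip) (ip0l Hip) rmorph0 mulr_ge0 ?hnorm_ge0.
have n0 := hnorm_gt0 v0; have m0 := hnorm_ge0 u.
set a := nrm u in m0 *; set b := nrm v in n0 *; pose r := complex.Re (ip u v).
(* Nonnegativity of the squared length of b^2 u - r v, expanded. *)
have hx : 0 <= b ^+ 2 * a ^+ 2 * b ^+ 2 - r ^+ 2 * b ^+ 2.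
  have [_] := ip_real (rc (b ^+ 2) *: u + rc (- r) *: v).
  rewrite (ipD Hip) !(ipDr Hip) !(ipZ Hip) !(ipZr Hip) !conj_rc [ip v u](ip_conj Hip).
  have [-> _] := ip_real u; have [-> _] := ip_real v; rewrite -!hnorm_sqr -/a -/b.
  rewrite /r; case: (ip u v) => p q; rewrite -[Num.conj _]/(Complex p (- q)) /=.
  by apply: etrans; congr (_ <= _); ring.
rewrite -/r leNgt; apply/negP => h.
have : 0 <= a * b by rewrite mulr_ge0 // ltW.
move=> ab0; have : (a * b) ^+ 2 < r ^+ 2 by nra.
have b2 : 0 < b ^+ 2 by rewrite exprn_gt0.
rewrite -(ltr_pM2r b2); nra.
Qed.

Lemma nsqi : nsq (Complex 0 1 : C) = 1.
Proof. by rewrite /nsq /=; ring. Qed.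

(** The real and imaginary parts are what the eigenvalue estimate uses; the imaginary part is
    reduced to the real one by replacing [u] with [i u]. *)
Lemma cauchy_schwarz u v :
  `|complex.Re (ip u v)| <= nrm u * nrm v /\ `|complex.Im (ip u v)| <= nrm u * nrm v.
Proof.
have hr z w : `|complex.Re (ip z w)| <= nrm z * nrm w.
  rewrite ler_norml cauchy_schwarz_re andbT lerNl.
  have := cauchy_schwarz_re (- z) w; rewrite (ipN Hip) -[- z]scaleN1r hnormZ ?nsqN ?nsq1 //.
  by case: (ip z w).
split=> //; have := hr (Complex 0 1 *: u) v; rewrite hnormZ ?nsqi // (ipZ Hip).
by case: (ip u v) => p q /=; rewrite mul0r mul1r sub0r normrN.
Qed.

Lemma opnorm_le (T : H -> H) x : bounded_op ip T -> nrm (T x) <= opnorm ip T * nrm x.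
Proof.
move=> [lin [K hK]].
have T0 : T 0 = 0.
  have := lin 1 0 0; rewrite !scale1r addr0 => /eqP.
  by rewrite -subr_eq0 opprD addrA subrr sub0r oppr_eq0 => /eqP.
have n0 : nrm 0 = 0.
  by apply/eqP; rewrite -sqrf_eq0 hnorm_sqr (ip0l Hip).
have [->|x0] := eqVneq x 0; first by rewrite T0 n0 mulr0.
have p := hnorm_gt0 x0; rewrite -ler_pdivrMr // mulrC.
have TZ : T (rc (nrm x)^-1 *: x) = rc (nrm x)^-1 *: T x.
  by have := lin (rc (nrm x)^-1) x 0; rewrite T0 !addr0.
have i0 : 0 <= (nrm x)^-1 by rewrite invr_ge0 hnorm_ge0.
rewrite -(hnormZr _ i0) -TZ; apply: sup_upper_bound.
  split.
    by exists (nrm (T 0)); exists 0; rewrite ?n0 ?ler01 //= n0 ler01.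
  exists `|K| => _ [y /= y1 <-]; apply: le_trans (hK y) _.
  apply: (@le_trans _ _ (`|K| * nrm y)); first by rewrite ler_wpM2r ?hnorm_ge0 ?ler_norm.
  by rewrite -[leRHS]mulr1 ler_wpM2l.
by exists (rc (nrm x)^-1 *: x) => //=; rewrite hnormZr // mulVf ?gt_eqF.
Qed.

Lemma opnorm_ge0 (T : H -> H) : bounded_op ip T -> (exists x : H, x <> 0) -> 0 <= opnorm ip T.
Proof.
move=> hT [x /eqP x0]; have := opnorm_le x hT; have := hnorm_ge0 (T x).
by have := hnorm_gt0 x0 => p h1 h2; rewrite -(pmulr_lge0 _ p); apply: le_trans h2.
Qed.

End HilbertNorm.

(** * Subalgebras of operators and their 2 by 2 blocks *)

Section OperatorSubalgebra.
Variables (R : realType) (H : lmodType R[i]) (ip : H -> H -> R[i]).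
Local Notation C := (R[i]).
Local Notation rc := (@real_complex R).
Variables (Hip : is_hilbert ip) (Hnt : exists x : H, x <> 0).
Local Notation adjop := (adjop_of Hip Hnt).
Local Notation star := (@astar R H ip Hip Hnt).
Implicit Types (S T : adjop).

Definition pull (Bs : set (H -> H)) T : Prop := Bs (afun T).

Lemma adjoint_unique f g g' : is_adjoint ip f g -> is_adjoint ip f g' -> g = g'.
Proof.
by move=> h h'; apply/funext => y; apply: (ip_injr Hip) => x; rewrite -h -h'.
Qed.

Variable Bs : set (H -> H).
Hypothesis HBs : star_subalgebra ip Bs.

Lemma lift_exists f : Bs f -> exists T, afun T = f.
Proof.
by have [_ _ _ _ h] := HBs; move=> /h[g [_ hg]]; exists (Adjop Hip Hnt hg).
Qed.

Lemma pull_fd : fin_dim Bs -> fd_star_subalg star (pull Bs).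
Proof.
have [_ [B0 BD] BZ BM BA] := HBs; move=> [n [f [Bf hf]]]; split.
- exact: B0.
- by move=> S T; apply: BD.
- by move=> c T; apply: BZ.
- by move=> S T; apply: BM.
- move=> T /BA[g [Bg hg]]; rewrite /pull /=.
  by rewrite (adjoint_unique (aadjP T) hg).
have /boolp.choice[G hG] : forall i, exists T, afun T = f i by move=> i; apply/lift_exists/Bf.
exists n, G => T /hf[c hc]; exists c; apply: adjop_inj; apply/funext => x.
by rewrite hc afun_sum; apply: eq_bigr => i _ /=; rewrite hG.
Qed.

Lemma pull_projP T : proj star (pull Bs) T <-> is_projection ip Bs (afun T).
Proof.
split=> [[BT TT sT]|[BT TT sT]]; split=> //.
- exact: (congr1 (@afun _ _ _ _ _) TT).
- by have := aadjP T; rewrite -[aadj T]/(afun (star T)) sT.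
- exact: adjop_inj.
- by apply: adjop_inj; apply: adjoint_unique (aadjP T) sT.
Qed.

Section M2Summand.
Variables (v : 'I_2 -> adjop) (e : adjop).
Hypothesis Hb : matrix_block star (pull Bs) v e.
Let Hs := astar_proper Hip Hnt.

Definition mxrep (a : 'M[C]_2) : adjop := \sum_i \sum_j a i j *: (v i * star (v j)).

Lemma mxrep_lin c a b : mxrep (c *: a + b) = c *: mxrep a + mxrep b.
Proof.
rewrite scaler_sumr -big_split /=; apply: eq_bigr => i _.
rewrite scaler_sumr -big_split /=; apply: eq_bigr => j _.
by rewrite !mxE scalerDl scalerA.
Qed.

Lemma mxrep0 : mxrep 0 = 0.
Proof. by rewrite /mxrep big1 // => i _; rewrite big1 // => j _; rewrite mxE scale0r. Qed.

Lemma mxrep_v a k : mxrep a * v k = \sum_i a i k *: v i.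
Proof.
have [_ hv vv _ _] := Hb; rewrite mulr_suml; apply: eq_bigr => i _.
rewrite mulr_suml (bigD1 k) //= big1 => [|j jk]; rewrite -scalerAl -mulrA vv.
  by rewrite eqxx scale1r addr0; have [_ ->] := hv i.
by rewrite (negbTE jk) scale0r mulr0 scaler0.
Qed.

Lemma mxrep_mul a b : mxrep (a *m b) = mxrep a * mxrep b.
Proof.
rewrite [X in _ = _ * X]/mxrep mulr_sumr.
rewrite [RHS](eq_bigr (fun k => \sum_l \sum_i (a i k * b k l) *: (v i * star (v l)))); last first.
  move=> k _; rewrite mulr_sumr; apply: eq_bigr => l _.
  rewrite -scalerAr mulrA mxrep_v mulr_suml scaler_sumr; apply: eq_bigr => i _.
  by rewrite -scalerAl scalerA mulrC.
rewrite [RHS]exchange_big /= /mxrep exchange_big /=; apply: eq_bigr => l _.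
rewrite [RHS]exchange_big /=; apply: eq_bigr => i _.
by rewrite mxE scaler_suml.
Qed.

Lemma mxrep_star a : star (mxrep a) = mxrep (mx_adj a).
Proof.
rewrite /mxrep (star_sum Hs) exchange_big /=; apply: eq_bigr => i _.
rewrite (star_sum Hs) ; apply: eq_bigr => j _.
by rewrite (starZ Hs) (starM Hs) (starK Hs) !mxE.
Qed.

Lemma mxrep_inj a b : mxrep a = mxrep b -> a = b.
Proof.
move=> h; have [e0 hv vv _ _] := Hb; apply/matrixP => i j.
have hc c : star (v i) * (mxrep c * v j) = c i j *: e.
  rewrite mxrep_v mulr_sumr (bigD1 i) //= big1 => [|k ki]; rewrite -scalerAr vv.
    by rewrite eqxx scale1r addr0.
  by rewrite eq_sym (negbTE ki) scale0r scaler0.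
have := hc a; rewrite h hc => /eqP; rewrite -subr_eq0 -scalerBl scaler_eq0 (negbTE e0) orbF.
by rewrite subr_eq0 => /eqP.
Qed.

Lemma pull_mxrep a : pull Bs (mxrep a).
Proof.
have [_ hv _ _ _] := Hb; have [_ [B0 BD] BZ BM BA] := HBs.
have Bsum (n : nat) (G : 'I_n -> adjop) : (forall i, pull Bs (G i)) -> pull Bs (\sum_i G i).
  by move=> hG; apply: big_ind => // S T; apply: BD.
apply: (Bsum 2) => i; apply: (Bsum 2) => j; apply: BZ; apply: BM; first by have [] := hv i.
have [Bj _] := hv j; have [g [Bg hg]] := BA _ Bj.
by rewrite /= (adjoint_unique (aadjP (v j)) hg).
Qed.

(** The column is invariant under [T], so on the block [T] acts as the matrix of its corner
    coefficients. *)
Lemma mul_mxrep T a : pull Bs T -> exists b, T * mxrep a = mxrep b.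
Proof.
move=> BT; have [_ hv vv cor blk] := Hb.
have /boolp.choice[c hc] : forall ij : 'I_2 * 'I_2, exists c,
    star (v ij.1) * T * v ij.2 = c *: e by move=> ij; apply: cor.
pose M : 'M[C]_2 := \matrix_(i, j) c (i, j).
have TvE j : T * v j = mxrep M * v j.
  rewrite (blk T j BT) mxrep_v; apply: eq_bigr => k _; rewrite mxE.
  rewrite -!mulrA (mulrA (star (v k))) (hc (k, j)) -scalerAr.
  by have [_ ->] := hv k.
exists (M *m a); rewrite mxrep_mul [X in T * X]/mxrep [X in _ = _ * X]/mxrep !mulr_sumr.
apply: eq_bigr => i _; rewrite !mulr_sumr; apply: eq_bigr => j _.
by rewrite -!scalerAr !mulrA TvE.
Qed.

Lemma mxrep_mulr T a : pull Bs T -> exists b, mxrep a * T = mxrep b.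
Proof.
move=> BT; have [_ _ _ _ BA] := HBs; have [g [Bg hg]] := BA _ BT.
have BsT : pull Bs (star T) by rewrite /pull /= (adjoint_unique (aadjP T) hg).
have [b hb] := mul_mxrep (mx_adj a) BsT; exists (mx_adj b).
by rewrite -mxrep_star -hb -mxrep_star (starM Hs) !(starK Hs).
Qed.

(** The span of the matrix units is the ideal isomorphic to M_2, and the elements annihilating the
    column form the complementary ideal. *)
Lemma block_has_M2_summand : has_M2_summand ip Bs.
Proof.
have [e0 hv vv cor blk] := Hb; have [Bb [B0 BD] BZ BM BA] := HBs.
pose J f := exists a, f = afun (mxrep a).
pose K f := exists T, [/\ pull Bs T, f = afun T & forall j, T * v j = 0].
have one_v j : mxrep 1%:M * v j = v j.
  rewrite mxrep_v (bigD1 j) //= big1 => [|i ij]; rewrite mxE.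
    by rewrite eqxx scale1r addr0.
  by rewrite (negbTE ij) scale0r.
exists J, K; split.
- split.
  + by move=> _ [a ->]; apply: pull_mxrep.
  + by exists 0; rewrite mxrep0.
  + by move=> _ _ [a ->] [b ->]; exists (1 *: a + b); rewrite mxrep_lin scale1r.
  + by move=> c _ [a ->]; exists (c *: a + 0); rewrite mxrep_lin mxrep0 addr0.
  + move=> S f /[dup] BS /lift_exists[T ?] [a ->]; subst S; split.
      by have [b hb] := mul_mxrep a BS; exists b; rewrite -hb.
    by have [b hb] := mxrep_mulr a BS; exists b; rewrite -hb.
- split.
  + by move=> _ [T [BT -> _]].
  + by exists 0; split=> // j; rewrite mul0r.
  + move=> _ _ [S [BS -> hS]] [T [BT -> hT]]; exists (S + T); split=> //; first exact: BD.
    by move=> j; rewrite mulrDl hS hT addr0.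
  + move=> c _ [S [BS -> hS]]; exists (c *: S); split=> //; first exact: BZ.
    by move=> j; rewrite -scalerAl hS scaler0.
  + move=> S _ /[dup] BS /lift_exists[U ?] [T [BT -> hT]]; subst S; split.
      by exists (U * T); split=> //; [exact: BM | move=> j; rewrite -mulrA hT mulr0].
    exists (T * U); split=> //; first exact: BM.
    move=> j; rewrite -mulrA (blk U j BS) mulr_sumr big1 // => k _.
    by rewrite !mulrA hT !mul0r.
- move=> _ [a ->] [T [BT hT Tv]]; have {}hT := adjop_inj hT.
  suff -> : mxrep a = 0 by [].
  rewrite -[a]mulmx1 mxrep_mul hT /mxrep mulr_sumr big1 // => i _.
  by rewrite mulr_sumr big1 // => j _; rewrite -scalerAr mulrA Tv mul0r scaler0.
- move=> f /[dup] Bf /lift_exists[T ?]; subst f.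
  (* [mxrep 1%:M] is the unit of the block: [T] times it is the component in [J], and the remainder
     kills the column. *)
  have [b hb] := mul_mxrep 1%:M Bf.
  exists (afun (mxrep b)), (afun (T - mxrep b)); split.
  + by exists b.
  + exists (T - mxrep b); split=> //; first by rewrite -scaleN1r; exact: (BD _ _ Bf (BZ (-1) _ (pull_mxrep b))).
    by move=> j; rewrite mulrBl -hb -mulrA one_v subrr.
  + by rewrite -[LHS]/(afun T) -{1}(subrKC (mxrep b) T).
exists (fun a => afun (mxrep a)); split.
- by move=> a; exists a.
- by move=> f [a ->]; exists a.
- split; first by move=> a b /adjop_inj/mxrep_inj.
  by move=> c a b; rewrite mxrep_lin.
- by move=> a b; rewrite mxrep_mul.
move=> a; have := aadjP (mxrep a); rewrite -[aadj _]/(afun (star (mxrep a))).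
by rewrite mxrep_star.
Qed.

End M2Summand.

End OperatorSubalgebra.

(** * Gluing along the directed family and the norm bound *)

Section Extension.
Local Open Scope classical_set_scope.
Variables (R : realType) (H : lmodType R[i]) (ip : H -> H -> R[i]).
Local Notation C := (R[i]).
Local Notation rc := (@real_complex R).
Variables (Hip : is_hilbert ip) (Hnt : exists x : H, x <> 0).
Local Notation adjop := (adjop_of Hip Hnt).
Local Notation star := (@astar R H ip Hip Hnt).
Local Notation pull := (@pull R H ip Hip Hnt).
Let Hs := astar_proper Hip Hnt.
Implicit Types (S T : adjop).

Lemma selfadjoint_form_real T x : star T = T -> complex.Im (ip (afun T x) x) = 0.
Proof.
move=> sT; have : ip (afun T x) x = Num.conj (ip (afun T x) x).
  by rewrite -(ip_conj Hip) aadjP -[aadj T]/(afun (star T)) sT.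
by case: (ip _ _) => a b; rewrite -[Num.conj _]/(Complex a (- b)) => -[] /=; lra.
Qed.

(** The forms of [T1] and [T2] are real, so on an eigenvector [y] the number l |y|^2 is the real or
    the imaginary part of the form of [T] itself. The norm of [T] thus bounds the eigenvalues of
    both parts directly; [j] selects the part. *)
Lemma eigenvalue_le T T1 T2 p (l : R) (j : bool) :
  bounded_op ip (afun T) -> T = T1 + Complex 0 1 *: T2 -> star T1 = T1 -> star T2 = T2 ->
  p != 0 -> (if j then T1 else T2) * p = rc l *: p ->
  `|l| <= opnorm ip (afun T).
Proof.
move=> hT TE s1 s2 p0 hp.
have [x hx] : exists x, afun p x <> 0.
  apply: contrapT => hn; move/eqP: p0; apply; apply: adjop_inj; apply/funext => x.
  by apply: contrapT => hx; apply: hn; exists x.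
set y := afun p x in hx; have y0 : y != 0 by apply/eqP.
have hy : afun (if j then T1 else T2) y = rc l *: y := congr1 (fun U : adjop => afun U x) hp.
have n0 := hnorm_gt0 Hip y0.
have form : ip (afun T y) y = ip (afun T1 y) y + Complex 0 1 * ip (afun T2 y) y.
  by rewrite TE -(ipZ Hip) -(ipD Hip).
have i1 := selfadjoint_form_real y s1; have i2 := selfadjoint_form_real y s2.
have le_op : hnorm ip (afun T y) * hnorm ip y <= opnorm ip (afun T) * hnorm ip y ^+ 2.
  by rewrite expr2 mulrA ler_wpM2r ?hnorm_ge0 // opnorm_le.
have [cs1 cs2] := cauchy_schwarz Hip (afun T y) y.
have lE : complex.Re (ip (afun (if j then T1 else T2) y) y) = l * hnorm ip y ^+ 2.
  rewrite hy (ipZ Hip) (hnorm_sqr Hip); have [-> _] := ip_real Hip y.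
  by rewrite -rmorphM.
rewrite -(ler_pM2r (_ : 0 < hnorm ip y ^+ 2)) ?exprn_gt0 //.
apply: le_trans le_op; rewrite -[X in `|l| * X]ger0_norm ?sqr_ge0 // -normrM -lE.
case: j lE {hp hy} => _; [apply: le_trans cs1 | apply: le_trans cs2]; rewrite form;
  move: i1 i2; case: (ip (afun T1 y) y) => a b; case: (ip (afun T2 y) y) => c d /= b0 d0;
  by rewrite ?b0 ?d0 ?(mul0r, mul1r, mulr0, mulr1, subr0, addr0, add0r, sub0r, oppr0).
Qed.

Variables (A : set (H -> H)) (mu : (H -> H) -> R) (I : Type) (Af : I -> set (H -> H)) (M : R).
Hypothesis HA : star_subalgebra ip A.
Hypothesis HAf : forall i, star_subalgebra ip (Af i) /\ fin_dim (Af i).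
Hypothesis Hdir : forall i j, exists k, Af i `<=` Af k /\ Af j `<=` Af k.
Hypothesis AE : A = \bigcup_i Af i.
Hypothesis HM2 : forall i, ~ has_M2_summand ip (Af i).
Hypothesis mu_add : fin_add_measure ip A mu.
Hypothesis mu_bound : forall p, is_projection ip A p -> `|mu p| <= M.

Let fdA i : fd_star_subalg star (pull (Af i)).
Proof. by have [h1 h2] := HAf i; apply: pull_fd. Qed.

Lemma Af_sub i f : Af i f -> A f.
Proof. by rewrite AE => h; exists i. Qed.

Lemma proj_A i T : proj star (pull (Af i)) T -> is_projection ip A (afun T).
Proof.
by move=> /pull_projP[a b c]; split=> //; apply: Af_sub a.
Qed.

Let nu T := mu (afun T).

Lemma nu_add i p q : proj star (pull (Af i)) p -> proj star (pull (Af i)) q ->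
  p * q = 0 -> nu (p + q) = nu p + nu q.
Proof.
move=> hp hq pq; apply: mu_add; [exact: proj_A hp | exact: proj_A hq |].
exact: (congr1 (@afun _ _ _ _ _) pq).
Qed.

Lemma nu_bound i p : proj star (pull (Af i)) p -> `|nu p| <= M.
Proof. by move=> /proj_A; apply: mu_bound. Qed.

Definition lin_on (B : adjop -> Prop) (phi : adjop -> C) :=
  forall c S T, B S -> B T -> phi (c *: S + T) = c * phi S + phi T.

Lemma local_extension i : exists phi, lin_on (pull (Af i)) phi /\
  forall p, proj star (pull (Af i)) p -> phi p = rc (nu p).
Proof.
apply: (local_gleason Hs (fdA i) (@nu_add i) (@nu_bound i)) => v e hb.
by have [h1 _] := HAf i; apply: HM2 (block_has_M2_summand h1 hb).
Qed.

Lemma pull_sub i k T : Af i `<=` Af k -> pull (Af i) T -> pull (Af k) T.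
Proof. by move=> h; apply: h. Qed.

Lemma proj_sub_Af i k p : Af i `<=` Af k -> proj star (pull (Af i)) p ->
  proj star (pull (Af k)) p.
Proof. by move=> h [a b c]; split=> //; apply: h. Qed.

Lemma global_extension : exists phi : adjop -> C,
  lin_on (pull A) phi /\ forall i p, proj star (pull (Af i)) p -> phi p = rc (nu p).
Proof.
have /boolp.choice[ph hph] := local_extension.
have agree i j T : pull (Af i) T -> pull (Af j) T -> ph i T = ph j T.
  have [k [ik jk]] := Hdir i j.
  have sub i' : Af i' `<=` Af k -> pull (Af i') T -> ph i' T = ph k T.
    move=> ik' hT; apply: (functional_unique Hs (fdA i')) => //.
    - by have [] := hph i'.
    - have [lk _] := hph k; move=> c S U hS hU; apply: lk; exact: pull_sub ik' _.
    - move=> p hp; have [_ ->] := hph i' => //; have [_ ->] := hph k => //.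
      exact: proj_sub_Af ik' hp.
  by move=> hi hj; rewrite (sub i) // (sub j).
have A0 : A (@op_zero R H) by have [_ [? _] _ _ _] := HA.
(* An index containing the zero operator, used as the default for elements outside [A]. *)
have [i0 _ _] : (\bigcup_i Af i) (@op_zero R H) by rewrite -AE.
have /boolp.choice[idx hidx] : forall T, exists i, pull A T -> pull (Af i) T.
  move=> T; have [hT|hT] := boolp.pselect (pull A T); last by exists i0.
  by move: (hT); rewrite /pull AE => -[i _ hi]; exists i.
have phE i T : pull (Af i) T -> ph (idx T) T = ph i T.
  by move=> hT; apply: agree => //; apply/hidx/Af_sub/hT.
exists (fun T => ph (idx T) T); split; last first.
  by move=> i p hp; rewrite (phE i); [have [_ ->] := hph i | case: hp].
move=> c S T /hidx hS /hidx hT; have [k [ik jk]] := Hdir (idx S) (idx T).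
have kS := pull_sub ik hS; have kT := pull_sub jk hT.
have kC : pull (Af k) (c *: S + T) by apply: (fdD (fdA k)) => //; apply: (fdZ (fdA k)).
by rewrite (phE k _ kC) (phE k _ kS) (phE k _ kT); have [lk _] := hph k; apply: lk.
Qed.

Lemma normc_le (a b : R) : Normc.normc (Complex a b) <= `|a| + `|b|.
Proof.
rewrite /= -(ler_pXn2r (_ : (0 < 2)%N)) ?nnegrE ?addr_ge0 ?sqrtr_ge0 // sqr_sqrtr.
  rewrite sqrrD !real_normK ?num_real //.
  have : 0 <= `|a| * `|b| by rewrite mulr_ge0.
  by lra.
by rewrite addr_ge0 ?sqr_ge0.
Qed.

(** Each self-adjoint part contributes at most 2 M times the norm of [T], and the modulus is at most
    the sum of the two contributions. *)
Lemma extension_bound (phi : adjop -> C) : lin_on (pull A) phi ->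
  (forall i p, proj star (pull (Af i)) p -> phi p = rc (nu p)) ->
  forall T, pull A T -> Normc.normc (phi T) <= 4 * M * opnorm ip (afun T).
Proof.
move=> lin hp T AT; have [i _ hi] : (\bigcup_i Af i) (afun T) by rewrite -AE.
have [T1 [T2 [TE s1 s2 hB]]] := real_imag Hs (fdA i) T; have [B1 B2] := hB hi.
have bT : bounded_op ip (afun T) by have [h _ _ _ _] := HA; apply: h.
have L0 := opnorm_ge0 Hip bT Hnt.
have lin_i : lin_on (pull (Af i)) phi.
  by move=> c S U hS hU; apply: lin; apply: (@Af_sub i).
have bnd j U : U = (if j then T1 else T2) -> pull (Af i) U -> star U = U ->
    exists2 r, phi U = rc r & `|r| <= 2 * M * opnorm ip (afun T).
  move=> UE BU sU.
  apply: (functional_bound Hs (fdA i) (@nu_add i) (@nu_bound i) lin_i (hp i) BU sU) => //.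
  by move=> p l _ p0 hl; apply: (eigenvalue_le (j := j) bT TE s1 s2 p0); rewrite -UE.
have [r1 e1 b1] := bnd true T1 erefl B1 s1; have [r2 e2 b2] := bnd false T2 erefl B2 s2.
have -> : phi T = Complex r1 r2.
  rewrite TE addrC lin_i // e1 e2.
  by apply/eqP; rewrite eq_complex /=; apply/andP; split; apply/eqP; ring.
by apply: le_trans (normc_le _ _) _; lra.
Qed.

Lemma nontrivial_case :
  (exists phi : (H -> H) -> C, bdd_lin_ext ip A mu phi) /\
  (forall phi1 phi2 : (H -> H) -> C,
      bdd_lin_ext ip A mu phi1 -> bdd_lin_ext ip A mu phi2 ->
      forall T : H -> H, A T -> phi1 T = phi2 T).
Proof.
split.
  have [phi [lin hp]] := global_extension.
  (* The functional lives on operators packaged with an adjoint, so elements of [A] are first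
     lifted; outside [A] the lift is arbitrary. *)
  have /boolp.choice[lift hlift] : forall f : H -> H, exists T : adjop, A f -> afun T = f.
    move=> f; have [hf|hf] := boolp.pselect (A f); last by exists 0.
    by have [T hT] := lift_exists Hip Hnt HA hf; exists T.
  have pl f : A f -> pull A (lift f) by move=> hf; rewrite /pull hlift.
  exists (fun f => phi (lift f)); split.
  - move=> a S T AS AT.
    have AST : A (op_add (op_scale a S) T).
      by have [_ [_ BD] BZ _ _] := HA; apply: BD => //; apply: BZ.
    rewrite -lin; [|exact: pl|exact: pl]; congr phi; apply: adjop_inj.
    by rewrite hlift //; apply/funext => x /=; rewrite !hlift.
  - exists (4 * M) => T AT; have := extension_bound lin hp (pl _ AT).
    by rewrite hlift.
  move=> p [Ap pp sp]; have [i _ hi] : (\bigcup_i Af i) p by rewrite -AE.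
  rewrite (hp i); first by rewrite /nu hlift.
  by apply/pull_projP; rewrite hlift.
move=> phi1 phi2 [l1 _ h1] [l2 _ h2] f Af_; have [T hT] := lift_exists Hip Hnt HA Af_.
have [i _ hi] : (\bigcup_i Af i) f by rewrite -AE.
rewrite -hT; apply: (functional_unique Hs (fdA i) (phi := fun T : adjop => phi1 (afun T))
  (psi := fun T : adjop => phi2 (afun T))).
- by move=> c S U hS hU; apply: l1; apply: (@Af_sub i).
- by move=> c S U hS hU; apply: l2; apply: (@Af_sub i).
- by move=> p /proj_A hp; rewrite h1 // h2.
by rewrite /pull hT.
Qed.

End Extension.

Theorem theorem8p9 (R : realType) (H : lmodType R[i]) (ip : H -> H -> R[i])
    (A : set (H -> H)) (mu : (H -> H) -> R) :
  is_hilbert ip ->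
  ultramatricial_N2 ip A ->
  fin_add_measure ip A mu ->
  (exists M : R, forall p, is_projection ip A p -> `|mu p| <= M) ->
  (exists phi : (H -> H) -> R[i], bdd_lin_ext ip A mu phi) /\
  (forall phi1 phi2 : (H -> H) -> R[i],
      bdd_lin_ext ip A mu phi1 -> bdd_lin_ext ip A mu phi2 ->
      forall T, A T -> phi1 T = phi2 T).
Proof.
move=> Hip [HA [I [Af [HAf Hdir AE HM2]]]] mu_add [M mu_bound].
have [Hnt|Htr] := boolp.pselect (exists x : H, x <> 0).
  exact: (nontrivial_case Hip Hnt HA HAf Hdir AE HM2 mu_add mu_bound).
(* On the zero space the adjointable operators do not form a nontrivial ring. Every operator is then
   [op_zero], additivity gives it measure 0, and the zero functional is the extension. *)
have H0 (x : H) : x = 0 by apply: contrapT => hx; apply: Htr; exists x.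
have all0 (f : H -> H) : f = @op_zero R H by apply/funext => x; rewrite (H0 (f x)).
have A0 : A (@op_zero R H) by have [_ [? _] _ _ _] := HA.
have p0 : is_projection ip A (@op_zero R H).
  by split=> // x y; rewrite (H0 (op_zero x)) (H0 (op_zero y)) (H0 x) (H0 y).
have mu0 : mu (@op_zero R H) = 0.
  have := mu_add _ _ p0 p0 (all0 _); rewrite (all0 (op_add _ _)); lra.
split.
  exists (fun=> 0); split.
  - by move=> a S T _ _; rewrite mulr0 addr0.
  - by exists 0 => T _; rewrite mul0r /= expr0n addr0 sqrtr0.
  by move=> p _; rewrite (all0 p) mu0.
by move=> phi1 phi2 [_ _ h1] [_ _ h2] T _; rewrite (all0 T) h1 // h2.
Qed.
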